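(* If $G \not\cong K_{2,3}$ is a connected, non-bipartite quadrangulation of a surface $S$ in which every $4$-cycle is facial, then $\mathrm{L}(G)$ is a double cover of $S$. Conversely, if $\mathrm{L}(G)$ is a closed surface, no neighborhood of $G$ dominates another, and $G$ is $K_{2,3}$-free, then $G$ is a quadrangulation of $\mathrm{L}(G)/\mathbb{Z}_2$ in which all $4$-cycles bound a face.
   Context: For a graph $G$, the neighborhood complex is $\mathrm{N}(G)=\{A\subseteq V(G)\mid \mathrm{CN}(A)\neq\emptyset\}$, where $\mathrm{CN}(A)$ is the set of common neighbors of $A$. The Lovász complex $\mathrm{L}(G)$ is the subcomplex of the barycentric subdivision of $\mathrm{N}(G)$ induced by the vertex set $\{A\subseteq V(G)\mid \mathrm{CN}^2(A)=A\}$; it carries a canonical free $\mathbb{Z}_2$-action $A\mapsto \mathrm{CN}(A)$. A quadrangulation of a surface is a graph embedded in it with every face bounded by a $4$-cycle. The neighborhood of $v$ dominates that of $u$ if $N(u)\subseteq N(v)$. A double cover of $X$ is a $\mathbb{Z}_2$-space whose orbit space is homeomorphic to $X$. *)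

(* Defs.v *)
From HB Require Import structures.
From mathcomp Require Import all_boot all_order all_algebra.

Set Implicit Arguments.
Unset Strict Implicit.
Unset Printing Implicit Defensive.

Record sgraph := SGraph {
  svertex :> finType;
  sedge : rel svertex;
  sedge_sym : symmetric sedge;
  sedge_irr : irreflexive sedge
}.

Definition sg_hom (G H : sgraph) (h : G -> H) : Prop :=
  forall x y, sedge x y -> sedge (h x) (h y).

Definition sg_isomorphic (G H : sgraph) : Prop :=
  exists h : G -> H, bijective h /\ forall x y, sedge (h x) (h y) = sedge x y.

(* [G] contains a copy of [H] as a subgraph, not necessarily induced *)
Definition sg_contains (G H : sgraph) : Prop :=
  exists h : H -> G, injective h /\ sg_hom h.

Definition sg_connected (G : sgraph) : Prop :=
  forall x y : G, connect (@sedge G) x y.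

Definition sg_bipartite (G : sgraph) : Prop :=
  exists c : G -> bool, forall x y, sedge x y -> c x != c y.

Section CompleteBipartite.
Variables m n : nat.

Definition cbip_edge (x y : 'I_m + 'I_n) : bool :=
  match x, y with inl _, inr _ | inr _, inl _ => true | _, _ => false end.

Lemma cbip_sym : symmetric cbip_edge. Proof. by case=> ? []. Qed.
Lemma cbip_irr : irreflexive cbip_edge. Proof. by case. Qed.

Definition complete_bipartite : sgraph := SGraph cbip_sym cbip_irr.
End CompleteBipartite.

Notation K23 := (complete_bipartite 2 3).

(* A 4-cycle is given by its vertices listed in cyclic order. *)
Definition four_cycle (G : sgraph) (p : seq G) : Prop :=
  size p = 4 /\ ucycle (@sedge G) p.

(* A finite simplicial complex is represented by its family of simplices. *)

Definition sd (T : finType) (K : {set {set T}}) : {set {set {set T}}} :=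
  [set C : {set {set T}} | (C \subset K :\ set0) &&
    [forall A in C, forall B in C, (A \subset B) || (B \subset A)]].

Definition induced_subcomplex (T : finType) (K : {set {set T}}) (W : {set T})
  : {set {set T}} := [set A in K | A \subset W].

(* The graph itself as a complex of dimension at most 1. *)
Definition graph_complex (G : sgraph) : {set {set G}} :=
  [set A : {set G} | (#|A| <= 1) ||
    [exists x, exists y, sedge x y && (A == [set x; y])]].

Section Lovasz.
Variable G : sgraph.
Implicit Types (A B : {set G}) (C : {set {set G}}).

Definition nbh (x : G) : {set G} := [set y | sedge x y].

Definition CN A : {set G} := [set y | [forall x in A, sedge x y]].

Definition dominates (v u : G) : Prop := nbh u \subset nbh v.

Definition neighborhood_complex : {set {set G}} := [set A | CN A != set0].

Definition lovasz_complex : {set {set {set G}}} :=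
  induced_subcomplex (sd neighborhood_complex) [set A | CN (CN A) == A].

Lemma CNP A y : reflect (forall x, x \in A -> sedge x y) (y \in CN A).
Proof. by rewrite inE; apply: forall_inP. Qed.

Lemma CN_sub A B : A \subset B -> CN B \subset CN A.
Proof.
move=> /subsetP AB; apply/subsetP => y /CNP yB.
by apply/CNP => x /AB; apply: yB.
Qed.

Lemma CN_disjoint A : A :&: CN A = set0.
Proof.
apply/setP => x; rewrite in_set0 in_setI; apply/negP => /andP[xA /CNP].
by move=> /(_ x xA); rewrite sedge_irr.
Qed.

Lemma lovasz_complexP C : reflect
  (forall A, A \in C -> [/\ A != set0, CN A != set0, CN (CN A) = A &
     forall B, B \in C -> (A \subset B) || (B \subset A)])
  (C \in lovasz_complex).
Proof.
rewrite !inE; apply: (iffP idP).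
  move=> /andP[/andP[/subsetP CK /forall_inP Cch] /subsetP Ccl] A AC.
  move: (CK _ AC) (Ccl _ AC); rewrite !inE => /andP[An0 CNn0] /eqP AA.
  by split=> // B BC; exact: (forall_inP (Cch _ AC)).
move=> H; apply/andP; split; last first.
  by apply/subsetP => A /H[_ _ AA _]; rewrite inE AA.
apply/andP; split.
  by apply/subsetP => A /H[An0 CNn0 _ _]; rewrite !inE An0.
apply/forall_inP => A /H[_ _ _ Ach]; exact/forall_inP.
Qed.

Lemma lovasz_complex_CN C : C \in lovasz_complex -> CN @: C \in lovasz_complex.
Proof.
move=> /lovasz_complexP H; apply/lovasz_complexP => _ /imsetP[A AC ->].
have [An0 CNn0 AA Ach] := H _ AC; split; rewrite ?AA //.
move=> _ /imsetP[B BC ->]; rewrite orbC.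
by case/orP: (Ach _ BC) => /CN_sub ->; rewrite ?orbT.
Qed.

End Lovasz.

From mathcomp Require Import all_classical all_reals all_analysis.
Import Order.TTheory GRing.Theory Num.Theory.
Import numFieldNormedType.Exports.

Local Open Scope classical_set_scope.
Local Open Scope ring_scope.

Definition homeomorphic (X Y : topologicalType) : Prop :=
  exists f : X -> Y, exists g : Y -> X,
    [/\ continuous f, continuous g, cancel f g & cancel g f].

(* Second countability is automatic for a compact locally Euclidean space.
   Connectedness is not part of the definition. *)
Definition closed_surface (R : realType) (S : topologicalType) : Prop :=
  [/\ [set: S] !=set0, hausdorff_space S, compact [set: S] &
      forall x : S, exists U : set S,
        [/\ open U, U x & homeomorphic (set_type U) (R * R)%type]].

(* Points are barycentric coordinates; with finitely many vertices the
   topology of pointwise convergence is the Euclidean one. *)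
Definition realization (R : realType) (T : finType) (K : {set {set T}})
  : set {ptws T -> R} :=
  [set t | [/\ forall x, 0 <= t x, \sum_x t x = 1 &
               [set x | t x != 0]%SET \in K]].
Arguments realization R {T} K _.

Definition polyhedron (R : realType) (T : finType) (K : {set {set T}})
  : topologicalType := set_type (realization R K).

(* Affine extension to barycentric coordinates of a map between vertex sets. *)
Definition pushforward (R : realType) (T U : finType) (h : T -> U)
  (t : {ptws T -> R}) : {ptws U -> R} := fun y => \sum_(x | h x == y) t x.

Lemma ptws_continuous (X : topologicalType) (I : Type)
    (K : I -> topologicalType) (f : X -> prod_topology K) :
  (forall i, continuous (fun x => f x i)) -> continuous f.
Proof.
move=> cf x; apply/cvg_sup => i A [/= _ [[W oW <-] /= Wf] /filterS]; apply.
by apply: (cf i x); exact: open_nbhs_nbhs.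
Qed.

Section Pushforward.
Variables (R : realType) (T U : finType) (h : T -> U).

Lemma pushforward_realization (K : {set {set T}}) (L : {set {set U}}) :
  (forall A, A \in K -> h @: A \in L) ->
  forall t, realization R K t -> realization R L (pushforward h t).
Proof.
move=> hK t [t0 t1 tK]; split.
- by move=> y; apply: sumr_ge0.
- by rewrite -t1 (partition_big h predT).
- suff -> : [set y | pushforward h t y != 0]%SET =
      h @: [set x | t x != 0]%SET by exact: hK.
  apply/setP => y; rewrite inE; apply/idP/imsetP => [|[x]].
    rewrite /pushforward psumr_neq0 //= => /hasP[x _ /andP[/eqP hx tx]].
    by exists x; rewrite ?inE ?gt_eqF.
  rewrite inE => tx ->; rewrite /pushforward psumr_neq0 //=; apply/hasP.
  by exists x; rewrite ?mem_index_enum // eqxx lt0r tx t0.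
Qed.

Lemma pushforward_continuous :
  continuous (@pushforward R T U h : {ptws T -> R} -> {ptws U -> R}).
Proof.
apply: ptws_continuous => y.
apply: (@continuous_big R T (fun a b : R => a + b) 0 (fun x => h x == y)).
  exact: add_continuous.
move=> x _; exact: (@proj_continuous T (fun _ => R) x).
Qed.

End Pushforward.

Record z2space := Z2Space {
  z2carrier :> topologicalType;
  z2act : z2carrier -> z2carrier;
  z2act_continuous : continuous z2act;
  z2actK : involutive z2act
}.

Section OrbitSpace.
Variable X : z2space.

Definition same_orbit (x y : X) : bool := (y == x) || (y == z2act x).

Lemma same_orbit_refl : reflexive same_orbit.
Proof. by move=> x; rewrite /same_orbit eqxx. Qed.

Lemma same_orbit_sym : symmetric same_orbit.
Proof.
move=> x y; rewrite /same_orbit eq_sym; congr orb.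
by apply/eqP/eqP => ->; rewrite z2actK.
Qed.

Lemma same_orbit_trans : transitive same_orbit.
Proof.
move=> y x z /orP[] /eqP -> /orP[] /eqP ->; rewrite /same_orbit ?z2actK ?eqxx //.
- by rewrite orbT.
- by rewrite orbT.
Qed.

Definition same_orbit_equiv :=
  EquivRel same_orbit same_orbit_refl same_orbit_sym same_orbit_trans.

Definition orbit_space : topologicalType :=
  quotient_topology {eq_quot same_orbit_equiv}%qT.

End OrbitSpace.

Definition double_cover (X : z2space) (S : topologicalType) : Prop :=
  homeomorphic (orbit_space X) S.


Section LovaszZ2.
Variables (R : realType) (G : sgraph).

Lemma lovasz_act_proof (t : polyhedron R (lovasz_complex G)) :
  realization R (lovasz_complex G) (pushforward (@CN G) (\val t)).
Proof.
by apply: pushforward_realization (@lovasz_complex_CN G) _ (set_valP t).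
Qed.

(* The simplicial involution given on vertices by [A |-> CN A]. *)
Definition lovasz_act (t : polyhedron R (lovasz_complex G)) :
  polyhedron R (lovasz_complex G) := SigSub (mem_set (lovasz_act_proof t)).

Lemma lovasz_act_continuous : continuous lovasz_act.
Proof.
apply: continuous_comp_initial => t.
apply: (@continuous_comp (polyhedron R (lovasz_complex G))
  {ptws {set G} -> R} {ptws {set G} -> R} set_val (pushforward (@CN G))).
  exact: initial_continuous.
exact: pushforward_continuous.
Qed.

Lemma lovasz_act_val (t : polyhedron R (lovasz_complex G)) A :
  CN (CN A) = A -> \val (lovasz_act t) A = \val t (CN A).
Proof.
have /= [_ _ /lovasz_complexP tL] := set_valP t => AA.
rewrite /= /pushforward (bigD1 (CN A)) ?AA //= big1 ?addr0 // => B.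
move=> /andP[/eqP <- nB]; apply: contraNeq nB => tB.
by have [|_ _ -> _] := tL B; rewrite ?inE.
Qed.

Lemma lovasz_act_closed (t : polyhedron R (lovasz_complex G)) A :
  \val t A != 0 -> [/\ A != finset.set0, CN A != finset.set0 & CN (CN A) = A].
Proof.
have /= [_ _ /lovasz_complexP tL] := set_valP t => tA.
by have [|? ? ? _] := tL A; rewrite ?inE.
Qed.

Lemma lovasz_actK : involutive lovasz_act.
Proof.
move=> t; apply: val_inj; apply: funext => A.
have [AA|nAA] := eqVneq (CN (CN A)) A.
  by rewrite !lovasz_act_val ?AA.
have tN (s : polyhedron R (lovasz_complex G)) : \val s A = 0.
  by apply: contraNeq nAA => /lovasz_act_closed[_ _ ->].
by rewrite !tN.
Qed.

Definition lovasz_space : z2space :=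
  Z2Space lovasz_act_continuous lovasz_actK.

Lemma lovasz_act_free (t : lovasz_space) : z2act t <> t.
Proof.
move=> tt; have /= [_ t1 /lovasz_complexP tL] := set_valP t.
have [A tA] : exists A, \val t A != 0.
  apply: contrapT => nt; move: t1; rewrite big1.
    by move/eqP; rewrite eq_sym oner_eq0.
  by move=> A _; apply: contrapT => /eqP tA; apply: nt; exists A.
have [An0 CAn0 AA] := lovasz_act_closed tA.
have tCA : \val t (CN A) != 0 by rewrite -(lovasz_act_val _ AA) [lovasz_act t]tt.
have [|_ _ _ /(_ (CN A))] := tL A; rewrite ?inE // => /(_ tCA) sACA.
have : A :&: CN A != finset.set0.
  by case/orP: sACA => [/finset.setIidPl|/finset.setIidPr] ->.
by rewrite CN_disjoint eqxx.
Qed.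

End LovaszZ2.

Section Quadrangulations.
Variables (R : realType) (G : sgraph) (S : topologicalType).
Implicit Type f : polyhedron R (graph_complex G) -> S.

(* For Hausdorff [S] this is an embedding, the domain being compact. *)
Definition graph_embedding f : Prop := continuous f /\ injective f.

Definition is_face f (F : set S) : Prop :=
  exists2 x : S, ~ range f x & F = connected_component (~` range f) x.

Definition cycle_points (p : seq G) : set (polyhedron R (graph_complex G)) :=
  [set t | exists2 x, x \in p &
     forall y, \val t y != 0 -> y = x \/ y = next p x].

(* The closure of [F] is a closed disc whose boundary circle is [p]. Asking
   only for [F] to be an open disc with frontier [p] would be too weak: the
   complement of a one-sided cycle in the projective plane is an open disc
   whose boundary walk traverses the cycle twice. *)
Definition bounded_by f (F : set S) (p : seq G) : Prop :=
  let D := [set z : R * R | z.1 ^+ 2 + z.2 ^+ 2 <= 1] in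
  exists phi : R * R -> S,
    [/\ {within D, continuous phi}, {in D &, injective phi},
        phi @` [set z | z.1 ^+ 2 + z.2 ^+ 2 < 1] = F &
        phi @` [set z | z.1 ^+ 2 + z.2 ^+ 2 = 1] = f @` cycle_points p].

Definition quadrangulation f : Prop :=
  [/\ closed_surface R S, graph_embedding f &
      forall F, is_face f F -> exists2 p, four_cycle p & bounded_by f F p].

Definition facial f (p : seq G) : Prop :=
  exists2 F, is_face f F & bounded_by f F p.

End Quadrangulations.

(* Main.v *)
Require Import Defs.
From mathcomp Require Import all_boot all_order all_algebra.
From mathcomp Require Import zify ring lra.

(** Write [N(v)] for the neighbourhood of [v]. If no two vertices of [G] have
    three common neighbours and no neighbourhood contains another, the closed
    sets are the singletons, the neighbourhoods and the diagonals [{a, c}] of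
    the 4-cycles [abcd]. The closed star of [{a, c}] in [L(G)] is then a square
    with corners [{a}], [N(b)], [{c}], [N(d)], and the involution exchanges it
    with the star of [{b, d}]; hence [L(G)/Z2] is obtained from [G] by gluing a
    disc into every 4-cycle. This gives the converse half directly.

    For the other half it remains to derive those two conditions from the
    quadrangulation, and to see that a 4-cycle bounds only one face. Both rest
    on invariance of domain in dimension two: along an edge, the closed discs
    of two different faces fill a neighbourhood, and one disc alone never does.
    So a family of faces in which every edge is used twice has an open and
    closed union, which contains all of [G]; two faces on one 4-cycle would
    make [G] a 4-cycle, and three faces on a theta graph would make it
    [K_{2,3}]. Invariance of domain itself follows from Tucker's lemma: if a
    value near [f 0] were missed by an injective [f], the map [f] could be
    deformed to a nowhere vanishing map of a square that is odd on the
    boundary. *)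

Set Implicit Arguments.
Unset Strict Implicit.
Unset Printing Implicit Defensive.

(** * Tucker's lemma on a square grid *)

(** The notion of a bounded face fixes its boundary circle only as a set. Every face is therefore
    reparametrised by a diamond on whose sides the embedding is affine; the same diamond carries the
    coordinates of the star of a diagonal in [L(G)]. Both surfaces thus become images of one finite
    family of diamonds, one for each 4-cycle up to symmetry, and compactness reduces the
    homeomorphism to checking that the two families identify the same points. Vertices resist the
    local argument, since arbitrarily many faces may meet there: two discs glued along an edge give
    neighbourhoods of its inner points only. Hence openness of a union of faces is proved off a
    finite set and then extended over it, a closed set that is open in a punctured ball and meets it
    being bound to fill it. *)

Section Tucker.
Variables (N : nat) (p q : nat -> nat -> bool).

(** The bits [p] and [q] place four labels on a cycle in the order 00, 01, 11, 10; opposite labels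
    are those that differ in both bits. *)
Definition not_opposite i j i' j' :=
  ~~ ((p i j != p i' j') && (q i j != q i' j')).

(* The crossings of one of the four sides of the label cycle; along a closed
   path without jumps between opposite labels their parity is that of the
   winding number. *)
Definition crossing i j i' j' :=
  [&& ~~ q i j, ~~ q i' j' & p i j != p i' j'].

Hypothesis no_jump : forall i j i' j',
  i <= N -> j <= N -> i' <= N -> j' <= N ->
  i <= i'.+1 -> i' <= i.+1 -> j <= j'.+1 -> j' <= j.+1 ->
  not_opposite i j i' j'.

Hypothesis antipodal : forall i j, i <= N -> j <= N ->
  [|| i == 0, i == N, j == 0 | j == N] ->
  (p (N - i) (N - j) = ~~ p i j) * (q (N - i) (N - j) = ~~ q i j).

(** The corners of a cell are pairwise non-opposite, so their labels lie on one side of the label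
    cycle, and a closed path that stays on one side crosses it an even number of times. *)
Lemma crossing_cell i j : i < N -> j < N ->
  crossing i j i.+1 j (+) crossing i j.+1 i.+1 j.+1 =
  crossing i j i j.+1 (+) crossing i.+1 j i.+1 j.+1.
Proof.
move=> iN jN.
have H a b a' b' : a <= 1 -> b <= 1 -> a' <= 1 -> b' <= 1 ->
    not_opposite (i + a) (j + b) (i + a') (j + b').
  by move=> *; apply: no_jump; lia.
move: (H 0 0 1 0 isT isT isT isT) (H 0 0 0 1 isT isT isT isT).
move: (H 0 0 1 1 isT isT isT isT) (H 1 0 0 1 isT isT isT isT).
move: (H 1 0 1 1 isT isT isT isT) (H 0 1 1 1 isT isT isT isT).
rewrite !addn0 !addn1 /not_opposite /crossing.
by do 4![case: (p _ _)]; do 4![case: (q _ _)].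
Qed.

Definition crossing_row k j := \big[addb/false]_(i < k) crossing i j i.+1 j.
Definition crossing_col i k := \big[addb/false]_(j < k) crossing i j i j.+1.

Lemma crossing_row_cell k j : k <= N -> j < N ->
  crossing_row k j (+) crossing_row k j.+1 =
  crossing 0 j 0 j.+1 (+) crossing k j k j.+1.
Proof.
rewrite /crossing_row => + jN; elim: k => [|k IH] kN.
  by rewrite !big_ord0; case: (crossing _ _ _ _).
rewrite !big_ord_recr /=; have := IH (ltnW kN); have := crossing_cell kN jN.
case: (crossing k j k.+1 j); case: (crossing k j.+1 k.+1 j.+1);
case: (crossing k j k j.+1); case: (crossing k.+1 j k.+1 j.+1) => //= _;
case: (\big[_/_]_(_ < _) _); case: (\big[_/_]_(_ < _) _) => //=;
by case: (crossing 0 j 0 j.+1).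
Qed.

(** Stokes' theorem modulo 2: the inner grid edges cancel when the cells are added up. *)
Lemma crossing_square k : k <= N ->
  crossing_row N 0 (+) crossing_row N k =
  crossing_col 0 k (+) crossing_col N k.
Proof.
rewrite /crossing_col; elim: k => [|k IH] kN.
  by rewrite !big_ord0; case: (crossing_row _ _).
rewrite !big_ord_recr /=; have := IH (ltnW kN).
have := crossing_row_cell (leqnn N) kN.
case: (crossing_row N k.+1); case: (crossing_row N k);
case: (crossing 0 k 0 k.+1); case: (crossing N k N k.+1) => //= _;
by case: (crossing_row _ _); case: (\big[_/_]_(_ < _) _);
   case: (\big[_/_]_(_ < _) _).
Qed.

(** The antipode of a bottom edge is a top edge, and its crossings correspond to those of the
    opposite side of the label cycle. Together the two count every change of [p] along the bottom,
    as [p] and [q] never change at once, and these changes telescope. *)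
Lemma crossing_row_antipodal :
  crossing_row N 0 (+) crossing_row N N = p 0 0 (+) p N 0.
Proof.
rewrite /crossing_row [X in _ (+) X](reindex_inj rev_ord_inj) /= -big_split /=.
transitivity (\big[addb/false]_(i < N) (p i 0 (+) p i.+1 0)).
  apply: eq_bigr => i _; have iN := ltn_ord i.
  have -> : (N - i.+1).+1 = N - i by lia.
  have [a b] : (p (N - i) N = ~~ p i 0) * (q (N - i) N = ~~ q i 0).
    by have := @antipodal _ 0; rewrite subn0; apply; lia.
  have [c d] : (p (N - i.+1) N = ~~ p i.+1 0) * (q (N - i.+1) N = ~~ q i.+1 0).
    by have := @antipodal _ 0; rewrite subn0; apply; lia.
  rewrite /crossing a b c d.
  have := no_jump (i := i) (j := 0) (i' := i.+1) (j' := 0).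
  rewrite /not_opposite => H.
  have {H} : ~~ ((p i 0 != p i.+1 0) && (q i 0 != q i.+1 0)) by apply: H; lia.
  by do 2![case: (p _ _)]; do 2![case: (q _ _)].
have -> : forall k, \big[addb/false]_(i < k) (p i 0 (+) p i.+1 0) =
    p 0 0 (+) p k 0; last by [].
elim=> [|k IH]; first by rewrite big_ord0; case: (p _ _).
rewrite big_ord_recr /= IH.
by case: (p 0 0); case: (p k 0); case: (p k.+1 0).
Qed.

Lemma crossing_col_antipodal :
  crossing_col 0 N (+) crossing_col N N = p N 0 (+) p N N.
Proof.
rewrite /crossing_col [X in X (+) _](reindex_inj rev_ord_inj) /= -big_split /=.
transitivity (\big[addb/false]_(j < N) (p N j (+) p N j.+1)).
  apply: eq_bigr => i _; have iN := ltn_ord i.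
  have -> : (N - i.+1).+1 = N - i by lia.
  have [a b] : (p 0 (N - i) = ~~ p N i) * (q 0 (N - i) = ~~ q N i).
    by have := @antipodal N; rewrite subnn; apply; lia.
  have [c d] : (p 0 (N - i.+1) = ~~ p N i.+1) * (q 0 (N - i.+1) = ~~ q N i.+1).
    by have := @antipodal N; rewrite subnn; apply; lia.
  rewrite /crossing a b c d.
  have := no_jump (i := N) (j := i) (i' := N) (j' := i.+1).
  rewrite /not_opposite => H.
  have {H} : ~~ ((p N i != p N i.+1) && (q N i != q N i.+1)) by apply: H; lia.
  by do 2![case: (p _ _)]; do 2![case: (q _ _)].
have -> : forall k, \big[addb/false]_(i < k) (p N i (+) p N i.+1) =
    p N 0 (+) p N k; last by [].
elim=> [|k IH]; first by rewrite big_ord0; case: (p _ _).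
rewrite big_ord_recr /= IH.
by case: (p N 0); case: (p N k); case: (p N k.+1).
Qed.

(** Antipodality makes [p] change an odd number of times along half of the boundary, so the whole
    boundary would have an odd number of crossings. *)
Theorem tucker_square : False.
Proof.
have := crossing_square (leqnn N).
rewrite crossing_row_antipodal crossing_col_antipodal.
have := antipodal (leqnn N) (leqnn N); rewrite eqxx orbT => /(_ isT) [+ _].
rewrite subnn => ->.
by case: (p N 0); case: (p N N).
Qed.

End Tucker.

(** * Combinatorics of the Lovász complex *)

Section Quads.
Variable G : sgraph.
Implicit Types (a b c d u v x y : G) (A B : {set G}) (C : {set {set G}}).

Definition quad a b c d : bool :=
  [&& sedge a b, sedge b c, sedge c d, sedge d a, a != c & b != d].

Lemma quad_rot a b c d : quad a b c d -> quad b c d a.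
Proof.
case/and5P=> ab bc cd da /andP[ac bd]; apply/and5P; split=> //.
by rewrite bd eq_sym.
Qed.

Lemma quad_flip a b c d : quad a b c d -> quad a d c b.
Proof.
case/and5P=> ab bc cd da /andP[ac bd].
by apply/and5P; split; rewrite 1?sedge_sym // ac eq_sym.
Qed.

Lemma quad_flop a b c d : quad a b c d -> quad c b a d.
Proof. by move=> q; do 2![apply: quad_rot]; exact: quad_flip. Qed.

Lemma four_cycleP (p : seq G) : four_cycle p <->
  exists a b c d, quad a b c d /\ p = [:: a; b; c; d].
Proof.
split=> [[]|[a [b [c [d [q ->]]]]]].
  case: p => [|a [|b [|c [|d []]]]] //= _ /andP[/= /and5P[ab bc cd da _]].
  rewrite !inE !negb_or => /and4P[/and3P[_ ac _] /andP[_ bd] _ _].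
  by exists a, b, c, d; split=> //; apply/and5P; rewrite ac bd.
case/and5P: q => ab bc cd da /andP[ac bd]; split=> //; apply/andP; split.
  by rewrite /= ab bc cd da.
have ne x y : sedge x y -> x != y by apply: contraTneq => ->; rewrite sedge_irr.
have da' : a != d by rewrite eq_sym ne.
by rewrite /= !inE !negb_or ac bd da' !ne.
Qed.

Definition quad_edge a b c d u v : bool :=
  [|| (u == a) && (v == b), (u == b) && (v == c), (u == c) && (v == d) |
      (u == d) && (v == a)].

(** The eight listings of a 4-cycle, under rotation and reflection, are those with the same
    unordered pair of diagonals. *)
Definition same_quad (p p' : G * G * G * G) : bool :=
  let: (a, b, c, d) := p in let: (a', b', c', d') := p' in
  ([set a; c] == [set a'; c']) && ([set b; d] == [set b'; d']) ||
  ([set a; c] == [set b'; d']) && ([set b; d] == [set a'; c']).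

Lemma same_quad_refl p : same_quad p p.
Proof. by case: p => [[[a b] c] d]; rewrite /= !eqxx. Qed.

Lemma same_quad_sym : symmetric same_quad.
Proof.
case=> [[[a b] c] d] [[[a' b'] c'] d'] /=.
by rewrite ![_ == [set a'; c']]eq_sym ![_ == [set b'; d']]eq_sym
  [X in _ || X]andbC.
Qed.

Lemma same_quad_trans : transitive same_quad.
Proof.
case=> [[[a b] c] d] [[[a' b'] c'] d'] [[[a2 b2] c2] d2] /=.
by move=> /orP[]/andP[/eqP-> /eqP->] /orP[]/andP[/eqP-> /eqP->];
   rewrite !eqxx ?orbT.
Qed.

Lemma set2_inj a c a' c' : a != c -> [set a; c] = [set a'; c'] ->
  a = a' /\ c = c' \/ a = c' /\ c = a'.
Proof.
move=> ac E.
have : a \in [set a'; c'] by rewrite -E set21.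
have : c \in [set a'; c'] by rewrite -E set22.
rewrite !inE => /orP[]/eqP cE /orP[]/eqP aE; subst.
- by rewrite eqxx in ac.
- by right.
- by left.
- by rewrite eqxx in ac.
Qed.

Definition quadP (p : G * G * G * G) : bool :=
  let: (a, b, c, d) := p in quad a b c d.

Definition qedge (p : G * G * G * G) u v : bool :=
  let: (a, b, c, d) := p in quad_edge a b c d u v || quad_edge a b c d v u.

Lemma qedgeE a b c d u v : qedge (a, b, c, d) u v =
  (u \in [set a; c]) && (v \in [set b; d]) ||
  (u \in [set b; d]) && (v \in [set a; c]).
Proof.
rewrite /= /quad_edge !inE.
by do 8![case: (_ == _)].
Qed.

Lemma same_quad_qedge p p' u v : same_quad p p' -> qedge p u v = qedge p' u v.
Proof.
case: p p' => [[[a b] c] d] [[[a' b'] c'] d'] /orP[]/andP[/eqP E /eqP E'];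
by rewrite !qedgeE E E' // orbC.
Qed.

Lemma quad_disjoint a b c d x : quad a b c d -> x \in [set a; c] ->
  x \in [set b; d] = false.
Proof.
case/and5P=> ab bc cd da _; rewrite !inE.
by case/orP=> /eqP->; apply/negP => /orP[]/eqP E; move: ab bc cd da;
  rewrite E ?sedge_irr.
Qed.

(** This is how a face determines its 4-cycle. The edges [ab], [ad] and [cb] put [b] and [d] on the
    diagonal of the second cycle opposite to [a], and [c] on that of [a]; inclusions between pairs
    are equalities. *)
Lemma qedge_sub_same_quad p p' : quadP p -> quadP p' ->
  (forall u v, qedge p u v -> qedge p' u v) -> same_quad p p'.
Proof.
case: p p' => [[[a b] c] d] [[[a' b'] c'] d'] /= q q' sub.
have [ac bd] : a != c /\ b != d by case/and5P: q => _ _ _ _ /andP[].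
have {}sub u v : u \in [set a; c] -> v \in [set b; d] ->
    (u \in [set a'; c']) && (v \in [set b'; d']) ||
    (u \in [set b'; d']) && (v \in [set a'; c']).
  by move=> uac vbd; rewrite -qedgeE; apply: sub; rewrite -/(qedge (a, b, c, d) u v)
    qedgeE uac vbd.
have card2 (x y x' y' : G) : x != y -> x \in [set x'; y'] -> y \in [set x'; y'] ->
    [set x; y] == [set x'; y'].
  move=> xy hx hy; rewrite eqEcard !cards2 xy.
  have -> : [set x; y] \subset [set x'; y'] by apply/subsetP => w /set2P[]->.
  by case: (x' != y').
have := sub a b; have := sub a d; have := sub c b; rewrite !set21 !set22.
move=> /(_ isT isT) cb /(_ isT isT) ad /(_ isT isT).
case/orP => /andP[a1 b1]; apply/orP; [left|right]; apply/andP.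
- have a2 := quad_disjoint q' a1; rewrite a2 orbF a1 /= in ad.
  have c1 : c \in [set a'; c'].
    by case/orP: cb => /andP[] // _ b2; rewrite (quad_disjoint q' b2) in b1.
  by split; exact: card2.
- have a2 : a \in [set a'; c'] = false.
    by apply/negP => h; rewrite (quad_disjoint q' h) in a1.
  rewrite a2 a1 /= in ad.
  have c1 : c \in [set b'; d'].
    by case/orP: cb => /andP[] // _ b2; rewrite (quad_disjoint q' b1) in b2.
  by split; exact: card2.
Qed.

(** * Copies of [K23] spanned by two vertices with three common neighbours *)

Section K23Map.
Variables a c x y z : G.
Let s := [:: a; c; x; y; z].

Definition k23_map (k : K23) : G :=
  match k with inl i => nth a s i | inr j => nth a s (2 + j) end.

Lemma k23_map_inj : uniq s -> injective k23_map.
Proof.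
move=> us.
have lt2 (i : 'I_2) : i < size s by rewrite (leq_trans (ltn_ord i)).
have lt3 (j : 'I_3) : 2 + j < size s.
  by rewrite (leq_trans (_ : _ < 2 + 3)) // ltn_add2l.
move=> [i|j] [i'|j'] /eqP; rewrite nth_uniq ?lt2 ?lt3 // => /eqP E.
- by congr inl; apply: val_inj.
- by have := ltn_ord i; rewrite E.
- by have := ltn_ord i'; rewrite -E.
- by congr inr; apply: val_inj; apply/eqP; rewrite -(eqn_add2l 2) E.
Qed.

Lemma k23_map_hom : sedge a x -> sedge a y -> sedge a z ->
  sedge c x -> sedge c y -> sedge c z -> sg_hom k23_map.
Proof.
move=> ax ay az cx cy cz [i|j] [i'|j'] //= _.
  by case: i => [[|[|]]] // ?; case: j' => [[|[|[|]]]] // ?.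
by rewrite sedge_sym; case: i' => [[|[|]]] // ?; case: j => [[|[|[|]]]] // ?.
Qed.

Lemma k23_map_surj u : u \in s -> exists k, k23_map k = u.
Proof.
rewrite !inE => /or4P[|||/orP[]]/eqP->.
- by exists (inl ord0).
- by exists (inl (lift ord0 ord0)).
- by exists (inr ord0).
- by exists (inr (lift ord0 ord0)).
- by exists (inr (lift ord0 (lift ord0 ord0))).
Qed.

Lemma k23_map_isomorphic : uniq s -> (forall u, u \in s) ->
  sg_hom k23_map ->
  (forall u v, sedge u v -> (u \in [set a; c]) != (v \in [set a; c])) ->
  sg_isomorphic G K23.
Proof.
move=> us alls hom bip.
have surj u := k23_map_surj (alls u).
have pick_ex u : {k | k23_map k == u}.
  by apply: sigW; have [k ku] := surj u; exists k; rewrite ku.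
pose h u := sval (pick_ex u).
have hK : cancel h k23_map by move=> u; rewrite /h; case: (pick_ex u) => k /= /eqP.
have Kh : cancel k23_map h by move=> k; apply: (k23_map_inj us); rewrite hK.
exists h; split; first by exists k23_map.
have side (k : K23) : (k23_map k \in [set a; c]) = if k is inl _ then true else false.
  move: us; rewrite /= !inE !negb_or => /and5P[/and4P[_ ax ay az] /and3P[cx cy cz] _ _ _].
  case: k => [[[|[|]] //= ?]|[[|[|[|]]] //= ?]]; rewrite ?inE ?eqxx ?orbT //.
  - by rewrite ![x == _]eq_sym (negPf ax) (negPf cx).
  - by rewrite ![y == _]eq_sym (negPf ay) (negPf cy).
  - by rewrite ![z == _]eq_sym (negPf az) (negPf cz).
move=> u v; rewrite -{2}(hK u) -{2}(hK v); apply/idP/idP; first exact: hom.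
by move=> /bip; rewrite !side; case: (h u) => ?; case: (h v).
Qed.

End K23Map.

(** * Closed sets and simplices of a regular graph *)

Section Regular.

(** The degree condition keeps neighbourhoods apart from singletons: a single edge [uv] satisfies
    the first two clauses, but there [nbh u] is the singleton of [v]. *)
Definition lovasz_regular : Prop :=
  [/\ forall a c, a != c -> #|CN [set a; c]| <= 2,
      forall u v, nbh u \subset nbh v -> u = v &
      forall u, 1 < #|nbh u|].

Hypothesis reg : lovasz_regular.

Lemma mem_nbh u v : (v \in nbh u) = sedge u v.
Proof. by rewrite inE. Qed.

Lemma CN1 u : CN [set u] = nbh u.
Proof.
apply/setP => v; rewrite mem_nbh; apply/CNP/idP => [H|uv x /set1P->] //.
by apply: H; rewrite set11.
Qed.

Lemma mem_CN2 a c v : (v \in CN [set a; c]) = sedge a v && sedge c v.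
Proof.
apply/CNP/andP => [H|[av cv] x /set2P[]->] //.
by split; apply: H; rewrite !inE eqxx ?orbT.
Qed.

Lemma CN_nbh u : CN (nbh u) = [set u].
Proof.
have [_ dom _] := reg; apply/setP => v; rewrite inE; apply/CNP/eqP => [H|->].
  apply/esym; apply: dom; apply/subsetP => x /H; rewrite mem_nbh sedge_sym //.
by move=> x; rewrite mem_nbh sedge_sym.
Qed.

Lemma nbh_inj : injective (@nbh G).
Proof. by move=> u v E; have [_ dom _] := reg; apply: dom; rewrite E. Qed.

Lemma quad_CN a b c d : quad a b c d -> CN [set a; c] = [set b; d].
Proof.
have [two _ _] := reg; case/and5P=> ab bc cd da /andP[ac bd].
apply/esym/eqP; rewrite eqEcard cards2 bd two // andbT.
apply/subsetP => x /set2P[]->; rewrite mem_CN2; apply/andP; split => //.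
- by rewrite sedge_sym.
- by rewrite sedge_sym.
Qed.

(** Among closed sets this singles out the diagonals of 4-cycles: a singleton is too small, and for
    a neighbourhood [CN A] is. On closed sets the test is invariant under [CN]. *)
Definition is_diagonal A : bool := (1 < #|A|) && (1 < #|CN A|).

Lemma diagonal1 u : is_diagonal [set u] = false.
Proof. by rewrite /is_diagonal cards1. Qed.

Lemma diagonal_nbh u : is_diagonal (nbh u) = false.
Proof. by rewrite /is_diagonal CN_nbh cards1 andbF. Qed.

Lemma diagonal_quad a b c d : quad a b c d -> is_diagonal [set a; c].
Proof.
move=> q; rewrite /is_diagonal (quad_CN q); case/and5P: q => _ _ _ _ /andP[ac bd].
by rewrite !cards2 ac bd.
Qed.

(** If neither [A] nor [CN A] is a singleton, two elements of each form a 4-cycle [abcd]; then [A],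
    being [CN (CN A)], lies in the set of common neighbours of [b] and [d], which regularity bounds
    by two elements. *)
Lemma lovasz_closedP A : A != set0 -> CN A != set0 -> CN (CN A) = A ->
  [\/ exists u, A = [set u], exists v, A = nbh v |
      exists a b c d, quad a b c d /\ A = [set a; c]].
Proof.
move=> A0 CA0 AA; have [A1|A1] := leqP #|A| 1.
  have /cards1P[u ->] : #|A| == 1 by rewrite eqn_leq A1 card_gt0.
  by constructor 1; exists u.
have [CA1|CA1] := leqP #|CN A| 1.
  have /cards1P[v E] : #|CN A| == 1 by rewrite eqn_leq CA1 card_gt0.
  by constructor 2; exists v; rewrite -AA E CN1.
have /card_gt1P[a [c [aA cA ac]]] := A1.
have /card_gt1P[b [d [bA dA bd]]] := CA1.
have q : quad a b c d.
  move/CNP: bA => bA; move/CNP: dA => dA; apply/and5P.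
  by rewrite !bA // ac bd dA // sedge_sym bA // sedge_sym dA.
constructor 3; exists a, b, c, d; split => //; apply/eqP.
rewrite eqEsubset; apply/andP; split; last first.
  by apply/subsetP => x /set2P[]->.
have sub : [set b; d] \subset CN A by apply/subsetP => x /set2P[]->.
by rewrite -{1}AA; apply: subset_trans (CN_sub sub) _;
  rewrite (quad_CN (quad_rot q)) setUC.
Qed.

Lemma nbhN1 u v : nbh v != [set u].
Proof.
by have [_ _ two] := reg; apply: contraTneq (two v) => ->; rewrite cards1.
Qed.

Lemma quad_diagN1 a b c d u : quad a b c d -> [set a; c] != [set u].
Proof. by move/diagonal_quad; apply: contraTneq => ->; rewrite diagonal1. Qed.

Lemma quad_diagNnbh a b c d u : quad a b c d -> [set a; c] != nbh u.
Proof. by move/diagonal_quad; apply: contraTneq => ->; rewrite diagonal_nbh. Qed.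

(** The link of a diagonal: below it there is room for singletons only, above it for neighbourhoods
    of common neighbours, and another diagonal has the same size. *)
Lemma quad_diag_comparable a b c d B : quad a b c d ->
  B != set0 -> CN B != set0 -> CN (CN B) = B ->
  ([set a; c] \subset B) || (B \subset [set a; c]) ->
  B \in [:: [set a]; [set c]; [set a; c]; nbh b; nbh d].
Proof.
move=> q B0 CB0 BB cmp.
have [_ _ two] := reg.
have ac : a != c by case/and5P: q => _ _ _ _ /andP[].
have c2 : #|[set a; c]| = 2 by rewrite cards2 ac.
have [[u E]|[v E]|[a' [b' [c' [d' [q' E]]]]]] := lovasz_closedP B0 CB0 BB; subst B.
- case/orP: cmp => [/subset_leq_card|]; first by rewrite c2 cards1.
  by rewrite sub1set !inE => /orP[]/eqP->; rewrite eqxx ?orbT.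
- have {}cmp : [set a; c] \subset nbh v.
    case/orP: cmp => // s; have /eqP E : nbh v == [set a; c].
      by rewrite eqEcard s c2 two.
    by move: (quad_diagNnbh v q); rewrite E eqxx.
  have : v \in CN [set a; c].
    apply/CNP => x xac; rewrite sedge_sym -mem_nbh.
    by move/subsetP: cmp; apply.
  by rewrite (quad_CN q) !inE => /orP[]/eqP->; rewrite eqxx ?orbT.
- have ac' : a' != c' by case/and5P: q' => _ _ _ _ /andP[].
  have /eqP-> : [set a'; c'] == [set a; c].
    case/orP: cmp => s; first by rewrite eq_sym eqEcard s !cards2 ac ac'.
    by rewrite eqEcard s !cards2 ac ac'.
  by rewrite !inE eqxx ?orbT.
Qed.

Lemma lovasz_edge C u v : sedge u v -> C \subset [set [set u]; nbh v] ->
  C \in lovasz_complex G.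
Proof.
move=> uv /subsetP sC; apply/lovasz_complexP => A /sC.
have [_ _ two] := reg.
have n0 x : nbh x != set0 by rewrite -card_gt0 (ltn_trans _ (two x)).
have s0 x : [set x] != set0 :> {set G} by rewrite -card_gt0 cards1.
have uv' : [set u] \subset nbh v by rewrite sub1set mem_nbh sedge_sym.
by move=> /set2P[]->; rewrite ?CN1 ?CN_nbh ?CN1; split => // B /sC/set2P[]->;
  rewrite ?uv' ?subxx ?orbT.
Qed.

Lemma lovasz_quad C a b c d : quad a b c d ->
  C \subset [set [set a]; [set a; c]; nbh b] -> C \in lovasz_complex G.
Proof.
move=> q /subsetP sC; apply/lovasz_complexP => A /sC.
have [_ _ two] := reg.
have n0 x : nbh x != set0 by rewrite -card_gt0 (ltn_trans _ (two x)).
have s0 x : [set x] != set0 :> {set G} by rewrite -card_gt0 cards1.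
have d0 x y : [set x; y] != set0 :> {set G}.
  by apply/set0Pn; exists x; rewrite set21.
have CE := quad_CN q; have := quad_CN (quad_rot q); rewrite [RHS]setUC => CE'.
have s1 : [set a] \subset [set a; c] by rewrite sub1set set21.
have s2 : [set a; c] \subset nbh b.
  case/and5P: q => ab bc _ _ _; apply/subsetP => x /set2P[]->;
  by rewrite mem_nbh // sedge_sym.
have s3 : [set a] \subset nbh b by exact: subset_trans s2.
by move=> /setUP[/set2P[]->|/set1P->]; rewrite ?CE ?CE' ?CN1 ?CN_nbh ?CN1;
  split => // B /sC/setUP[/set2P[]->|/set1P->]; rewrite ?s1 ?s2 ?s3 ?subxx ?orbT.
Qed.

(** By regularity a chain has at most one singleton and at most one neighbourhood. When a chain
    without diagonal lacks one of them, the degree condition supplies an edge that completes it. *)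
Lemma lovasz_simplexP C : C \in lovasz_complex G -> C != set0 ->
  (exists u v, sedge u v /\ C \subset [set [set u]; nbh v]) \/
  (exists a b c d, quad a b c d /\
     C \subset [set [set a]; [set a; c]; nbh b]).
Proof.
have [_ dom two] := reg => /lovasz_complexP LC C0.
have [[A AiC dA]|nd] : (exists2 A, A \in C & is_diagonal A) \/
    (forall A, A \in C -> ~~ is_diagonal A).
  have [/existsP[A /andP[AiC dA]]|/existsPn H] :=
    boolP [exists A, (A \in C) && is_diagonal A]; first by left; exists A.
  by right=> A AiC; have := H A; rewrite AiC.
- right; have [A0 CA0 AA cmp] := LC _ AiC.
  have [[u E]|[v E]|[a [b [c [d [q E]]]]]] := lovasz_closedP A0 CA0 AA.
  + by rewrite E diagonal1 in dA.
  + by rewrite E diagonal_nbh in dA.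
  rewrite {}E in A0 CA0 AA cmp AiC dA.
  have memC B : B \in C -> B \in [:: [set a]; [set c]; [set a; c]; nbh b; nbh d].
    move=> BC; have [B0 CB0 BB cmp'] := LC _ BC.
    exact: (quad_diag_comparable q B0 CB0 BB (cmp _ BC)).
  have [n_ac n_bd] : a != c /\ b != d by case/and5P: q => _ _ _ _ /andP[].
  have not1 : ~~ (([set a] \in C) && ([set c] \in C)).
    apply/negP => /andP[aC cC]; have [_ _ _ /(_ _ cC)] := LC _ aC.
    by rewrite !sub1set !inE [c == a]eq_sym orbb (negPf n_ac).
  have not2 : ~~ ((nbh b \in C) && (nbh d \in C)).
    apply/negP => /andP[bC dC]; have [_ _ _ /(_ _ dC)] := LC _ bC.
    by case/orP => /dom/eqP; rewrite 1?[d == b]eq_sym (negPf n_bd).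
  (* Relabelling within each diagonal makes [a'] and [b'] the corners that may occur in [C]. *)
  pose a' := if [set c] \in C then c else a.
  pose c' := if [set c] \in C then a else c.
  pose b' := if nbh d \in C then d else b.
  pose d' := if nbh d \in C then b else d.
  exists a', b', c', d'; split.
    rewrite /a' /b' /c' /d'; do 2![case: ifP => _] => //.
    - by apply: quad_flip; exact: quad_flop.
    - exact: quad_flop.
    - exact: quad_flip.
  have E : [set a'; c'] = [set a; c] by rewrite /a' /c'; case: ifP; rewrite // setUC.
  rewrite E; apply/subsetP => B BC; have := memC B BC.
  rewrite !inE => /or4P[/eqP E'|/eqP E'|/eqP->|/orP[]/eqP E'].
  + by move: BC not1; rewrite E' /a' => -> /= /negPf->; rewrite eqxx.
  + by move: BC; rewrite E' /a' => ->; rewrite eqxx.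
  + by rewrite eqxx orbT.
  + by move: BC not2; rewrite E' /b' => -> /= /negPf->; rewrite eqxx orbT.
  + by move: BC; rewrite E' /b' => ->; rewrite eqxx orbT.
left.
have kind A : A \in C -> (exists u, A = [set u]) \/ (exists v, A = nbh v).
  move=> AiC; have [A0 CA0 AA _] := LC _ AiC.
  have [?|?|[a [b [c [d [q E]]]]]] := lovasz_closedP A0 CA0 AA; [by left|by right|].
  by have := nd _ AiC; rewrite E (diagonal_quad q).
have uniq1 u u' : [set u] \in C -> [set u'] \in C -> u = u'.
  move=> uC uC'; have [_ _ _ /(_ _ uC')] := LC _ uC.
  by rewrite !sub1set !inE [u' == u]eq_sym orbb => /eqP.
have uniq2 v v' : nbh v \in C -> nbh v' \in C -> v = v'.
  move=> vC vC'; have [_ _ _ /(_ _ vC')] := LC _ vC.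
  by case/orP => /dom.
have edge u v : [set u] \in C -> nbh v \in C -> sedge u v.
  move=> uC vC; have [_ _ _ /(_ _ vC)] := LC _ uC.
  case/orP; first by rewrite sub1set mem_nbh sedge_sym.
  by move=> /subset_leq_card; rewrite cards1 leqNgt two.
have [/existsP[u uC]|/existsPn nu] := boolP [exists u, [set u] \in C].
- have [/existsP[v vC]|/existsPn nv] := boolP [exists v, nbh v \in C].
    exists u, v; split; first exact: edge.
    apply/subsetP => A AiC; rewrite !inE.
    case: (kind A AiC) => [] [x E]; rewrite E in AiC *.
      by rewrite (uniq1 _ _ AiC uC) eqxx.
    by rewrite (uniq2 _ _ AiC vC) eqxx orbT.
  have [v uv] : exists v, sedge u v.
    have /card_gt0P[v] : 0 < #|nbh u| by exact: ltn_trans (two u).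
    by rewrite mem_nbh; exists v.
  exists u, v; split => //; apply/subsetP => A AiC; rewrite !inE.
  case: (kind A AiC) => [] [x E]; rewrite E in AiC *.
    by rewrite (uniq1 _ _ AiC uC) eqxx.
  by have := nv x; rewrite AiC.
have [v vC] : exists v, nbh v \in C.
  have /set0Pn[A AiC] := C0; case: (kind A AiC) => [] [x E]; rewrite E in AiC.
    by have := nu x; rewrite AiC.
  by exists x.
have [u uv] : exists u, sedge v u.
  have /card_gt0P[u] : 0 < #|nbh v| by exact: ltn_trans (two v).
  by rewrite mem_nbh; exists u.
exists u, v; rewrite sedge_sym; split => //; apply/subsetP => A AiC; rewrite !inE.
case: (kind A AiC) => [] [x E]; rewrite E in AiC *.
  by have := nu x; rewrite AiC.
by rewrite (uniq2 _ _ AiC vC) eqxx orbT.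
Qed.

End Regular.
End Quads.


From mathcomp Require Import all_classical all_reals all_analysis.
Import Order.TTheory GRing.Theory Num.Theory.
Import numFieldNormedType.Exports.

Local Open Scope classical_set_scope.
Local Open Scope ring_scope.

(** * Invariance of domain in the plane *)

Section ContinuousOperations.
Context {R : realType} {V : normedModType R} {T : topologicalType}.
Implicit Types (f g : T -> V) (k l : T -> R).

Lemma contD f g : continuous f -> continuous g ->
  continuous (fun x => f x + g x).
Proof. by move=> cf cg x; apply: cvgD; [exact: cf | exact: cg]. Qed.

Lemma contN f : continuous f -> continuous (fun x => - f x).
Proof. by move=> cf x; apply: cvgN; exact: cf. Qed.

Lemma contB f g : continuous f -> continuous g ->
  continuous (fun x => f x - g x).
Proof. by move=> cf cg; apply: contD => //; exact: contN. Qed.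

Lemma contZ k f : continuous k -> continuous f ->
  continuous (fun x => k x *: f x).
Proof. by move=> ck cf x; apply: cvgZ; [exact: ck | exact: cf]. Qed.

Lemma contM k l : continuous k -> continuous l ->
  continuous (fun x => k x * l x).
Proof. by move=> ck cl x; apply: cvgM; [exact: ck | exact: cl]. Qed.

Lemma contV k : (forall x, k x != 0) -> continuous k ->
  continuous (fun x => (k x)^-1).
Proof. by move=> k0 ck x; apply: cvgV => //; exact: ck. Qed.

Lemma contnorm f : continuous f -> continuous (fun x => `|f x|).
Proof. by move=> cf x; apply: cvg_norm; exact: cf. Qed.

Lemma contmax k l : continuous k -> continuous l ->
  continuous (fun x => Num.max (k x) (l x)).
Proof. by move=> ck cl; exact: max_fun_continuous. Qed.

Lemma contmin k l : continuous k -> continuous l ->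
  continuous (fun x => Num.min (k x) (l x)).
Proof. by move=> ck cl; exact: min_fun_continuous. Qed.

Lemma contcst (U : topologicalType) (c : U) : continuous (fun _ : T => c).
Proof. by move=> x; exact: cvg_cst. Qed.

Lemma contpair k l : continuous k -> continuous l ->
  continuous (fun x => (k x, l x) : R * R).
Proof.
move=> ck cl x; apply: (@cvg_pair _ _ _ _ (nbhs (k x)) (nbhs (l x))).
  exact: ck.
exact: cl.
Qed.

Lemma contcomp (U W : topologicalType) (g : U -> W) (h : T -> U) :
  continuous g -> continuous h -> continuous (fun x => g (h x)).
Proof. by move=> cg ch x; apply: continuous_comp; [exact: ch | exact: cg]. Qed.

End ContinuousOperations.

Section Plane.
Variable R : realType.
Implicit Types (z w h : R * R).

Lemma norm_prodE z : `|z| = Num.max `|z.1| `|z.2|.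
Proof. by []. Qed.

Lemma norm_prod_le z (r : R) : (`|z| <= r) = (`|z.1| <= r) && (`|z.2| <= r).
Proof. by rewrite norm_prodE ge_max. Qed.

Lemma norm_prod_lt z (r : R) : (`|z| < r) = (`|z.1| < r) && (`|z.2| < r).
Proof. by rewrite norm_prodE gt_max. Qed.

Lemma square_compact (r : R) : compact [set z : R * R | `|z| <= r].
Proof.
rewrite (_ : [set _ | _] = `[- r, r] `*` `[- r, r]).
  by apply: compact_setX; exact: segment_compact.
apply/seteqP; split => z /=; rewrite norm_prod_le !in_itv /= !ler_norml.
  by move=> /andP[].
by move=> [-> ->].
Qed.

Lemma fst_continuous : continuous (fst : R * R -> R).
Proof. by move=> z; exact: cvg_fst. Qed.

Lemma snd_continuous : continuous (snd : R * R -> R).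
Proof. by move=> z; exact: cvg_snd. Qed.

(** The pair of labels records the dominant coordinate and its sign: 00 to the right, 11 to the
    left, 10 above, 01 below. Opposite directions thus differ in both bits. *)
Definition label1 h : bool := if `|h.2| <= `|h.1| then h.1 < 0 else 0 < h.2.
Definition label2 h : bool := if `|h.2| <= `|h.1| then h.1 < 0 else h.2 < 0.

Lemma labelN h : h != 0 ->
  (label1 (- h) = ~~ label1 h) * (label2 (- h) = ~~ label2 h).
Proof.
case: h => a b h0; rewrite /label1 /label2 /= !normrN.
have [ba|ab] := leP `|b| `|a|.
  have a0 : a != 0.
    apply: contraNneq h0 => a0; move: ba; rewrite a0 normr0 normr_le0 => /eqP->.
    by [].
  by rewrite oppr_lt0 -leNgt le_eqVlt eq_sym (negPf a0).
have b0 : b != 0 by apply: contraTneq ab => ->; rewrite normr0 -leNgt.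
rewrite oppr_lt0 oppr_gt0 -!leNgt.
by rewrite !le_eqVlt (negPf b0) eq_sym (negPf b0).
Qed.

(** A displacement shorter than [h] in the maximum norm cannot reverse the sign of the dominant
    coordinate of [h], and a change of the dominant coordinate leads to an adjacent label only. *)
Lemma label_near h h' : `|h' - h| < `|h| ->
  ~~ ((label1 h != label1 h') && (label2 h != label2 h')).
Proof.
case: h h' => a b [a' b']; rewrite norm_prod_lt /= /label1 /label2 /=.
rewrite norm_prodE /= => /andP[Ha Hb].
have absN (x y : R) : `|y - x| < `|x| -> (0 < x) = (0 < y) /\ (x < 0) = (y < 0).
  have [x0|x0|->] := ltgtP x 0; last by rewrite normr0 ltNge normr_ge0.
    by rewrite (ltr0_norm x0) ltr_norml => /andP[y1 y2]; split; lra.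
  by rewrite (gtr0_norm x0) ltr_norml => /andP[y1 y2]; split; lra.
have [ba|ab] := leP `|b| `|a|; have [ba'|ab'] := leP `|b'| `|a'|.
- by have [|_ ->] := absN a a'; [rewrite (max_idPl ba) in Ha | rewrite eqxx].
- have b'0 : b' != 0 by apply: contraTneq ab' => ->; rewrite normr0 -leNgt.
  by case: (a < 0) => /=; case: ltgtP b'0.
- have b0 : b != 0 by apply: contraTneq ab => ->; rewrite normr0 -leNgt.
  by case: (a' < 0) => /=; case: ltgtP b0.
- by have [|_ ->] := absN b b';
    [rewrite (max_idPr (ltW ab)) in Hb | rewrite eqxx andbF].
Qed.

(** A Lebesgue number argument; [2 / N.+1] is the mesh of the grid that cuts [-1, 1] into [N.+1]
    intervals. *)
Lemma local_variation (H : R * R -> R * R) : continuous H ->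
  (forall z, `|z| <= 1 -> H z != 0) ->
  exists N, forall z w, `|z| <= 1 -> `|w - z| <= 2 / N.+1%:R ->
    `|H w - H z| < `|H z|.
Proof.
move=> cH H0.
have /compact_near_coveringP/(_ nat \oo (fun N z =>
  forall w, `|w - z| <= 2 / N.+1%:R -> `|H w - H z| < `|H z|)) :=
  @square_compact 1.
move=> /(_ _) [|N _ HN]; last by exists N => z w z1; exact: HN N (leqnn N) z z1 w.
move=> z /= z1; have e0 : 0 < `|H z| by rewrite normr_gt0 H0.
(* With a quarter, two values near [H z] differ by less than half of its norm, while each keeps more
   than three quarters of it. *)
have /cvgrPdist_lt/(_ (`|H z| / 4)) := cH z.
have e4 : 0 < `|H z| / 4 by rewrite divr_gt0.
move=> /(_ e4)/nbhs_ballP[r /= r0 Hr].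
have Hr' w : `|w - z| < r -> `|H z - H w| < `|H z| / 4.
  by move=> ?; apply: Hr; rewrite -ball_normE /= distrC.
have r4 : 0 < r / 4 by rewrite divr_gt0.
near=> z' N => w wz'.
have zz' : `|z' - z| < r / 2.
  near: z'; apply/nbhs_ballP; exists (r / 2); first by rewrite /= divr_gt0.
  by move=> y; rewrite -ball_normE /= distrC.
have Nr : 2 / N.+1%:R < r / 2.
  suff : N.+1%:R^-1 < r / 4 by move: (N.+1%:R^-1) => x; lra.
  by near: N; exact: (near_infty_natSinv_lt (PosNum r4)).
have wz2 := le_lt_trans wz' Nr.
have wz : `|w - z| < r.
  have -> : w - z = (w - z') + (z' - z) by rewrite addrA subrK.
  by have := ler_normD (w - z') (z' - z); lra.
have h1 := Hr' _ wz.
have h2 : `|H z - H z'| < `|H z| / 4 by apply: Hr'; lra.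
have h3 : `|H w - H z'| <= `|H z - H w| + `|H z - H z'|.
  have -> : H w - H z' = (H z - H z') - (H z - H w).
    by rewrite opprB [RHS]addrC addrA subrK.
  by rewrite [leRHS]addrC; exact: ler_normB.
have h4 : `|H z| <= `|H z - H z'| + `|H z'|.
  by rewrite -{1}(subrK (H z') (H z)); exact: ler_normD.
lra.
Unshelve. all: by end_near. Qed.

Theorem borsuk_ulam_plane (H : R * R -> R * R) : continuous H ->
  (forall z, `|z| <= 1 -> H z != 0) ->
  (forall z, `|z| = 1 -> H (- z) = - H z) -> False.
Proof.
move=> cH H0 Hodd.
have [n Hn] := local_variation cH H0.
pose N := n.+1; pose g (i : nat) : R := -1 + 2 * (i%:R / N%:R).
have N0 : 0 < N%:R :> R by rewrite ltr0n.
have gN i : (i <= N)%N -> g (N - i)%N = - g i.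
  by move=> iN; rewrite /g natrB // mulrBl divff ?gt_eqF //; lra.
have g1 i : (i <= N)%N -> `|g i| <= 1.
  move=> iN; have : i%:R / N%:R <= 1 :> R.
    by rewrite ler_pdivrMr // mul1r ler_nat.
  have : 0 <= i%:R / N%:R :> R by rewrite divr_ge0.
  by rewrite ler_norml /g; lra.
have gB i j : (i <= j.+1)%N -> (j <= i.+1)%N -> `|g i - g j| <= 2 / N%:R.
  move=> ij ji.
  have -> : g i - g j = 2 / N%:R * (i%:R - j%:R) by rewrite /g; ring.
  have d0 : 0 < 2 / N%:R :> R by rewrite divr_gt0.
  rewrite normrM (gtr0_norm d0) -[leRHS]mulr1 ler_pM2l //.
  move: ij ji; rewrite -!(ler_nat R) -!natr1 ler_norml => *; lra.
apply: (@tucker_square N (fun i j => label1 (H (g i, g j)))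
                        (fun i j => label2 (H (g i, g j)))).
- move=> i j i' j' iN jN i'N j'N *; apply: label_near; apply: Hn.
    by rewrite norm_prod_le /= !g1.
  by rewrite norm_prod_le /= !gB.
- move=> i j iN jN bd; rewrite !gN //.
  have -> : (- g i, - g j) = - (g i, g j) by [].
  have n1 : `|(g i, g j)| <= 1 by rewrite norm_prod_le /= !g1.
  have g0E : g 0%N = -1 by rewrite /g mul0r mulr0 addr0.
  have gNE : g N = 1 by rewrite /g divff ?gt_eqF //; lra.
  rewrite Hodd; first exact: labelN (H0 _ n1).
  apply/le_anti; rewrite n1 norm_prodE /= le_max.
  by case/or4P: bd => /eqP ->; rewrite ?g0E ?gNE ?normrN1 ?normr1 ?lexx ?orbT.
Qed.

(** The radial retraction of the plane onto the unit ball of the maximum norm, which is a square. *)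
Definition clamp_disc z : R * R := (Num.max 1 `|z|)^-1 *: z.

Lemma clamp_disc_continuous : continuous clamp_disc.
Proof.
apply: contZ => [|z]; last exact: cvg_id.
apply: contV => [z|]; first by rewrite gt_eqF // lt_max ltr01.
by apply: contmax; [exact: contcst | apply: contnorm => z; exact: cvg_id].
Qed.

Lemma clamp_disc_le1 z : `|clamp_disc z| <= 1.
Proof.
have m0 : 0 < Num.max 1 `|z| by rewrite lt_max ltr01.
rewrite /clamp_disc normrZ gtr0_norm ?invr_gt0 // mulrC ler_pdivrMr // mul1r.
by rewrite le_max lexx orbT.
Qed.

Lemma clamp_disc_id z : `|z| <= 1 -> clamp_disc z = z.
Proof. by move=> z1; rewrite /clamp_disc (max_idPl z1) invr1 scale1r. Qed.

Lemma clamp_disc_out z : 1 <= `|z| -> clamp_disc z = `|z|^-1 *: z.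
Proof. by move=> z1; rewrite /clamp_disc (max_idPr z1). Qed.

Definition clamp01 (x : R) : R := Num.max 0 (Num.min 1 x).

Lemma clamp01_continuous : continuous clamp01.
Proof.
apply: contmax; first exact: contcst.
by apply: contmin => [|x]; [exact: contcst | exact: cvg_id].
Qed.

Lemma clamp01_ge0 x : 0 <= clamp01 x.
Proof. by rewrite le_max lexx. Qed.

Lemma clamp01_le1 x : clamp01 x <= 1.
Proof. by rewrite ge_max ler01 ge_min lexx. Qed.

Lemma clamp01_0 x : x <= 0 -> clamp01 x = 0.
Proof.
move=> x0; apply/max_idPl; rewrite ge_min x0 orbT //.
Qed.

Lemma clamp01_1 x : 1 <= x -> clamp01 x = 1.
Proof. by move=> x1; rewrite /clamp01 (min_idPl x1); apply/max_idPr. Qed.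

Section InvarianceOfDomain.
Variable f : R * R -> R * R.
Hypothesis cf : continuous f.
Hypothesis injf : forall z w, `|z| <= 1 -> `|w| <= 1 -> f z = f w -> z = w.

(* If [c] near [f 0] were not a value of [f], the nonvanishing map
   [f - c] on the unit square would be joined, on collars of width one, first
   to [f - f 0] by moving [c] to [f 0], and then to the odd map
   [z |-> f (z / 2) - f (- z / 2)]; injectivity keeps it nonvanishing. *)
Definition odd_homotopy (c : R * R) z : R * R :=
  let w := clamp_disc (3 *: z) in
  let a := clamp01 (`|3 *: z| - 1) in
  let t := clamp01 (`|3 *: z| - 2) in
  f ((1 + t)^-1 *: w) - f (- (t / (1 + t)) *: w) - (1 - a) *: (c - f 0).

Lemma odd_homotopy_continuous c : continuous (odd_homotopy c).
Proof.
have c3 : continuous (fun z : R * R => 3 *: z).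
  by apply: contZ => [|z]; [exact: contcst | exact: cvg_id].
have cw : continuous (fun z : R * R => clamp_disc (3 *: z)).
  by apply: contcomp => //; exact: clamp_disc_continuous.
have ct (r : R) : continuous (fun z : R * R => clamp01 (`|3 *: z| - r)).
  apply: contcomp; first exact: clamp01_continuous.
  by apply: contB; [exact: contnorm | exact: contcst].
have ci : continuous (fun z : R * R => (1 + clamp01 (`|3 *: z| - 2))^-1).
  apply: contV => [z|]; first by rewrite gt_eqF // ltr_wpDr ?clamp01_ge0.
  by apply: contD => //; exact: contcst.
apply: contB; first apply: contB.
- by apply: contcomp => //; exact: contZ.
- by apply: contcomp => //; apply: contZ => //; apply: contN; exact: contM.
- by apply: contZ; [apply: contB => //; exact: contcst | exact: contcst].
Qed.

Lemma odd_homotopy_odd c z : `|z| = 1 ->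
  odd_homotopy c (- z) = - odd_homotopy c z.
Proof.
move=> z1; have z3 (s : R * R) : `|s| = 1 -> `|3 *: s| = 3.
  by move=> s1; rewrite normrZ s1 mulr1 ger0_norm.
rewrite /odd_homotopy !z3 ?normrN //.
rewrite !clamp01_1; [|lra|lra].
rewrite subrr !scale0r !subr0 opprB scalerN !clamp_disc_out ?normrN ?z3 //;
  [|lra|lra].
congr (f _ - f _); rewrite ?scalerN ?scaleNr ?opprK ?mul1r //.
Qed.

(** Inside, the value is [f w - c]. On the first collar a zero would make [f w - f 0] a shrunken
    copy of [c - f 0], too short because [mu] bounds it from below. On the second, injectivity would
    equate a nonnegative and a nonpositive multiple of a unit vector, the former nonzero. *)
Lemma odd_homotopy_neq0 c z (mu : R) :
  (forall w, `|w| = 1 -> mu <= `|f w - f 0|) -> `|c - f 0| < mu ->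
  (forall w, `|w| <= 1 -> f w != c) -> odd_homotopy c z != 0.
Proof.
move=> mu_le c_mu fc; rewrite /odd_homotopy.
set w := 3 *: z; have [w1|w1] := leP `|w| 1.
  rewrite clamp_disc_id // !clamp01_0 ?subr_le0 //; last by lra.
  rewrite mul0r addr0 invr1 subr0 oppr0 scale0r !scale1r opprB addrA subrK.
  by rewrite subr_eq0 fc.
have n1 : `|clamp_disc w| = 1.
  rewrite clamp_disc_out ?ltW // normrZ ger0_norm ?invr_ge0 // mulVf //.
  by rewrite gt_eqF // (lt_trans _ w1).
have [w2|w2] := leP `|w| 2.
  rewrite (@clamp01_0 (_ - 2)) ?subr_le0 // mul0r addr0 invr1 oppr0 scale0r.
  rewrite scale1r subr_eq0; apply/eqP => E.
  have := mu_le _ n1; rewrite E normrZ ger0_norm; last first.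
    by rewrite subr_ge0 clamp01_le1.
  apply/negP; rewrite -ltNge; apply: le_lt_trans c_mu.
  by rewrite ler_piMl // gerBl clamp01_ge0.
rewrite (@clamp01_1 (_ - 1)); last by lra.
rewrite subrr scale0r subr0 subr_eq0; apply/eqP.
set t := clamp01 _; have t0 : 0 <= t by exact: clamp01_ge0.
have t1 : t <= 1 by exact: clamp01_le1.
have i0 : 0 < 1 + t by lra.
move=> /injf E; have {E} : (1 + t)^-1 *: clamp_disc w =
    - (t / (1 + t)) *: clamp_disc w.
  apply: E; rewrite normrZ n1 mulr1 ?normrN ger0_norm ?divr_ge0 ?invr_ge0 //;
    try lra.
    by rewrite invf_le1 //; lra.
  by rewrite ler_pdivrMr //; lra.
move/eqP; rewrite -subr_eq0 -scalerBl opprK scaler_eq0 => /orP[|/eqP w0].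
  by rewrite -[X in X + _]mul1r -mulrDl divff ?gt_eqF // oner_eq0.
by move: n1; rewrite w0 normr0 => /eqP; rewrite eq_sym oner_eq0.
Qed.

Lemma image_square_nbhs : nbhs (f 0) (f @` [set z | `|z| <= 1]).
Proof.
have [mu mu0 mu_le] : exists2 mu : R, 0 < mu &
    forall w, `|w| = 1 -> mu <= `|f w - f 0|.
  have cK : closed (f @` [set z | `|z| = 1]).
    apply: compact_closed; first exact: norm_hausdorff.
    apply: continuous_compact; first exact: continuous_subspaceT.
    rewrite (_ : [set _ | _] = [set z | `|z| <= 1] `&` Num.norm @^-1` [set 1]).
      apply: compact_closedI; first exact: square_compact.
      apply: closed_comp => [z _|]; first exact: norm_continuous.
      exact: closed_eq.
    by apply/seteqP; split => z /= => [->|[]].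
  have : nbhs (f 0) (~` (f @` [set z | `|z| = 1])).
    apply: open_nbhs_nbhs; split; first exact: closed_openC.
    move=> [w /= w1 /injf]; rewrite w1 normr0 lexx ler01 => /(_ isT isT) w0.
    by move: w1; rewrite w0 normr0 => /eqP; rewrite eq_sym oner_eq0.
  move=> /nbhs_ballP[mu /= mu0 H]; exists mu => // w w1.
  rewrite leNgt; apply/negP => lt; apply: (H (f w)); last by exists w.
  by rewrite -ball_normE /= distrC.
apply/nbhs_ballP; exists mu => //= c; rewrite -ball_normE /= distrC => c_mu.
apply: contrapT => nc.
apply: (@borsuk_ulam_plane (odd_homotopy c)).
- exact: odd_homotopy_continuous.
- move=> z _; apply: odd_homotopy_neq0 mu_le c_mu _ => w w1.
  by apply/eqP => fw; apply: nc; exists w.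
- exact: odd_homotopy_odd.
Qed.

End InvarianceOfDomain.

Theorem invariance_of_domain (f : R * R -> R * R) (O : set (R * R)) :
  open O -> (forall z, O z -> {for z, continuous f}) ->
  (forall z w, O z -> O w -> f z = f w -> z = w) -> open (f @` O).
Proof.
move=> oO cf injf; rewrite openE => _ [x Ox <-].
have : nbhs x O by exact: open_nbhs_nbhs.
move=> /nbhs_ballP[e /= e0 He].
pose r := e / 2; have r0 : 0 < r by rewrite divr_gt0.
(* The clamp replaces [f], continuous only on [O], by a map that is continuous on the whole plane;
   half of the radius keeps the closed square inside the ball. *)
pose k z : R * R := x + r *: clamp_disc z.
have kO z : O (k z).
  apply: He; rewrite -ball_normE /= opprD addrA subrr sub0r normrN normrZ.
  rewrite gtr0_norm //; apply: (@le_lt_trans _ _ r); last by rewrite /r; lra.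
  by rewrite ler_piMr ?clamp_disc_le1 // ltW.
have ck : continuous k.
  apply: contD; first exact: contcst.
  by apply: contZ; [exact: contcst | exact: clamp_disc_continuous].
have /= := @image_square_nbhs (f \o k).
have -> : k 0 = x by rewrite /k clamp_disc_id ?normr0 // scaler0 addr0.
move=> H.
apply: filterS (H _ _); first by move=> _ [z z1 <-]; exists (k z).
  by move=> z; apply: continuous_comp; [exact: ck | exact: cf].
move=> z w z1 w1 /injf E; have /addrI := E (kO z) (kO w).
rewrite !clamp_disc_id // => /eqP; rewrite -subr_eq0 -scalerBr scaler_eq0.
by rewrite gt_eqF //= subr_eq0 => /eqP.
Qed.

End Plane.

(** * Finite covers, charts and surfaces *)

Section FiniteCovers.
Variables (I : finType) (P : pred I) (T : topologicalType) (A : set T).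
Hypothesis cptA : compact A.

(** The images of the compact set [A] under the [al i] are finitely many closed sets, so [X] has the
    quotient topology of their disjoint union: a preimage under [g] is a finite union of compact
    images. *)
Lemma finite_cover_continuous (X Y : topologicalType) (al : I -> T -> X)
    (g : X -> Y) : hausdorff_space X ->
  (forall i, P i -> {within A, continuous (al i)}) ->
  (forall x, exists i z, [/\ P i, A z & al i z = x]) ->
  (forall i, P i -> {within A, continuous (g \o al i)}) -> continuous g.
Proof.
move=> hX cal cov cg; apply/continuous_closedP => C clC.
rewrite (_ : g @^-1` C = \bigcup_(i in [set i | P i])
    al i @` (A `&` (g \o al i) @^-1` C)); last first.
  apply/seteqP; split => [x /= gx|x [i Pi [z [Az Cz] <-]]] //=.
  by have [i [z [Pi Az E]]] := cov x; exists i => //; exists z => //=; rewrite E.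
apply: closed_bigcup => [|i Pi]; first exact: finite_finset.
apply: compact_closed => //; apply: continuous_compact.
  by apply: continuous_subspaceW (cal i Pi) => z [].
have /continuous_closedP/(_ _ clC)/closed_subspaceP[V clV VE] := cg i Pi.
by rewrite setIC -VE setIC; apply: compact_closedI.
Qed.

(** Two quotients of the same finite union of copies of [A] are homeomorphic as soon as they make
    the same identifications. This replaces an explicit gluing of surfaces. *)
Lemma finite_cover_homeomorphic (X Y : topologicalType)
    (al : I -> T -> X) (be : I -> T -> Y) :
  hausdorff_space X -> hausdorff_space Y ->
  (forall i, P i -> {within A, continuous (al i)}) ->
  (forall i, P i -> {within A, continuous (be i)}) ->
  (forall x, exists i z, [/\ P i, A z & al i z = x]) ->
  (forall y, exists i z, [/\ P i, A z & be i z = y]) ->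
  (forall i j z w, P i -> P j -> A z -> A w ->
    al i z = al j w <-> be i z = be j w) -> homeomorphic X Y.
Proof.
move=> hX hY cal cbe covX covY abE.
have /choice[g gP] : forall x, exists y, forall i z, P i -> A z -> al i z = x ->
    be i z = y.
  move=> x; have [i [z [Pi Az E]]] := covX x; exists (be i z) => j w Pj Aw E'.
  by apply/abE; rewrite // E.
have /choice[k kP] : forall y, exists x, forall i z, P i -> A z -> be i z = y ->
    al i z = x.
  move=> y; have [i [z [Pi Az E]]] := covY y; exists (al i z) => j w Pj Aw E'.
  by apply/abE; rewrite // E.
exists g, k; split.
- apply: (finite_cover_continuous hX cal covX) => i Pi.
  apply: subspace_eq_continuous (cbe i Pi) => z /set_mem Az.
  exact: gP.
- apply: (finite_cover_continuous hY cbe covY) => i Pi.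
  apply: subspace_eq_continuous (cal i Pi) => z /set_mem Az.
  exact: kP.
- move=> x; have [i [z [Pi Az E]]] := covX x.
  by rewrite -{2}E; symmetry; apply: kP => //; exact: gP.
- move=> y; have [i [z [Pi Az E]]] := covY y.
  by rewrite -{2}E; symmetry; apply: gP => //; exact: kP.
Qed.

End FiniteCovers.

Lemma compact_inverse_continuous (T X : topologicalType) (A : set T)
    (al : T -> X) (ga : X -> T) : hausdorff_space X -> compact A ->
  {within A, continuous al} -> (forall z, A z -> ga (al z) = z) ->
  {within al @` A, continuous ga}.
Proof.
move=> hX cptA cal gaK; apply/continuous_closedP => C clC.
apply/closed_subspaceP; exists (al @` (A `&` C)).
  apply: compact_closed => //; apply: continuous_compact.
    by apply: continuous_subspaceW cal => z [].
  exact: compact_closedI.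
apply/seteqP; split => [x [[z [Az Cz] <-] _]|x [+ [z Az E]]].
  by split; [rewrite /from_subspace /= gaK | exists z].
by rewrite /from_subspace /= -E gaK // => Cz; split; exists z.
Qed.

(** * Charts, invariance of domain on surfaces, and openness off a finite set *)

Section Charts.
Variable R : realType.

(** Both maps are total, with [kap] arbitrary outside [U]; this avoids working in the subspace type
    of [U]. *)
Definition is_chart (S : topologicalType) (U : set S) (chi : R * R -> S)
    (kap : S -> R * R) :=
  [/\ open U, continuous chi, cancel chi kap, forall z, U (chi z) &
      forall y, U y -> chi (kap y) = y /\ {for y, continuous kap}].

Lemma chart_homeomorphicP (S : topologicalType) (U : set S) :
  open U /\ homeomorphic (set_type U) (R * R)%type <->
  exists chi kap, is_chart U chi kap.
Proof.
split=> [[oU [f [g [cf cg fK gK]]]]|[chi [kap [oU cc cK Uc kP]]]].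
  exists (fun z => \val (g z)), (valL_ 0 f); split => //.
  - move=> z; apply: continuous_comp; first exact: cg.
    exact: initial_continuous.
  - move=> z; have := @valLK _ _ 0 U f => /(congr1 (fun h => h (g z))).
    by rewrite /sigL /= => ->; exact: gK.
  - by move=> z; exact: set_valP.
  - have := iffRL (@subspace_valL_continuousP' S U (R * R)%type 0 f) cf.
    rewrite continuous_open_subspace // => cv y Uy; split; last first.
      by apply: cv; exact/mem_set.
    have := @valLK _ _ 0 U f => /(congr1 (fun h => h (exist _ y (mem_set Uy)))).
    by rewrite /sigL /= => ->; rewrite fK.
split=> //.
pose g z : set_type U := exist _ (chi z) (mem_set (Uc z)).
exists (fun y => kap (\val y)), g; split.
- move=> y; apply: (@continuous_comp (set_type U) S _ set_val kap).
    exact: initial_continuous.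
  by have [_] := kP _ (set_valP y).
- by apply: continuous_comp_initial => z; exact: cc.
- by move=> y; apply: val_inj => /=; have [->] := kP _ (set_valP y).
- by move=> z; rewrite /= cK.
Qed.

Lemma surface_chart (S : topologicalType) : closed_surface R S ->
  forall x : S, exists U chi kap, U x /\ is_chart U chi kap.
Proof.
move=> [_ _ _ H] x; have [U [oU Ux hU]] := H x.
have /chart_homeomorphicP[chi [kap ch]] := conj oU hU.
by exists U, chi, kap.
Qed.

Lemma chart_open (S : topologicalType) (U : set S) chi kap (V : set (R * R)) :
  is_chart U chi kap -> open V -> open (chi @` V).
Proof.
move=> [oU cc cK Uc kP] oV.
have -> : chi @` V = U `&` kap @^-1` V.
  apply/seteqP; split => [_ [z Vz <-]|y [Uy Vy]].
    by split; [exact: Uc | rewrite /= cK].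
  by exists (kap y) => //; have [] := kP y Uy.
move: V oV; apply/(continuous_inP kap oU) => y /set_mem Uy.
by have [] := kP y Uy.
Qed.

Lemma surface_invariance_of_domain (S : topologicalType) (psi : R * R -> S)
    (O : set (R * R)) : closed_surface R S -> open O ->
  (forall z, O z -> {for z, continuous psi}) ->
  (forall z w, O z -> O w -> psi z = psi w -> z = w) -> open (psi @` O).
Proof.
move=> hS oO cpsi ipsi; rewrite openE => _ [z0 Oz0 <-].
have [U [chi [kap [Ux ch]]]] := surface_chart hS (psi z0).
have [oU cc cK Uc kP] := ch.
pose O' := O `&` psi @^-1` U.
have oO' : open O'.
  apply: (iffLR (continuous_inP psi oO)) => // z /set_mem Oz; exact: cpsi.
have oI : open ((kap \o psi) @` O').
  apply: invariance_of_domain => //.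
    move=> z [Oz Uz]; apply: continuous_comp; first exact: cpsi.
    by have [] := kP _ Uz.
  move=> z w [Oz Uz] [Ow Uw] /= E; apply: ipsi => //.
  by have [<- _] := kP _ Uz; have [<- _] := kP _ Uw; rewrite E.
have := chart_open ch oI; rewrite openE => H.
apply: filterS (H (psi z0) _).
  by move=> _ [_ [z [Oz Uz] <-] <-]; exists z => //=; have [-> _] := kP _ Uz.
exists (kap (psi z0)); last by have [-> _] := kP _ Ux.
by exists z0.
Qed.

(* Away from [z0], a closed set all of whose points are interior spreads along
   segments; two segments through a rotated copy of the first end point avoid
   [z0]. *)
Section PuncturedBall.
Variables (z0 : R * R) (e : R) (C : set (R * R)).
Hypothesis clC : closed C.
Hypothesis intC : forall z, `|z - z0| < e -> z != z0 -> C z -> nbhs z C.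

Let seg (a b : R * R) (t : R) : R * R := z0 + ((1 - t) *: a + t *: b).

Let seg_continuous a b : continuous (seg a b).
Proof.
apply: contD; first exact: contcst.
apply: contD; apply: contZ; try exact: contcst; last by move=> x; exact: cvg_id.
by apply: contB; [exact: contcst | move=> x; exact: cvg_id].
Qed.

(** Along a segment that avoids the centre the preimage of [C] is closed, and open by [intC], hence
    everything once it contains the first end point. *)
Lemma segment_spread a b : `|a| < e -> `|b| < e ->
  (forall t, 0 <= t -> t <= 1 -> (1 - t) *: a + t *: b != 0) ->
  C (z0 + a) -> C (z0 + b).
Proof.
move=> ae be ab0 Ca.
have sgn t : 0 <= t -> t <= 1 -> `|seg a b t - z0| < e.
  move=> t0 t1; rewrite /seg addrAC subrr add0r.
  apply: le_lt_trans (ler_normD _ _) _; rewrite !normrZ.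
  rewrite ger0_norm ?subr_ge0 // ger0_norm //.
  have m0 : `|a| <= Num.max `|a| `|b| by rewrite le_max lexx.
  have m1 : `|b| <= Num.max `|a| `|b| by rewrite le_max lexx orbT.
  have m2 : Num.max `|a| `|b| < e by rewrite gt_max ae.
  have h1 : (1 - t) * `|a| <= (1 - t) * Num.max `|a| `|b|.
    by rewrite ler_wpM2l // subr_ge0.
  have h2 : t * `|b| <= t * Num.max `|a| `|b| by rewrite ler_wpM2l.
  lra.
have E : `[0%R, 1%R]%classic `&` seg a b @^-1` C = `[0%R, 1%R]%classic :> set R.
  have := @segment_connected R 0 1; apply.
  - exists 0; split; first by rewrite /= in_itv /= lexx ler01.
    by rewrite /seg /= subr0 scale1r scale0r addr0.
  - exists (seg a b @^-1` C)°; first exact: open_interior.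
    apply/seteqP; split => t [t01 Ct]; split => //; last exact: interior_subset.
    move: t01; rewrite /= in_itv /= => /andP[t0 t1].
    apply: (seg_continuous (a := a) (b := b)); apply: intC => //; first exact: sgn.
    by rewrite -subr_eq0 /seg addrAC subrr add0r ab0.
  - exists (seg a b @^-1` C) => //.
    by apply: closed_comp => // t _; exact: seg_continuous.
have : `[0%R, 1%R]%classic (1 : R) by rewrite /= in_itv /= lexx ler01.
by rewrite -E => -[_]; rewrite /seg /= subrr scale0r scale1r add0r.
Qed.

Lemma punctured_ball_spread a b : `|a| < e -> `|b| < e -> a != 0 -> b != 0 ->
  C (z0 + a) -> C (z0 + b).
Proof.
move=> ae be a0 b0 Ca.
(* The vector [a] turned by a right angle: the segments from [a] to [w] and to [- w] both miss the
   origin. *)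
pose w : R * R := (- a.2, a.1).
have a20 : 0 < a.1 ^+ 2 + a.2 ^+ 2.
  rewrite lt0r addr_ge0 ?sqr_ge0 // andbT paddr_eq0 ?sqr_ge0 // !sqrf_eq0.
  apply: contraNN a0 => /andP[/eqP h1 /eqP h2].
  by rewrite (surjective_pairing a) h1 h2.
have wn : `|w| = `|a| by rewrite !norm_prodE /= normrN maxC.
have perp (s : R) : s ^+ 2 = 1 -> forall t : R,
    (1 - t) *: a + t *: (s *: w) != 0.
  move=> s1 t; apply/eqP => -[]; rewrite /GRing.scale /= => h1 h2.
  have h3 : (1 - t) * (a.1 ^+ 2 + a.2 ^+ 2) = 0.
    transitivity (a.1 * ((1 - t) * a.1 + t * (s * - a.2)) +
      a.2 * ((1 - t) * a.2 + t * (s * a.1))); first by ring.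
    by rewrite h1 h2 !mulr0 addr0.
  move: h3 => /eqP; rewrite mulf_eq0 (gt_eqF a20) orbF subr_eq0 => /eqP t1.
  move: h1 h2; rewrite -t1 subrr !mul0r !add0r !mul1r => h1 h2.
  have : s * (s * (a.1 ^+ 2 + a.2 ^+ 2)) = 0.
    transitivity (s * (a.1 * (s * a.1)) - s * (a.2 * (s * - a.2))).
      by ring.
    by rewrite h1 h2 !mulr0 subr0.
  by rewrite mulrA -expr2 s1 mul1r => /eqP; rewrite (gt_eqF a20).
have step (s : R) : s ^+ 2 = 1 -> C (z0 + s *: w).
  move=> s1; apply: (segment_spread ae) Ca => [|t _ _]; last exact: perp.
  rewrite normrZ wn; suff -> : `|s| = 1 by rewrite mul1r.
  by apply/eqP; rewrite -sqrp_eq1 // real_normK ?s1 // num_real.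
(* If the segment from [w] to [b] hits the origin, then [b] is a negative multiple of [w], and the
   segment from [- w] does not. *)
have [H|/existsNP[t /not_implyP[t0 /not_implyP[t1 /negP]]]] := pselect
    (forall t, 0 <= t -> t <= 1 -> (1 - t) *: (1 *: w) + t *: b != 0).
  apply: (segment_spread _ be H); first by rewrite scale1r wn.
  by apply: step; rewrite expr1n.
rewrite negbK scale1r => /eqP bw.
have t'0 : 0 < t.
  rewrite lt0r t0 andbT; apply/eqP => t00; move: bw.
  rewrite t00 subr0 scale1r scale0r addr0 => w0; move: ae wn a0.
  by rewrite w0 normr0 => _ /esym/eqP; rewrite normr_eq0 => ->.
have bE : b = - ((1 - t) / t) *: w.
  have -> : b = t^-1 *: (t *: b) by rewrite scalerA mulVf ?scale1r ?gt_eqF.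
  move/eqP: bw; rewrite addrC addr_eq0 => /eqP ->.
  by rewrite scalerN scalerA mulrC scaleNr.
apply: (@segment_spread (-1 *: w) b) => //.
- by rewrite scaleN1r normrN wn.
- move=> u u0 u1; rewrite bE !scalerA -scalerDl scaler_eq0 negb_or.
  apply/andP; split; last by rewrite -normr_eq0 wn normr_eq0.
  rewrite mulrN1 mulrN -opprD oppr_eq0.
  have d0 : 0 <= (1 - t) / t by rewrite divr_ge0 // subr_ge0.
  have [u0'|u1'] := ltP u 1.
    by rewrite gt_eqF // ltr_pwDl ?subr_gt0 // mulr_ge0.
  have {u0 u1 u1'} -> : u = 1 by apply/le_anti; rewrite u1.
  rewrite subrr add0r mul1r; apply: contraNneq b0 => d00.
  by rewrite bE d00 oppr0 scale0r.
- by apply: step; rewrite sqrrN expr1n.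
Qed.

End PuncturedBall.

(** In a chart ball without further exceptional points, [X] meets the punctured ball because [x] is
    a limit point, and [punctured_ball_spread] then fills it. *)
Lemma surface_open_except_finite (S : topologicalType) (X V : set S) :
  closed_surface R S -> closed X -> finite_set V ->
  (forall x, X x -> ~ V x -> nbhs x X) ->
  (forall x, X x -> limit_point X x) -> open X.
Proof.
move=> hS clX fV intX limX; rewrite openE => x Xx.
have [Vx|] := pselect (V x); last exact: intX.
have [U [chi [kap [Ux ch]]]] := surface_chart hS x.
have [oU cc cK Uc kP] := ch; pose z0 := kap x.
have chi0 : chi z0 = x by have [] := kP _ Ux.
have [_ hdS _ _] := hS.
have nW : nbhs z0 (chi @^-1` (~` (V `\ x))).
  apply: cc; apply: open_nbhs_nbhs; split; last by rewrite chi0 => -[_]; apply.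
  apply: closed_openC.
  have /accessible_finite_set_closed := hausdorff_accessible hdS; apply.
  exact: finite_setD.
have /nbhs_ballP[e /= e0 He] := nW.
have oB : open (chi @` ball z0 e) by apply: chart_open ch _; exact: ball_open.
have nB : nbhs x (chi @` ball z0 e).
  by apply: open_nbhs_nbhs; split => //; exists z0 => //; exact: ballxx.
have [y [xy Xy [z1 z1B yE]]] := limX x Xx _ nB.
have ballE z : ball z0 e z -> `|z - z0| < e.
  by rewrite -ball_normE /= distrC.
have z10 : z1 != z0 by apply: contraNneq xy => z10; rewrite -yE z10 chi0.
apply: filterS nB => _ [z2 z2B <-].
have [->|z20] := eqVneq z2 z0; first by rewrite chi0.
suff : (chi @^-1` X) (z0 + (z2 - z0)) by rewrite addrC subrK.
apply: (@punctured_ball_spread z0 e _ _ _ (z1 - z0)); rewrite ?subr_eq0 //;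
  try exact: ballE; last by rewrite addrC subrK /= yE.
  by apply: closed_comp => // z _; exact: cc.
move=> z zB zz0 Xz; apply: cc; apply: intX => //= Vz.
have : ball z0 e z by rewrite -ball_normE /= distrC.
move=> /He; apply; split => // zx; move/eqP: zz0; apply.
by rewrite -(cK z) zx.
Qed.

End Charts.

(** * Radial extensions and orbit spaces *)

Section RadialExtension.
Variable R : realType.

(** The lower bound by the norm makes [N] vanish at the origin only and its unit ball compact. *)
Definition gauge (N : R * R -> R) :=
  [/\ continuous N, forall z, `|z| <= N z &
      forall (k : R) z, N (k *: z) = `|k| * N z].

Lemma gauge_ge0 N z : gauge N -> 0 <= N z.
Proof. by move=> [_ le _]; apply: le_trans (le z). Qed.

Lemma gauge_eq0 N z : gauge N -> (N z == 0) = (z == 0).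
Proof.
move=> [_ le h]; apply/eqP/eqP => [Nz|->].
  by apply/eqP; rewrite -normr_le0 -Nz.
by rewrite -(scale0r 0) h normr0 mul0r.
Qed.

(** The cone over a map [h] of unit circles. At the origin the value is 0 whatever [h] is, since [N]
    vanishes there. *)
Definition radial (N : R * R -> R) (h : R * R -> R * R) z : R * R :=
  N z *: h ((N z)^-1 *: z).

Variables (N N' : R * R -> R) (h : R * R -> R * R).
Hypotheses (gN : gauge N) (gN' : gauge N').
Hypothesis ch : {within [set z | N z = 1], continuous h}.
Hypothesis hN : forall z, N z = 1 -> N' (h z) = 1.
Hypothesis ih : forall z w, N z = 1 -> N w = 1 -> h z = h w -> z = w.
Hypothesis sh : forall y, N' y = 1 -> exists2 z, N z = 1 & h z = y.

Let normalize z : z != 0 -> N ((N z)^-1 *: z) = 1.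
Proof.
move=> z0; have [_ _ ->] := gN.
rewrite ger0_norm ?invr_ge0 ?gauge_ge0 // mulVf // gauge_eq0 //.
Qed.

Lemma radial_gauge z : N' (radial N h z) = N z.
Proof.
have [_ _ ->] := gN'; rewrite ger0_norm ?gauge_ge0 //.
have [->|z0] := eqVneq z 0.
  by have /eqP-> : N 0 == 0; [rewrite gauge_eq0 | rewrite mul0r].
by rewrite hN ?mulr1 // normalize.
Qed.

Lemma radial_inj : injective (radial N h).
Proof.
move=> z w E; have NE : N z = N w by rewrite -radial_gauge E radial_gauge.
have [z0|z0] := eqVneq z 0.
  by apply/esym/eqP; rewrite z0 -(gauge_eq0 w gN) -NE z0 gauge_eq0.
have w0 : w != 0 by rewrite -(gauge_eq0 w gN) -NE gauge_eq0.
have Nz0 : N z != 0 by rewrite gauge_eq0.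
have : h ((N z)^-1 *: z) = h ((N w)^-1 *: w).
  by apply: (scalerI Nz0); rewrite -[LHS]/(radial N h z) E /radial NE.
by move=> /ih; rewrite !normalize // => /(_ erefl erefl); rewrite -NE;
  apply: scalerI; rewrite invr_eq0.
Qed.

Lemma radial_surj y : exists z, radial N h z = y.
Proof.
have [->|y0] := eqVneq y 0.
  exists 0; have /eqP N0 : N 0 == 0 by rewrite gauge_eq0.
  by rewrite /radial N0 scale0r.
have N'y0 : N' y != 0 by rewrite gauge_eq0.
have [_ _ h'] := gN'; have [_ _ h0] := gN.
have [|z Nz hz] := @sh ((N' y)^-1 *: y).
  by rewrite h' ger0_norm ?invr_ge0 ?gauge_ge0 // mulVf.
exists (N' y *: z); rewrite /radial h0 Nz mulr1 ger0_norm ?gauge_ge0 //.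
by rewrite !scalerA mulVf // scale1r hz scalerA divff // scale1r.
Qed.

(** At the origin the norm of the value is at most [N z], which tends to 0; elsewhere the continuity
    of [h] along the unit circle is pulled back by the normalisation. *)
Lemma radial_continuous : continuous (radial N h).
Proof.
have [cN leN homN] := gN; have [cN' leN' homN'] := gN'.
move=> z; have [->|z0] := eqVneq z 0.
  have N0 : N 0 = 0 by apply/eqP; rewrite gauge_eq0.
  rewrite /continuous_at {2}/radial N0 scale0r; apply/cvgrPdist_lt => e e0.
  have := cN 0 => /cvgrPdist_lt/(_ e e0); apply: filterS => y.
  rewrite N0 !sub0r !normrN ger0_norm ?gauge_ge0 //.
  by apply: le_lt_trans; rewrite -radial_gauge.
have Nz0 : N z != 0 by rewrite gauge_eq0.
apply: cvgZ; first exact: cN.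
have cu : {for z, continuous (fun y => (N y)^-1 *: y)}.
  apply: (@cvgZ _ _ _ (nbhs z) _ (fun y => (N y)^-1)); last exact: cvg_id.
  by apply: (@cvgV _ _ (nbhs z) _ N (N z)) => //; exact: cN.
move=> W nW.
have /subspace_continuousP/(_ _ (normalize z0) W nW) := ch.
rewrite /fmap /within /= => nK.
have nK' : nbhs z [set y | N ((N y)^-1 *: y) = 1 -> W (h ((N y)^-1 *: y))].
  exact: cu _ nK.
have nz : nbhs z [set y | y != 0].
  have : \forall y \near z, 0 < N y.
    by apply: (cN z [set x | 0 < x]); apply: lt_nbhsr; rewrite lt0r Nz0 gauge_ge0.
  apply: filterS => y; apply: contraTneq => ->; rewrite -leNgt.
  by have /eqP-> : N 0 == 0; [rewrite gauge_eq0 | ].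
suff : nbhs z [set y | W (h ((N y)^-1 *: y))] by [].
by apply: filterS2 nz nK' => y y0; apply; exact: normalize.
Qed.

End RadialExtension.

Section Gauges.
Variable R : realType.

Definition l1 (z : R * R) : R := `|z.1| + `|z.2|.
Definition l2 (z : R * R) : R := Num.sqrt (z.1 ^+ 2 + z.2 ^+ 2).

Lemma gauge_l1 : gauge l1.
Proof.
split.
- by apply: contD; apply: contnorm; [exact: fst_continuous|exact: snd_continuous].
- by move=> z; rewrite norm_prod_le /l1 lerDl lerDr !normr_ge0.
- by move=> k z; rewrite /l1 /= /GRing.scale /= !normrM mulrDr.
Qed.

Lemma gauge_l2 : gauge l2.
Proof.
split.
- apply: contcomp; first exact: sqrt_continuous.
  by apply: contD; apply: contM;
    (exact: fst_continuous || exact: snd_continuous).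
- move=> z; rewrite norm_prod_le /l2 -!sqrtr_sqr !ler_wsqrtr //.
    by rewrite lerDr sqr_ge0.
  by rewrite lerDl sqr_ge0.
- move=> k z; rewrite /l2 /= /GRing.scale /= !exprMn -mulrDr sqrtrM ?sqr_ge0 //.
  by rewrite sqrtr_sqr.
Qed.

Lemma l2_le1 z : (l2 z <= 1) = (z.1 ^+ 2 + z.2 ^+ 2 <= 1).
Proof. by rewrite -{1}sqrtr1 ler_sqrt. Qed.

Lemma l2_lt1 z : (l2 z < 1) = (z.1 ^+ 2 + z.2 ^+ 2 < 1).
Proof. by rewrite -{1}sqrtr1 ltr_sqrt. Qed.

Lemma l2_eq1 z : l2 z = 1 <-> z.1 ^+ 2 + z.2 ^+ 2 = 1.
Proof.
have s0 : 0 <= z.1 ^+ 2 + z.2 ^+ 2 by rewrite addr_ge0 ?sqr_ge0.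
split=> [E|E]; last by rewrite /l2 E sqrtr1.
by rewrite -(sqr_sqrtr s0) -/(l2 z) E expr1n.
Qed.

Lemma gauge_le1_compact N : gauge N -> compact [set z : R * R | N z <= 1].
Proof.
move=> [cN le _]; apply: (subclosed_compact _ (@square_compact R 1)).
  apply: (@closed_comp _ _ N [set x | x <= 1]) => [z _|]; first exact: cN.
  exact: closed_le.
by move=> z /=; apply: le_trans.
Qed.

End Gauges.

(** * Orbit spaces of involutions *)

Section OrbitSpaces.
Variable X : z2space.

Definition orbit_of (x : X) : orbit_space X := (\pi_({eq_quot same_orbit_equiv X}) x)%qT.

Lemma orbit_ofP (x y : X) : orbit_of x = orbit_of y <-> y = x \/ y = z2act x.
Proof.
split=> [/eqquotP /orP[] /eqP ->|H]; [by left|by right|].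
by apply/eqquotP; apply/orP; case: H => ->; [left | right].
Qed.

Lemma orbit_of_act x : orbit_of (z2act x) = orbit_of x.
Proof. by apply/esym/orbit_ofP; right. Qed.

Lemma orbit_of_surj xi : exists x, orbit_of x = xi.
Proof. by exists (repr xi); rewrite /orbit_of reprK. Qed.

Lemma orbit_of_continuous : continuous orbit_of.
Proof. exact: (@pi_continuous X _). Qed.

Lemma orbit_of_open (A : set X) : open A -> open (orbit_of @` A).
Proof.
move=> oA; rewrite /open /= /quotient_open.
rewrite (_ : _ @^-1` _ = A `|` @z2act _ @^-1` A).
  apply: openU => //; apply: open_comp => // x _; exact: z2act_continuous.
apply/seteqP; split => [y [x Ax /orbit_ofP[] ->]|y [Ay|Ay]].
- by left.
- by right => /=; rewrite z2actK.
- by exists y.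
- by exists (z2act y) => //; exact: orbit_of_act.
Qed.

(** Separating [y] from both points of the orbit of [x] and intersecting gives neighbourhoods whose
    saturations are disjoint. *)
Lemma orbit_space_hausdorff : hausdorff_space X -> hausdorff_space (orbit_space X).
Proof.
move=> hX; rewrite open_hausdorff => xi yi.
have [x <-] := orbit_of_surj xi; have [y <-] := orbit_of_surj yi => xy.
have nxy : x != y by apply: contraNneq xy => ->.
have nxy' : z2act x != y by apply: contraNneq xy => <-; rewrite orbit_of_act.
move: hX; rewrite open_hausdorff => hX.
have [[A B] /= [/set_mem Ax /set_mem By] [oA oB /eqP AB]] := hX _ _ nxy.
have [[A' B'] /= [/set_mem Ax' /set_mem By'] [oA' oB' /eqP AB']] := hX _ _ nxy'.
exists (orbit_of @` (A `&` @z2act _ @^-1` A'), orbit_of @` (B `&` B')) => /=.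
  by split; apply/mem_set; [exists x | exists y].
split.
- apply: orbit_of_open; apply: openI => //; apply: open_comp => // z _.
  exact: z2act_continuous.
- by apply: orbit_of_open; exact: openI.
- apply/eqP; rewrite -subset0 => _ [[u [Au Au'] <-] [v [Bv Bv'] /esym/orbit_ofP[E|E]]].
    by have : (A `&` B) u by [split; rewrite // -E]; rewrite AB.
  have : (A' `&` B') v by split; rewrite // E.
  by rewrite AB'.
Qed.

Lemma orbit_space_compact : compact [set: X] -> compact [set: orbit_space X].
Proof.
move=> cX; rewrite (_ : setT = orbit_of @` setT).
  apply: continuous_compact => //; apply: continuous_subspaceT.
  exact: orbit_of_continuous.
by apply/seteqP; split => // xi _; have [x] := orbit_of_surj xi; exists x.
Qed.

End OrbitSpaces.

Section OrbitSurfaces.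
Variable R : realType.

Lemma open_injection_chart (S : topologicalType) (chi : R * R -> S) :
  continuous chi -> injective chi -> (forall V, open V -> open (chi @` V)) ->
  exists kap, is_chart (range chi) chi kap.
Proof.
move=> cc ic oc.
pose kap y := xget 0 [set z | chi z = y].
have kapK z : kap (chi z) = z.
  by apply: ic; rewrite /kap; case: xgetP => [w _ -> |/(_ z)/(_ erefl)].
exists kap; split => //.
- by apply: oc; exact: openT.
move=> _ [z _ <-]; split; first by rewrite kapK.
rewrite /prop_for /continuous_at kapK => W; rewrite nbhsE => -[V [oV Vz] VW].
rewrite /fmap /=; apply: (filterS (P := chi @` V)).
  by move=> _ [v Vv <-]; rewrite /= kapK; exact: VW.
by apply: open_nbhs_nbhs; split; [exact: oc | exists z].
Qed.

(** An embedding of the plane into the ball of radius [e] about [z0]: a chart restricted to a ball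
    becomes again a chart modelled on the whole plane, as [closed_surface] demands. *)
Definition shrink (z0 : R * R) (e : R) (y : R * R) : R * R :=
  z0 + (e / (1 + `|y|)) *: y.

Lemma shrink_continuous z0 e : continuous (shrink z0 e).
Proof.
apply: contD; first exact: contcst.
apply: contZ => [|y]; last exact: cvg_id.
apply: contM; first exact: contcst.
apply: contV => [y|]; first by rewrite gt_eqF // ltr_wpDr.
by apply: contD; [exact: contcst | apply: contnorm => y; exact: cvg_id].
Qed.

Lemma shrink_ball z0 e y : 0 < e -> `|shrink z0 e y - z0| < e.
Proof.
move=> e0; rewrite /shrink addrAC subrr add0r normrZ.
have y1 : 0 < 1 + `|y| by rewrite ltr_wpDr.
rewrite ger0_norm ?divr_ge0 ?ltW // mulrAC ltr_pdivrMr // ltr_pM2l //.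
by rewrite ltrDr.
Qed.

Lemma shrink_inj z0 e : 0 < e -> injective (shrink z0 e).
Proof.
move=> e0 y y' /addrI E.
have h (x : R * R) : 0 < 1 + `|x| by rewrite ltr_wpDr.
have nE : `|y| / (1 + `|y|) = `|y'| / (1 + `|y'|).
  move/(congr1 Num.norm): (E); rewrite !normrZ !ger0_norm ?divr_ge0 ?ltW //.
  rewrite -!mulrA ![(1 + _)^-1 * _]mulrC => /(mulfI _); apply.
  by rewrite gt_eqF.
have yy : `|y| = `|y'|.
  move/eqP: nE; rewrite eqr_div ?lt0r_neq0 // => /eqP; lra.
move: E; rewrite yy => /scalerI; apply.
by rewrite mulf_neq0 ?invr_eq0 ?gt_eqF.
Qed.

Lemma orbit_space_surface (X : z2space) : (forall x : X, z2act x <> x) ->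
  closed_surface R X -> closed_surface R (orbit_space X).
Proof.
move=> free hS; have [[x0 _] hX cX _] := hS; split.
- by exists (orbit_of x0).
- exact: orbit_space_hausdorff.
- exact: orbit_space_compact.
move=> xi; have [x <-] := orbit_of_surj xi.
have [U [chi [kap [Ux ch]]]] := surface_chart hS x.
have [oU cc cK Uc kP] := ch; pose z0 := kap x.
have chi0 : chi z0 = x by have [] := kP _ Ux.
have /eqP nx : x <> z2act x by move=> E; apply: (free x).
move: (hX); rewrite open_hausdorff => hX'.
have [[A B] /= [/set_mem Ax /set_mem By] [oA oB /eqP AB]] := hX' _ _ nx.
(* On a ball this small the involution moves the image off itself, so that the orbit map is
   injective there. *)
have : nbhs z0 (chi @^-1` (A `&` @z2act _ @^-1` B)).
  apply: cc; rewrite chi0; apply: open_nbhs_nbhs; split => //.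
  by apply: openI => //; apply: open_comp => // z _; exact: z2act_continuous.
move=> /nbhs_ballP[e /= e0 He].
pose chi' y := orbit_of (chi (shrink z0 e y)).
have shW y : (A `&` @z2act _ @^-1` B) (chi (shrink z0 e y)).
  by apply: He; rewrite -ball_normE /= distrC shrink_ball.
have [||V oV|kap' ch'] := @open_injection_chart _ chi'.
- apply: contcomp; first exact: orbit_of_continuous.
  by apply: contcomp => //; exact: shrink_continuous.
- move=> y y' /orbit_ofP[/esym|] E.
    by apply: (shrink_inj (z0 := z0) e0); rewrite -(cK (shrink _ _ y)) E cK.
  have [_ By1] := shW y; have [Ay' _] := shW y'.
  have : (A `&` B) (chi (shrink z0 e y')) by split => //; rewrite E.
  by rewrite AB.
- rewrite (_ : chi' @` V = @orbit_of X @` (chi @` (shrink z0 e @` V))).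
    apply: orbit_of_open; apply: chart_open ch _.
    apply: invariance_of_domain => // [z _|z w _ _]; first exact: shrink_continuous.
    exact: shrink_inj.
  apply/seteqP; split => [_ [z Vz <-]|_ [_ [_ [z Vz <-] <-] <-]]; last by exists z.
  by exists (chi (shrink z0 e z)) => //; exists (shrink z0 e z) => //; exists z.
exists (range chi'); have [oU' _ _ _ _] := ch'.
split => //.
  exists 0 => //; rewrite /chi' /shrink scaler0 addr0 chi0 //.
by have [] := iffRL (chart_homeomorphicP R (range chi')) (ex_intro _ _ (ex_intro _ _ ch')).
Qed.

End OrbitSurfaces.

(** * Points of the Lovász complex *)

Notation sing a := [set a]%SET.
Notation diag a c := [set a; c]%SET.

Section PosNeg.
Variable R : realType.
Implicit Type x : R.

Definition posp x : R := Num.max x 0.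
Definition posn x : R := Num.max (- x) 0.

Lemma posp_ge0 x : 0 <= posp x. Proof. by rewrite le_max lexx orbT. Qed.
Lemma posn_ge0 x : 0 <= posn x. Proof. by rewrite le_max lexx orbT. Qed.

Lemma posp_pos x : 0 <= x -> posp x = x. Proof. by move=> ?; apply/max_idPl. Qed.
Lemma posp_neg x : x <= 0 -> posp x = 0. Proof. by move=> ?; apply/max_idPr. Qed.
Lemma posn_pos x : 0 <= x -> posn x = 0.
Proof. by move=> ?; apply/max_idPr; rewrite oppr_le0. Qed.
Lemma posn_neg x : x <= 0 -> posn x = - x.
Proof. by move=> ?; apply/max_idPl; rewrite oppr_ge0. Qed.

Lemma pospN x : posp (- x) = posn x. Proof. by []. Qed.
Lemma posnN x : posn (- x) = posp x. Proof. by rewrite /posn opprK. Qed.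

Lemma pospDn x : posp x + posn x = `|x|.
Proof.
have [x0|/ltW x0] := leP 0 x.
  by rewrite posp_pos // posn_pos // addr0 ger0_norm.
by rewrite posp_neg // posn_neg // add0r ler0_norm.
Qed.

Lemma pospBn x : posp x - posn x = x.
Proof.
have [x0|/ltW x0] := leP 0 x.
  by rewrite posp_pos // posn_pos // subr0.
by rewrite posp_neg // posn_neg // sub0r opprK.
Qed.

Lemma posp_continuous (T : topologicalType) (f : T -> R) :
  continuous f -> continuous (fun z => posp (f z)).
Proof. by move=> cf; apply: contmax => //; exact: contcst. Qed.

Lemma posn_continuous (T : topologicalType) (f : T -> R) :
  continuous f -> continuous (fun z => posn (f z)).
Proof.
by move=> cf; apply: contmax; [exact: contN | exact: contcst].
Qed.

End PosNeg.

Lemma injective_hausdorff (X Y : topologicalType) (f : X -> Y) :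
  continuous f -> injective f -> hausdorff_space Y -> hausdorff_space X.
Proof.
move=> cf injf hY p q pq; apply: injf; apply: hY => A B nA nB.
by have [x [Ax Bx]] := pq _ _ (cf p A nA) (cf q B nB); exists (f x).
Qed.

Section PolyhedronPoints.
Variables (R : realType) (T : finType) (K : {set {set T}}).
Implicit Types (x : polyhedron R K) (t : {ptws T -> R}).

Definition poly_pt x t : polyhedron R K := insubd x t.

Lemma val_poly_pt x t : realization R K t -> \val (poly_pt x t) = t.
Proof. by move=> Kt; rewrite /poly_pt insubdK //; exact/mem_set. Qed.

Lemma poly_pt_continuous x (U : topologicalType) (A : set U)
    (F : U -> {ptws T -> R}) : {within A, continuous F} ->
  (forall u, A u -> realization R K (F u)) ->
  {within A, continuous (fun u => poly_pt x (F u))}.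
Proof.
move=> cF AF; apply: continuous_comp_initial.
apply: subspace_eq_continuous cF => u /set_mem Au.
by apply/esym; apply: val_poly_pt; exact: AF.
Qed.

Lemma polyhedron_hausdorff : hausdorff_space (polyhedron R K).
Proof.
apply: (@injective_hausdorff _ {ptws T -> R} set_val).
- exact: initial_continuous.
- exact: val_inj.
- by apply: hausdorff_product => i; exact: Rhausdorff.
Qed.

End PolyhedronPoints.

Lemma sum_delta (R : realType) (T : finType) (k : R) (y : T) :
  \sum_x k * (x == y)%:R = k.
Proof.
rewrite (bigD1 y) //= eqxx mulr1 big1 ?addr0 // => x /negPf->.
by rewrite mulr0.
Qed.

Section LovaszPoints.
Variables (R : realType) (G : sgraph).
Hypothesis reg : lovasz_regular G.
Implicit Types (a b c d u v w : G) (A B : {set G}) (z : R * R) (x : R).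
Local Notation LR := (realization R (lovasz_complex G)).
Implicit Types (t : {ptws {set G} -> R}).

(** The involution exchanges [sing v] and [nbh v], so the sum is constant on orbits. On points
    without weight on diagonals it is the projection onto the graph. *)
Definition shadow t : {ptws G -> R} := fun v => t (sing v) + t (nbh v).

(** The star of [diag a c] over the diamond: the centre goes to the diagonal, the corners on the
    first axis to [sing a] and [sing c], those on the second to [nbh b] and [nbh d]. *)
Definition Lam a b c d z : {ptws {set G} -> R} := fun A =>
  posp z.1 * (A == sing a)%:R + posn z.1 * (A == sing c)%:R +
  posp z.2 * (A == nbh b)%:R + posn z.2 * (A == nbh d)%:R +
  (1 - l1 z) * (A == diag a c)%:R.

(** The shadow of [Lam]; its weights add up to [l1 z], so it is a point of the graph exactly on the
    boundary of the diamond. *)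
Definition quad_pt a b c d z : {ptws G -> R} := fun v =>
  posp z.1 * (v == a)%:R + posn z.1 * (v == c)%:R +
  posp z.2 * (v == b)%:R + posn z.2 * (v == d)%:R.

(** A lift of an edge point that depends on the direction: the other lift of the same point is
    [elift v u (1 - x)]. *)
Definition elift u v x : {ptws {set G} -> R} := fun A =>
  x * (A == sing u)%:R + (1 - x) * (A == nbh v)%:R.

Definition edge_pt u v x : {ptws G -> R} := fun w =>
  x * (w == u)%:R + (1 - x) * (w == v)%:R.

Lemma sing_eq u v : (sing u == sing v) = (u == v).
Proof. exact: (inj_eq set1_inj). Qed.

Lemma nbh_eq u v : (nbh u == nbh v) = (u == v).
Proof. exact: (inj_eq (nbh_inj reg)). Qed.

Lemma sing_nbh u v : (sing u == nbh v) = false.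
Proof. by apply/negbTE; rewrite eq_sym nbhN1. Qed.

Lemma nbh_sing u v : (nbh v == sing u) = false.
Proof. by apply/negbTE; rewrite nbhN1. Qed.

Lemma sing_diag a b c d u : quad a b c d -> (sing u == diag a c) = false.
Proof. by move=> q; apply/negbTE; rewrite eq_sym (quad_diagN1 reg _ q). Qed.

Lemma nbh_diag a b c d u : quad a b c d -> (nbh u == diag a c) = false.
Proof. by move=> q; apply/negbTE; rewrite eq_sym (quad_diagNnbh reg _ q). Qed.

Lemma shadow_Lam a b c d z : quad a b c d ->
  shadow (Lam a b c d z) = quad_pt a b c d z.
Proof.
move=> q; apply/funext => v; rewrite /shadow /Lam /quad_pt.
rewrite !sing_eq !nbh_eq !sing_nbh !nbh_sing (sing_diag _ q) (nbh_diag _ q).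
by rewrite !mulr0 !addr0 !add0r !addrA.
Qed.

Lemma shadow_elift u v x : shadow (elift u v x) = edge_pt u v x.
Proof.
apply/funext => w; rewrite /shadow /elift /edge_pt.
by rewrite !sing_eq !nbh_eq !sing_nbh !nbh_sing !mulr0 !addr0 !add0r.
Qed.

Lemma quad_neq a b c d : quad a b c d ->
  [/\ a != b, a != c, a != d, b != c & (b != d) && (c != d)].
Proof.
case/and5P=> ab bc cd da /andP[ac bd].
have ne u v : sedge u v -> u != v by apply: contraTneq => ->; rewrite sedge_irr.
have ad : a != d by rewrite eq_sym ne.
by split; rewrite // ?bd ?ne.
Qed.

Lemma quad_pt_fst a b c d z : quad a b c d ->
  quad_pt a b c d z a - quad_pt a b c d z c = z.1.
Proof.
move=> /quad_neq[ab ac ad bc /andP[bd cd]].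
rewrite /quad_pt !eqxx (negPf ab) (negPf ac) (negPf ad) (negPf cd).
by rewrite [c == a]eq_sym (negPf ac) [c == b]eq_sym (negPf bc)
  !mulr0 !mulr1 !addr0 !add0r pospBn.
Qed.

Lemma quad_pt_snd a b c d z : quad a b c d ->
  quad_pt a b c d z b - quad_pt a b c d z d = z.2.
Proof.
move=> /quad_neq[ab ac ad bc /andP[bd cd]].
rewrite /quad_pt !eqxx (negPf bc) (negPf bd) [b == a]eq_sym (negPf ab).
by rewrite [d == a]eq_sym (negPf ad) [d == c]eq_sym (negPf cd) [d == b]eq_sym
  (negPf bd) !mulr0 !mulr1 !addr0 !add0r pospBn.
Qed.

Lemma quad_pt_inj a b c d : quad a b c d -> injective (quad_pt a b c d).
Proof.
move=> q z w E; rewrite (surjective_pairing z) (surjective_pairing w).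
by rewrite -(quad_pt_fst z q) -(quad_pt_snd z q) E quad_pt_fst ?quad_pt_snd.
Qed.

Lemma Lam_diag a b c d z : quad a b c d -> Lam a b c d z (diag a c) = 1 - l1 z.
Proof.
move=> q; rewrite /Lam eqxx ![diag a c == _]eq_sym !(sing_diag _ q).
by rewrite !(nbh_diag _ q) !mulr0 !add0r mulr1.
Qed.

Lemma Lam_diag0 a b c d z B : is_diagonal B -> B != diag a c ->
  Lam a b c d z B = 0.
Proof.
move=> dB /negPf nB; rewrite /Lam nB.
have ns u : (B == sing u) = false.
  by apply: contraTF dB => /eqP->; rewrite diagonal1.
have nn u : (B == nbh u) = false.
  by apply: contraTF dB => /eqP->; rewrite diagonal_nbh.
by rewrite !ns !nn !mulr0 !addr0.
Qed.

Lemma Lam_real a b c d z : quad a b c d -> l1 z <= 1 -> LR (Lam a b c d z).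
Proof.
move=> q z1; split.
- move=> A; rewrite /Lam !addr_ge0 // mulr_ge0 ?ler0n ?posp_ge0 ?posn_ge0 //.
  by rewrite subr_ge0.
- rewrite /Lam !big_split /= !sum_delta /l1 -(pospDn z.1) -(pospDn z.2).
  by ring.
(* The signs of the coordinates select one of the four triangles of the star, with corners
   [sing a'], [diag a' c'] and [nbh b']. *)
pose a' := if 0 <= z.1 then a else c; pose c' := if 0 <= z.1 then c else a.
pose b' := if 0 <= z.2 then b else d; pose d' := if 0 <= z.2 then d else b.
have q' : quad a' b' c' d'.
  rewrite /a' /b' /c' /d'; do 2![case: ifP => _] => //.
  - exact: quad_flip.
  - exact: quad_flop.
  - by apply: quad_flip; exact: quad_flop.
apply: (lovasz_quad reg q'); apply/fintype.subsetP => A; rewrite !inE.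
apply: contraNT; rewrite !negb_or => /andP[/andP[Aa Aac] Ab].
have ac' : diag a' c' = diag a c.
  by rewrite /a' /c'; case: ifP => // _; rewrite finset.setUC.
move: Aa Aac Ab; rewrite ac' /a' /b' /Lam => + /negPf->; rewrite mulr0 addr0.
have [x0|/ltW x0] := leP 0 z.1; have [y0|/ltW y0] := leP 0 z.2;
  rewrite ?(posp_pos x0) ?(posn_pos x0) ?(posp_neg x0) ?(posn_neg x0);
  rewrite ?(posp_pos y0) ?(posn_pos y0) ?(posp_neg y0) ?(posn_neg y0);
  by move=> /negPf-> /negPf->; rewrite !(mulr0, mul0r, addr0).
Qed.

Lemma elift_real u v x : sedge u v -> 0 <= x -> x <= 1 -> LR (elift u v x).
Proof.
move=> uv x0 x1; split.
- by move=> A; rewrite /elift addr_ge0 // mulr_ge0 ?ler0n // subr_ge0.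
- by rewrite /elift big_split /= !sum_delta addrC subrK.
apply: (lovasz_edge reg uv); apply/fintype.subsetP => A; rewrite !inE.
apply: contraNT; rewrite negb_or /elift => /andP[/negPf-> /negPf->].
by rewrite !mulr0 addr0.
Qed.

Lemma real_supp t (s : seq {set G}) : LR t ->
  (forall A, t A != 0 -> A \in s) -> uniq s -> \sum_(A <- s) t A = 1.
Proof.
move=> [t0 t1 _] ts us; rewrite -t1 big_uniq //= [RHS](bigID (mem s)) /=.
rewrite [X in _ = _ + X]big1 ?addr0 // => A; apply: contraNeq; exact: ts.
Qed.

Lemma supp_neq0 t : LR t -> [set A | t A != 0]%SET != finset.set0.
Proof.
move=> [t0 t1 _]; apply/negP => /eqP E; move: t1; rewrite big1.
  by move/eqP; rewrite eq_sym oner_eq0.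
move=> A _; apply/eqP; apply: contraT => tA.
by have : A \in [set A | t A != 0]%SET; [rewrite inE | rewrite E inE].
Qed.

Lemma elift_of_supp t u v : sedge u v -> LR t ->
  (forall A, t A != 0 -> A \in [:: sing u; nbh v]) ->
  exists x, [/\ 0 <= x, x <= 1 & t = elift u v x].
Proof.
move=> uv Lt ts; have [t0 _ _] := Lt.
have := real_supp Lt ts; rewrite /= inE sing_nbh => /(_ isT).
rewrite !big_cons big_nil addr0 => t1; exists (t (sing u)); split => //.
  by rewrite -t1 lerDl.
have t2 : 1 - t (sing u) = t (nbh v) by rewrite -t1 addrAC subrr add0r.
apply/funext => A; rewrite /elift t2.
have [->|nu] := eqVneq A (sing u).
  by rewrite sing_nbh mulr1 mulr0 addr0.
have [->|nv] := eqVneq A (nbh v); first by rewrite mulr0 mulr1 add0r.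
rewrite !mulr0 addr0; apply/eqP; apply: contraT => /ts.
by rewrite !inE (negPf nu) (negPf nv).
Qed.

Lemma Lam_of_supp t a b c d : quad a b c d -> LR t ->
  (forall A, t A != 0 -> A \in [:: sing a; diag a c; nbh b]) ->
  exists z, l1 z <= 1 /\ t = Lam a b c d z.
Proof.
move=> q Lt ts; have [t0 _ _] := Lt.
have := real_supp Lt ts.
rewrite /= !inE sing_nbh (sing_diag _ q) eq_sym (nbh_diag _ q) => /(_ isT).
rewrite !big_cons big_nil addr0 => t1.
pose z := (t (sing a), t (nbh b)).
have lz : l1 z = t (sing a) + t (nbh b) by rewrite /l1 /= !ger0_norm.
have lz' : 1 - l1 z = t (diag a c) by rewrite lz -t1; ring.
exists z; split; first by rewrite -subr_ge0 lz'.
apply/funext => A; rewrite /Lam lz' /= (posp_pos (t0 _)) (posn_pos (t0 _)).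
rewrite (posp_pos (t0 _)) (posn_pos (t0 _)) !mul0r !addr0.
have [->|nu] := eqVneq A (sing a).
  by rewrite sing_nbh (sing_diag _ q) mulr1 !mulr0 !addr0.
have [->|nv] := eqVneq A (nbh b).
  by rewrite (nbh_diag _ q) mulr1 !mulr0 addr0 add0r.
have [->|nd] := eqVneq A (diag a c); first by rewrite !mulr0 mulr1 !add0r.
rewrite !mulr0 !addr0; apply/eqP; apply: contraT => /ts.
by rewrite !inE (negPf nu) (negPf nv) (negPf nd).
Qed.

(** The open diamonds are cut out by a nonzero weight on a diagonal; without one, the point lies
    over an edge of [G]. *)
Lemma LR_cases t : LR t ->
  (exists u v x, [/\ sedge u v, 0 <= x, x <= 1 & t = elift u v x]) \/
  (exists a b c d z,
     [/\ quad a b c d, l1 z < 1 & t = Lam a b c d z]).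
Proof.
move=> Lt; have [t0 t1 tL] := Lt.
have [[u [v [uv /fintype.subsetP sub]]]|[a [b [c [d [q /fintype.subsetP sub]]]]]] :=
  lovasz_simplexP reg tL (supp_neq0 Lt).
  left; have [|x [x0 x1 ->]] := elift_of_supp uv Lt; last by exists u, v, x.
  by move=> A tA; have := sub A; rewrite !inE tA => /(_ isT).
have [ac0|ac0] := eqVneq (t (diag a c)) 0.
  have ab : sedge a b by case/and5P: q.
  left; have [|x [x0 x1 ->]] := elift_of_supp ab Lt; last by exists a, b, x.
  move=> A tA; have := sub A; rewrite !inE tA => /(_ isT).
  by case/orP => [/orP[->|/eqP E]|->]; rewrite ?orbT //; rewrite E ac0 eqxx in tA.
right; have [|z [z1 E]] := Lam_of_supp q Lt.
  by move=> A tA; have := sub A; rewrite !inE tA orbA => /(_ isT).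
exists a, b, c, d, z; split => //; rewrite lt_neqAle z1 andbT.
by apply: contraNneq ac0 => l1z; rewrite E Lam_diag // l1z subrr.
Qed.

Lemma elift_diag0 u v x B : is_diagonal B -> elift u v x B = 0.
Proof.
move=> dB; rewrite /elift.
have -> : (B == sing u) = false.
  by apply: contraTF dB => /eqP->; rewrite diagonal1.
have -> : (B == nbh v) = false.
  by apply: contraTF dB => /eqP->; rewrite diagonal_nbh.
by rewrite !mulr0 addr0.
Qed.

Lemma LR_no_diag t : LR t -> (forall B, is_diagonal B -> t B = 0) ->
  exists u v x, [/\ sedge u v, 0 <= x, x <= 1 & t = elift u v x].
Proof.
move=> Lt t0; have [//|[a [b [c [d [z [q z1 E]]]]]]] := LR_cases Lt.
have := t0 _ (diagonal_quad reg q); rewrite E Lam_diag // => /eqP.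
by rewrite subr_eq0 => /eqP z1'; move: z1; rewrite -z1' ltxx.
Qed.

Local Notation L := (lovasz_space R G).
Implicit Types (T : L).

Lemma CN_CN1 v : CN (CN (sing v)) = sing v.
Proof. by rewrite CN1 CN_nbh. Qed.

Lemma CN_CNnbh v : CN (CN (nbh v)) = nbh v.
Proof. by rewrite CN_nbh // CN1. Qed.

Lemma shadow_act T : shadow (\val (z2act T)) = shadow (\val T).
Proof.
apply/funext => v; rewrite /shadow (lovasz_act_val T (CN_CN1 v)).
by rewrite (lovasz_act_val T (CN_CNnbh v)) CN_nbh // CN1 addrC.
Qed.

Lemma act_diag T a b c d : quad a b c d ->
  \val (z2act T) (diag a c) = \val T (diag b d).
Proof.
move=> q; have E := quad_CN reg q.
have E' : CN (diag b d) = diag a c.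
  by rewrite (quad_CN reg (quad_rot q)) finset.setUC.
by rewrite (lovasz_act_val T) E // E'.
Qed.

Lemma act_elift T u v x : sedge u v -> 0 <= x -> x <= 1 ->
  \val T = elift u v x -> \val (z2act T) = elift v u (1 - x).
Proof.
move=> uv x0 x1 E.
have e1 : sing u = CN (nbh u) by rewrite CN_nbh.
have e2 : nbh v = CN (sing v) by rewrite CN1.
apply/funext => A; rewrite /= /Defs.pushforward E.
(* If [A] is closed, [CN A] is the only closed set that [CN] sends to [A]; otherwise [A] is the
   image of no set in the support and both sides vanish. *)
have [AA|nAA] := eqVneq (CN (CN A)) A.
  transitivity (elift u v x (CN A)).
    rewrite (bigD1 (CN A)) ?AA //= big1 ?addr0 // => B /andP[/eqP BA nB].
    rewrite /elift; have [Bu|nu] := eqVneq B (sing u).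
      by move: nB; rewrite -BA Bu CN_CN1 eqxx.
    have [Bv|nv] := eqVneq B (nbh v); last by rewrite !mulr0 addr0.
    by move: nB; rewrite -BA Bv CN_CNnbh eqxx.
  have xx : 1 - (1 - x) = x by ring.
  rewrite /elift xx.
  have -> : (CN A == sing u) = (A == nbh u).
    apply/eqP/eqP => [H|->]; last by rewrite CN_nbh.
    by rewrite -AA H CN1.
  have -> : (CN A == nbh v) = (A == sing v).
    apply/eqP/eqP => [H|->]; last by rewrite CN1.
    by rewrite -AA H CN_nbh.
  by rewrite addrC.
rewrite big1; last first.
  move=> B /eqP BA; rewrite /elift; have [Bu|nu] := eqVneq B (sing u).
    by move: nAA; rewrite -BA Bu CN_CN1 eqxx.
  have [Bv|nv] := eqVneq B (nbh v); last by rewrite !mulr0 addr0.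
  by move: nAA; rewrite -BA Bv CN_CNnbh eqxx.
rewrite /elift; have [Av|nv] := eqVneq A (sing v).
  by move: nAA; rewrite Av CN_CN1 eqxx.
have [Au|nu] := eqVneq A (nbh u); last by rewrite !mulr0 addr0.
by move: nAA; rewrite Au CN_CNnbh eqxx.
Qed.

Lemma sedge_neq u v : sedge u v -> u != v.
Proof. by apply: contraTneq => ->; rewrite sedge_irr. Qed.

(** An inner point of an edge has just its two directed lifts. The case analysis is due to the
    vertices, which are represented on every incident edge. *)
Lemma shadow_fiber T T' :
  (forall B, is_diagonal B -> \val T B = 0) ->
  (forall B, is_diagonal B -> \val T' B = 0) ->
  shadow (\val T) = shadow (\val T') -> T' = T \/ T' = z2act T.
Proof.
move=> T0 T'0.
have [u [v [x [uv x0 x1 E]]]] := LR_no_diag (set_valP T) T0.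
have [u' [v' [x' [uv' x'0 x'1 E']]]] := LR_no_diag (set_valP T') T'0.
have EA := act_elift uv x0 x1 E.
have nuv := sedge_neq uv; have nuv' := sedge_neq uv'.
rewrite E E' !shadow_elift => S.
have Su := congr1 (fun h => h u) S; have Sv := congr1 (fun h => h v) S.
move: Su Sv; rewrite /edge_pt /= !eqxx (negPf nuv) [v == u]eq_sym (negPf nuv).
rewrite !mulr1 !mulr0 addr0 add0r.
suff : elift u' v' x' = elift u v x \/ elift u' v' x' = elift v u (1 - x) ->
    T' = T \/ T' = z2act T.
  move=> H Su Sv; apply: H; move: Su Sv.
  have [uu|nuu] := eqVneq u u'.
    subst u'; rewrite (negPf nuv') [v == u]eq_sym (negPf nuv).
    rewrite !mulr1 !mulr0 addr0 add0r => xx; subst x'.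
    have [-> _|nvv] := eqVneq v v'; first by left.
    rewrite mulr0 => x1'; left; apply/funext => A; rewrite /elift.
    by rewrite x1' !mul0r.
  have [uv1|nuv1] := eqVneq u v'.
    subst v'; rewrite !mulr0 !mulr1 add0r [v == u]eq_sym (negPf nuv) mulr0 addr0.
    move=> xx; have [vu|nvu] := eqVneq v u'.
      by subst u'; rewrite mulr1 => xx'; right; rewrite xx'.
    rewrite mulr0 => x1'; right; apply/funext => A; rewrite /elift.
    have -> : x = 1 by lra.
    have -> : x' = 0 by lra.
    by rewrite subrr !mul0r.
  rewrite !mulr0 addr0 => xx; have x00 : x = 0 by lra.
  rewrite x00; have [vu|nvu] := eqVneq v u'.
    subst u'; rewrite (negPf nuv') mulr1 mulr0 addr0 subr0 => xx'.
    right; apply/funext => A; rewrite /elift subrr mul0r addr0 -xx'.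
    by rewrite subrr mul0r addr0.
  rewrite mulr0 add0r; have [vv|nvv] := eqVneq v v'.
    subst v'; rewrite mulr1 => xx'; left; apply/funext => A.
    have -> : x' = 0 by lra.
    by rewrite /elift !mul0r.
  by rewrite mulr0 subr0 => /eqP; rewrite oner_eq0.
rewrite -E -E' -EA => -[H|H]; [left|right]; exact: val_inj.
Qed.

Lemma Lam_continuous a b c d : continuous (Lam a b c d).
Proof.
have cm (f : R * R -> R) (k : R) : continuous f -> continuous (fun z => f z * k).
  by move=> ?; apply: contM => //; exact: contcst.
have [c1 _ _] := gauge_l1 R.
have c1' := @fst_continuous R; have c2' := @snd_continuous R.
apply: ptws_continuous => A; rewrite /Lam.
by repeat apply: contD; apply: cm;
  first [exact: posp_continuous | exact: posn_continuous |
         by apply: contB => //; exact: contcst].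
Qed.

Lemma quad_pt_continuous a b c d : continuous (quad_pt a b c d).
Proof.
have cm (f : R * R -> R) (k : R) : continuous f -> continuous (fun z => f z * k).
  by move=> ?; apply: contM => //; exact: contcst.
have c1' := @fst_continuous R; have c2' := @snd_continuous R.
apply: ptws_continuous => A; rewrite /quad_pt.
by repeat apply: contD; apply: cm;
  first [exact: posp_continuous | exact: posn_continuous].
Qed.

Lemma elift_continuous u v : continuous (elift u v).
Proof.
apply: ptws_continuous => A; rewrite /elift.
apply: contD; apply: contM; try exact: contcst; first by move=> x; exact: cvg_id.
by apply: contB; [exact: contcst | move=> x; exact: cvg_id].
Qed.

Lemma edge_pt_continuous u v : continuous (edge_pt u v).
Proof.
apply: ptws_continuous => w; rewrite /edge_pt.
apply: contD; apply: contM; try exact: contcst; first by move=> x; exact: cvg_id.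
by apply: contB; [exact: contcst | move=> x; exact: cvg_id].
Qed.

End LovaszPoints.

(** * Points of the graph *)

Lemma within_comp (X Y Z : topologicalType) (A : set X) (B : set Y)
    (f : X -> Y) (g : Y -> Z) : {within A, continuous f} ->
  (forall x, A x -> B (f x)) -> {within B, continuous g} ->
  {within A, continuous (fun x => g (f x))}.
Proof.
move=> /subspace_continuousP cf AB /subspace_continuousP cg.
apply/subspace_continuousP => x Ax W nW.
have H : nbhs x [set y | A y -> B (f y) -> W (g (f y))].
  exact: cf x Ax _ (cg (f x) (AB x Ax) W nW).
suff : nbhs x [set y | A y -> W (g (f y))] by [].
by apply: filterS H => y H Ay; apply: H => //; exact: AB.
Qed.

Section GraphPoints.
Variables (R : realType) (G : sgraph).
Implicit Types (a b c d u v w : G) (z : R * R) (s : R).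
Local Notation GR := (realization R (graph_complex G)).
Implicit Types (t : {ptws G -> R}).

Lemma GR_of_supp t u v : (forall x, 0 <= t x) -> \sum_x t x = 1 ->
  sedge u v -> (forall x, t x != 0 -> x = u \/ x = v) -> GR t.
Proof.
move=> t0 t1 uv ts; split=> //; rewrite inE.
have sub : [set x | t x != 0]%SET \subset diag u v.
  by apply/fintype.subsetP => x; rewrite !inE => /ts[] ->; rewrite eqxx ?orbT.
have uv' := sedge_neq uv.
have [|c1] := leqP #|[set x | t x != 0]%SET| 1; first by [].
apply/orP; right; apply/existsP; exists u; apply/existsP; exists v; rewrite uv /=.
by rewrite eqEcard sub cards2 uv'.
Qed.

Lemma edge_pt_ge0 u v s x : 0 <= s -> s <= 1 -> 0 <= edge_pt u v s x :> R.
Proof. by move=> *; rewrite addr_ge0 ?mulr_ge0 ?ler0n // subr_ge0. Qed.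

Lemma edge_pt_real u v s : sedge u v -> 0 <= s -> s <= 1 ->
  GR (edge_pt u v s).
Proof.
move=> uv s0 s1; apply: (GR_of_supp _ _ uv).
- by move=> x; exact: edge_pt_ge0.
- by rewrite /edge_pt big_split /= !sum_delta addrC subrK.
move=> x; rewrite /edge_pt; have [|_] := eqVneq x u; first by left.
have [|_] := eqVneq x v; first by right.
by rewrite !mulr0 addr0 eqxx.
Qed.

Lemma GR_edge_pt t u v : u != v -> (forall x, 0 <= t x) -> \sum_x t x = 1 ->
  (forall x, t x != 0 -> x = u \/ x = v) ->
  exists s, [/\ 0 <= s, s <= 1 & t = edge_pt u v s].
Proof.
move=> uv t0 t1 ts.
have E : t u + t v = 1.
  rewrite -t1 (bigD1 u) //= (bigD1 v) /=; last by rewrite eq_sym.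
  rewrite big1 ?addr0 // => x /andP[xu xv]; apply/eqP; apply: contraT => /ts[] E.
    by rewrite E eqxx in xu.
  by rewrite E eqxx in xv.
have E' : 1 - t u = t v by rewrite -E addrAC subrr add0r.
exists (t u); split=> //; first by rewrite -E lerDl.
apply/funext => x; rewrite /edge_pt E'.
have [->|xu] := eqVneq x u; first by rewrite (negPf uv) mulr1 mulr0 addr0.
have [->|xv] := eqVneq x v; first by rewrite mulr0 mulr1 add0r.
rewrite !mulr0 addr0; apply/eqP; apply: contraT => /ts[] E2.
  by rewrite E2 eqxx in xu.
by rewrite E2 eqxx in xv.
Qed.

(** A vertex is written as an end point of an edge, whence the assumption on neighbours. *)
Lemma GR_cases t : (forall u, exists v, sedge u v) -> GR t ->
  exists u v s, [/\ sedge u v, 0 <= s, s <= 1 & t = edge_pt u v s].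
Proof.
move=> nb [t0 t1 tK].
suff [u [v [uv ts]]] : exists u v, sedge u v /\ forall x, t x != 0 -> x = u \/ x = v.
  have [s [s0 s1 ->]] := GR_edge_pt (sedge_neq uv) t0 t1 ts.
  by exists u, v, s.
move: tK; rewrite inE => /orP[c1|/existsP[u /existsP[v /andP[uv /eqP E]]]].
  have /fintype.card_gt0P[u tu] : (0 < #|[set x | (t x != 0)%R]%SET|)%N.
    rewrite card_gt0; apply/negP => /eqP E; move: t1; rewrite big1.
      by move/eqP; rewrite eq_sym oner_eq0.
    move=> x _; apply/eqP; apply: contraT => tx.
    by have : x \in [set x | t x != 0]%SET; [rewrite inE | rewrite E inE].
  have [v uv] := nb u; exists u, v; split => // x tx; left.
  by move/card_le1P: c1 => /(_ u tu x); rewrite inE tx inE => /esym/eqP.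
exists u, v; split=> // x tx.
have : x \in [set x | t x != 0]%SET by rewrite inE.
by rewrite E !inE => /orP[]/eqP; [left | right].
Qed.

Lemma edge_ptC u v s : edge_pt u v s = edge_pt v u (1 - s).
Proof.
by apply/funext => x; rewrite /edge_pt; have -> : 1 - (1 - s) = s; [ring | rewrite addrC].
Qed.

Lemma quad_edge_sedge a b c d u v : quad a b c d -> quad_edge a b c d u v ->
  sedge u v.
Proof.
case/and5P => ab bc cd da _.
by case/or4P => /andP[/eqP-> /eqP->].
Qed.

Lemma quad_pt_edges a b c d z : l1 z = 1 -> exists u v s,
  [/\ quad_edge a b c d u v, 0 <= s, s <= 1 &
      quad_pt a b c d z = edge_pt u v s].
Proof.
case: z => x y; rewrite /l1 /=.
have [x0|/ltW x0] := leP 0 x; have [y0|/ltW y0] := leP 0 y.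
- rewrite !ger0_norm // => E; exists a, b, x; split=> //; last 1 first.
  + apply/funext => v; rewrite /quad_pt /edge_pt /= (posp_pos x0) (posn_pos x0).
    by rewrite (posp_pos y0) (posn_pos y0) -E; ring.
  + by rewrite /quad_edge !eqxx.
  + lra.
- rewrite (ger0_norm x0) (ler0_norm y0) => E; exists d, a, (- y).
  split; [by rewrite /quad_edge !eqxx !orbT|lra|lra|].
  apply/funext => v; rewrite /quad_pt /edge_pt /= (posp_pos x0) (posn_pos x0).
  by rewrite (posp_neg y0) (posn_neg y0) -E; ring.
- rewrite (ler0_norm x0) (ger0_norm y0) => E; exists b, c, y.
  split; [by rewrite /quad_edge !eqxx !orbT|lra|lra|].
  apply/funext => v; rewrite /quad_pt /edge_pt /= (posp_neg x0) (posn_neg x0).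
  by rewrite (posp_pos y0) (posn_pos y0) -E; ring.
- rewrite (ler0_norm x0) (ler0_norm y0) => E; exists c, d, (- x).
  split; [by rewrite /quad_edge !eqxx !orbT|lra|lra|].
  apply/funext => v; rewrite /quad_pt /edge_pt /= (posp_neg x0) (posn_neg x0).
  by rewrite (posp_neg y0) (posn_neg y0) -E; ring.
Qed.

Lemma edge_pt_quad a b c d u v s : quad_edge a b c d u v -> 0 <= s -> s <= 1 ->
  exists2 z, l1 z = 1 & edge_pt u v s = quad_pt a b c d z.
Proof.
move=> + s0 s1; have r0 : 0 <= 1 - s by rewrite subr_ge0.
have s0' : - s <= 0 by rewrite oppr_le0.
have r0' : - (1 - s) <= 0 by rewrite oppr_le0.
case/or4P => /andP[/eqP-> /eqP->].
- exists (s, 1 - s); first by rewrite /l1 /= !ger0_norm //; ring.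
  apply/funext => w; rewrite /quad_pt /edge_pt /= (posp_pos s0) (posn_pos s0).
  by rewrite (posp_pos r0) (posn_pos r0); ring.
- exists (- (1 - s), s); first by rewrite /l1 /= ler0_norm // ger0_norm //; ring.
  apply/funext => w; rewrite /quad_pt /edge_pt /= (posp_pos s0) (posn_pos s0).
  by rewrite (posp_neg r0') (posn_neg r0'); ring.
- exists (- s, - (1 - s)); first by rewrite /l1 /= !ler0_norm //; ring.
  apply/funext => w; rewrite /quad_pt /edge_pt /= (posp_neg s0') (posn_neg s0').
  by rewrite (posp_neg r0') (posn_neg r0'); ring.
- exists (1 - s, - s); first by rewrite /l1 /= ger0_norm // ler0_norm //; ring.
  apply/funext => w; rewrite /quad_pt /edge_pt /= (posp_neg s0') (posn_neg s0').
  by rewrite (posp_pos r0) (posn_pos r0); ring.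
Qed.

Lemma quad_pt_real a b c d z : quad a b c d -> l1 z = 1 ->
  GR (quad_pt a b c d z).
Proof.
move=> q z1; have [u [v [s [uv s0 s1 ->]]]] := quad_pt_edges a b c d z1.
by apply: edge_pt_real => //; exact: quad_edge_sedge uv.
Qed.

Lemma quad_edgeP a b c d u v : quad a b c d ->
  quad_edge a b c d u v <-> u \in [:: a; b; c; d] /\ v = next [:: a; b; c; d] u.
Proof.
move=> /quad_neq[ab ac ad bc /andP[bd cd]].
have nE : [/\ next [:: a; b; c; d] a = b, next [:: a; b; c; d] b = c,
             next [:: a; b; c; d] c = d & next [:: a; b; c; d] d = a].
  rewrite /next /= !eqxx ![_ == a]eq_sym ![c == b]eq_sym ![d == b]eq_sym.
  rewrite ![d == c]eq_sym.
  by rewrite (negPf ab) (negPf ac) (negPf ad) (negPf bc) (negPf bd) (negPf cd).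
have [na nb nc nd] := nE.
split.
  by case/or4P => /andP[/eqP-> /eqP->]; rewrite ?na ?nb ?nc ?nd !inE !eqxx ?orbT.
rewrite !inE => -[/or4P[]/eqP-> ->]; rewrite ?na ?nb ?nc ?nd /quad_edge !eqxx ?orbT //.
Qed.

Lemma cycle_pointsP a b c d (W : polyhedron R (graph_complex G)) :
  quad a b c d -> cycle_points [:: a; b; c; d] W <->
  exists2 z, l1 z = 1 & \val W = quad_pt a b c d z.
Proof.
move=> q; split.
  move=> [u up us]; set v := next _ u in us.
  have uv : quad_edge a b c d u v by apply/quad_edgeP.
  have [t0 t1 _] := set_valP W.
  have [s [s0 s1 E]] := GR_edge_pt (sedge_neq (quad_edge_sedge q uv)) t0 t1 us.
  have [z z1 E'] := edge_pt_quad uv s0 s1.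
  by exists z => //; rewrite -E'; exact: E.
move=> [z z1 E]; have [u [v [s [uv s0 s1 E']]]] := quad_pt_edges a b c d z1.
have /(quad_edgeP _ _ q)[up vE] := uv.
exists u => // y; rewrite -vE E E' /edge_pt.
have [|_] := eqVneq y u; first by left.
have [|_] := eqVneq y v; first by right.
by rewrite !mulr0 addr0 eqxx.
Qed.

End GraphPoints.

(** * From the Lovász complex to a quadrangulation *)

Lemma connected_clopen_component (X : topologicalType) (A B : set X) (x : X) :
  B x -> B `<=` A -> connected B -> open B -> open (A `\` B) ->
  connected_component A x = B.
Proof.
move=> Bx BA cB oB oAB; apply/seteqP; split; last exact: connected_component_max.
set C := connected_component A x.
suff <- : C `&` B = C by apply: subIsetr.
have := @component_connected _ A x; apply.
- by exists x; split => //; apply: connected_component_refl; exact: BA.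
- by exists B.
exists (~` (A `\` B)); first exact: open_closedC.
apply/seteqP; split => y [Cy By]; split => //; first by case.
have Ay : A y by exact: connected_component_sub Cy.
by apply: contrapT => nB; apply: By.
Qed.

Section DiscShape.
Variable R : realType.

Lemma l1_lt1_connected : connected [set z : R * R | l1 z < 1].
Proof.
have hom := gauge_l1 R.
rewrite (_ : [set _ | _] = \bigcup_(w in [set z : R * R | l1 z < 1])
    ((fun k : R => k *: w) @` `[0, 1])).
  apply: bigcup_connected; first by exists 0 => w _; exists 0;
    rewrite /= ?scale0r ?in_itv /= ?lexx ?ler01.
  move=> w _; apply: connected_continuous_connected; first exact: segment_connected.
  apply: continuous_subspaceT; apply: contZ; last exact: contcst.
  by move=> k; exact: cvg_id.
apply/seteqP; split => [w w1|_ [w /= w1 [k /= + <-]]].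
  exists w => //; exists 1; last by rewrite scale1r.
  by rewrite /= in_itv /= ler01 lexx.
have [_ _ ->] := hom; rewrite in_itv /= => /andP[k0 k1]; rewrite ger0_norm //.
by apply: le_lt_trans w1; rewrite ler_piMl // (gauge_ge0 _ hom).
Qed.

(** It mediates between the round disc in [bounded_by] and the diamond in [cell]. *)
Definition round_to_square : R * R -> R * R :=
  radial (@l2 R) (fun w => (l1 w)^-1 *: w).

Let l2_neq0 (w : R * R) : l2 w = 1 -> w != 0.
Proof.
move=> E; rewrite -(gauge_eq0 w (gauge_l2 R)) E oner_eq0 //.
Qed.

Let ch : {within [set z : R * R | l2 z = 1],
  continuous (fun w => (l1 w)^-1 *: w)}.
Proof.
apply: continuous_in_subspaceT => w /set_mem/l2_neq0 w0.
have [c1 _ _] := gauge_l1 R.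
apply: (@cvgZ _ _ _ (nbhs w) _ (fun y => (l1 y)^-1)); last exact: cvg_id.
apply: (@cvgV _ _ (nbhs w) _ (@l1 R) (l1 w)); last exact: c1.
by rewrite (gauge_eq0 w (gauge_l1 R)).
Qed.

Let hN (w : R * R) : l2 w = 1 -> l1 ((l1 w)^-1 *: w) = 1.
Proof.
move/l2_neq0 => w0; have [_ _ ->] := gauge_l1 R.
rewrite ger0_norm ?invr_ge0 ?(gauge_ge0 _ (gauge_l1 R)) // mulVf //.
by rewrite (gauge_eq0 w (gauge_l1 R)).
Qed.

Let ih (z w : R * R) : l2 z = 1 -> l2 w = 1 ->
  (l1 z)^-1 *: z = (l1 w)^-1 *: w -> z = w.
Proof.
move=> z1 w1 E; have [_ _ hom] := gauge_l2 R.
have g := gauge_ge0 _ (gauge_l1 R).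
have := congr1 (@l2 R) E; rewrite !hom z1 w1 !mulr1.
rewrite !ger0_norm ?invr_ge0 ?g // => E'.
move: E; rewrite -E' => /scalerI; apply; rewrite invr_eq0.
by rewrite (gauge_eq0 z (gauge_l1 R)) l2_neq0.
Qed.

Let sh (y : R * R) : l1 y = 1 -> exists2 z, l2 z = 1 & (l1 z)^-1 *: z = y.
Proof.
move=> y1; have [_ _ hom] := gauge_l2 R; have [_ _ hom1] := gauge_l1 R.
have g := gauge_ge0 y (gauge_l2 R).
have y0 : l2 y != 0.
  by rewrite (gauge_eq0 y (gauge_l2 R)) -(gauge_eq0 y (gauge_l1 R)) y1 oner_eq0.
exists ((l2 y)^-1 *: y).
  by rewrite hom ger0_norm ?invr_ge0 // mulVf.
by rewrite hom1 y1 mulr1 ger0_norm ?invr_ge0 // invrK scalerA divff // scale1r.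
Qed.

Lemma round_to_squareE z : l1 (round_to_square z) = l2 z.
Proof. exact: (radial_gauge (gauge_l2 R) (gauge_l1 R) hN). Qed.

Lemma round_to_square_continuous : continuous round_to_square.
Proof. exact: (radial_continuous (gauge_l2 R) (gauge_l1 R) ch hN). Qed.

Lemma round_to_square_inj : injective round_to_square.
Proof. exact: (radial_inj (gauge_l2 R) (gauge_l1 R) hN ih). Qed.

Lemma round_to_square_surj y : exists z, round_to_square z = y.
Proof. exact: (radial_surj (gauge_l2 R) (gauge_l1 R) sh). Qed.

(* A closed face parametrised by the diamond [|x| + |y| <= 1], whose corners
   are the vertices of the boundary cycle and on whose sides the embedding is
   affine. *)
Definition cell (G : sgraph) (S : topologicalType)
    (f : polyhedron R (graph_complex G) -> S)
    (w0 : polyhedron R (graph_complex G)) (a b c d : G) (Phi : R * R -> S) :=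
  [/\ quad a b c d, {within [set z | l1 z <= 1], continuous Phi},
      forall z w, l1 z <= 1 -> l1 w <= 1 -> Phi z = Phi w -> z = w,
      forall z, l1 z = 1 -> Phi z = f (poly_pt w0 (quad_pt a b c d z)) &
      is_face f (Phi @` [set z | l1 z < 1])].

Lemma cell_bounded_by (G : sgraph) (S : topologicalType)
    (f : polyhedron R (graph_complex G) -> S) w0 a b c d Phi :
  cell f w0 a b c d Phi ->
  bounded_by f (Phi @` [set z | l1 z < 1]) [:: a; b; c; d].
Proof.
move=> [q cP iP bP fP]; exists (Phi \o round_to_square); split.
- apply: within_comp cP; last by move=> z /=; rewrite round_to_squareE l2_le1.
  by apply: continuous_subspaceT; exact: round_to_square_continuous.
- move=> z w /set_mem /= z1 /set_mem /= w1 /iP.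
  by rewrite !round_to_squareE !l2_le1 => /(_ z1 w1)/round_to_square_inj.
- apply/seteqP; split => [_ [z /= z1 <-]|_ [z /= z1 <-]].
    by exists (round_to_square z); rewrite //= round_to_squareE l2_lt1.
  have [w E] := round_to_square_surj z; exists w; rewrite /= ?E //.
  by rewrite -l2_lt1 -round_to_squareE E.
- apply/seteqP; split => [_ [z /= z1 <-]|_ [W /(cycle_pointsP _ q)[z z1 WE] <-]].
    have rz : l1 (round_to_square z) = 1.
      by rewrite round_to_squareE; apply/l2_eq1.
    rewrite bP //; eexists; last by [].
    apply/(cycle_pointsP _ q); exists (round_to_square z) => //.
    by rewrite val_poly_pt //; exact: quad_pt_real.
  have [w E] := round_to_square_surj z; exists w.
    by apply/l2_eq1; rewrite -round_to_squareE E.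
  rewrite /= E bP //; congr f; apply: val_inj.
  by rewrite val_poly_pt //; exact: quad_pt_real.
Qed.

End DiscShape.

(** * The graph and its faces in the quotient of the Lovász complex *)

Section Quotient.
Variables (R : realType) (G : sgraph).
Hypothesis reg : lovasz_regular G.
Local Notation L := (lovasz_space R G).
Variable t0 : L.
Implicit Types (a b c d u v : G) (T : L) (B : {set G}).
Local Notation poly := (polyhedron R (graph_complex G)).
Implicit Types (W : poly).
Variable w0 : poly.

Definition no_diag T := forall B, is_diagonal B -> \val T B = 0.

Definition lift_pt (t : {ptws {set G} -> R}) : L := poly_pt t0 t.

Lemma val_lift_pt t : realization R (lovasz_complex G) t -> \val (lift_pt t) = t.
Proof. exact: val_poly_pt. Qed.

Lemma neighbor_ex u : exists v, sedge u v.
Proof.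
have [_ _ two] := reg.
have /fintype.card_gt0P[v] : (0 < #|nbh u|)%N by exact: ltn_trans (two u).
by rewrite mem_nbh; exists v.
Qed.

Lemma no_diag_lift W : exists T, no_diag T /\ shadow (\val T) = \val W.
Proof.
have [u [v [s [uv s0 s1 E]]]] := GR_cases neighbor_ex (set_valP W).
exists (lift_pt (elift u v s)); split => [B dB|].
  by rewrite val_lift_pt ?elift_diag0 //; exact: elift_real.
rewrite val_lift_pt; last exact: elift_real.
by rewrite shadow_elift // -E.
Qed.

Lemma no_diag_act T : no_diag T -> no_diag (z2act T).
Proof.
move=> T0 B dB; apply/eqP; apply: contraT => TB.
have [B0 CB0 BB] := lovasz_act_closed TB.
rewrite (lovasz_act_val T BB) T0 ?eqxx // in TB.
by move: dB; rewrite /is_diagonal BB andbC.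
Qed.

(** The choice of a lift is immaterial: by [shadow_fiber] all lifts without weight on diagonals form
    one orbit. *)
Definition quotient_embedding W : orbit_space L :=
  orbit_of (xget t0 [set T | no_diag T /\ shadow (\val T) = \val W]).
Local Notation f := quotient_embedding.

Lemma quotient_embeddingE W T :
  no_diag T -> shadow (\val T) = \val W -> f W = orbit_of T.
Proof.
move=> T0 TW; rewrite /f; case: xgetP => [T' _ [T'0 T'W]|/(_ T)]; last first.
  by move=> /(_ (conj T0 TW)).
by apply/orbit_ofP; apply: (shadow_fiber reg) => //; rewrite T'W TW.
Qed.

Lemma quotient_embedding_inj : injective f.
Proof.
move=> W W'; have [T [T0 TW]] := no_diag_lift W.
have [T' [T'0 T'W]] := no_diag_lift W'.
rewrite (quotient_embeddingE T0 TW) (quotient_embeddingE T'0 T'W) => /orbit_ofP E.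
apply: val_inj; rewrite -TW -T'W; case: E => -> //.
by rewrite shadow_act.
Qed.

(** The chosen lift need not vary continuously, but [elift] is a continuous lift along each directed
    edge, and finitely many edges cover the graph. *)
Lemma quotient_embedding_continuous : continuous f.
Proof.
pose al (e : G * G) (s : R) := poly_pt w0 (edge_pt e.1 e.2 s).
have rE e s : sedge e.1 e.2 -> `[0, 1]%classic s ->
    realization R (graph_complex G) (edge_pt e.1 e.2 s).
  by move=> ee; rewrite /= in_itv /= => /andP[? ?]; exact: edge_pt_real.
apply: (@finite_cover_continuous _ [pred e | sedge e.1 e.2] R `[0, 1]%classic
  (@segment_compact R 0 1) _ _ al).
- exact: polyhedron_hausdorff.
- move=> e ee; apply: poly_pt_continuous => [|s s01]; last exact: rE.
  by apply: continuous_subspaceT; exact: edge_pt_continuous.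
- move=> W; have [u [v [s [uv s0 s1 E]]]] := GR_cases neighbor_ex (set_valP W).
  exists (u, v), s; split => //; first by rewrite /= in_itv /= s0.
  by apply: val_inj; rewrite val_poly_pt //; exact: edge_pt_real.
move=> [u v] /= uv.
have rL s : `[0, 1]%classic s ->
    realization R (lovasz_complex G) (elift u v s).
  by rewrite /= in_itv /= => /andP[? ?]; exact: elift_real.
have c : {within `[0, 1]%classic,
    continuous (fun s : R => orbit_of (lift_pt (elift u v s)))}.
  apply: (@within_comp _ _ _ _ setT (fun s : R => lift_pt (elift u v s))
    (@orbit_of L)) => //.
    apply: poly_pt_continuous => [|s s01]; last exact: rL.
    by apply: continuous_subspaceT; exact: elift_continuous.
  by apply: continuous_subspaceT; exact: orbit_of_continuous.
apply: subspace_eq_continuous c => s /set_mem s01.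
apply/esym; apply: quotient_embeddingE => [B dB|].
  by rewrite val_lift_pt ?elift_diag0 //; exact: rL.
rewrite val_lift_pt; last exact: rL.
by rewrite shadow_elift // val_poly_pt //; exact: (rE (u, v)).
Qed.

Lemma range_quotient_embedding T : range f (orbit_of T) <-> no_diag T.
Proof.
split=> [[W _]|T0].
  have [T' [T'0 T'W]] := no_diag_lift W.
  rewrite (quotient_embeddingE T'0 T'W) => /orbit_ofP[] -> //.
  exact: no_diag_act.
have [u [v [s [uv s0 s1 E]]]] := LR_no_diag reg (set_valP T) T0.
exists (poly_pt w0 (edge_pt u v s)) => //.
apply: quotient_embeddingE => //; rewrite val_poly_pt; last exact: edge_pt_real.
by rewrite -(shadow_elift reg) -E.
Qed.

Definition quotient_cell a b c d z : orbit_space L :=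
  orbit_of (lift_pt (Lam a b c d z)).

Lemma val_Lam a b c d z : quad a b c d -> l1 z <= 1 ->
  \val (lift_pt (Lam a b c d z)) = Lam a b c d z.
Proof. by move=> q z1; rewrite val_lift_pt //; exact: Lam_real. Qed.

Lemma quotient_cell_continuous a b c d : quad a b c d ->
  {within [set z | l1 z <= 1], continuous (quotient_cell a b c d)}.
Proof.
move=> q; apply: (@within_comp _ _ _ _ setT
    (fun z => lift_pt (Lam a b c d z)) (@orbit_of L)) => //.
  apply: poly_pt_continuous => [|z z1]; last exact: Lam_real.
  by apply: continuous_subspaceT; exact: Lam_continuous.
by apply: continuous_subspaceT; exact: orbit_of_continuous.
Qed.

(** Passing to orbits loses nothing on a cell: the shadow is constant on orbits and still determines
    the point of the diamond, which yields [quotient_cell_inj]. *)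
Lemma quotient_cell_shadow a b c d a' b' c' d' z w :
  quad a b c d -> quad a' b' c' d' -> l1 z <= 1 -> l1 w <= 1 ->
  quotient_cell a b c d z = quotient_cell a' b' c' d' w ->
  quad_pt a b c d z = quad_pt a' b' c' d' w.
Proof.
move=> q q' z1 w1 /orbit_ofP E.
rewrite -(shadow_Lam reg z q) -(shadow_Lam reg w q').
rewrite -(val_Lam q z1) -(val_Lam q' w1).
by case: E => ->; rewrite // shadow_act.
Qed.

Lemma quotient_cell_inj a b c d z w : quad a b c d -> l1 z <= 1 -> l1 w <= 1 ->
  quotient_cell a b c d z = quotient_cell a b c d w -> z = w.
Proof.
by move=> q z1 w1 /quotient_cell_shadow => /(_ q q z1 w1)/(quad_pt_inj q).
Qed.

Lemma Lam_no_diag a b c d z : quad a b c d -> l1 z = 1 ->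
  no_diag (lift_pt (Lam a b c d z)).
Proof.
move=> q z1 B dB; rewrite val_Lam ?z1 //.
have [->|nB] := eqVneq B (diag a c); first by rewrite Lam_diag // z1 subrr.
exact: Lam_diag0.
Qed.

Lemma quotient_cell_boundary a b c d z : quad a b c d -> l1 z = 1 ->
  quotient_cell a b c d z = f (poly_pt w0 (quad_pt a b c d z)).
Proof.
move=> q z1; apply/esym; apply: quotient_embeddingE; first exact: Lam_no_diag.
rewrite val_Lam ?z1 // shadow_Lam // val_poly_pt //; exact: quad_pt_real.
Qed.

Lemma Lam_flip a b c d (z : R * R) : Lam a d c b z = Lam a b c d (z.1, - z.2).
Proof.
apply/funext => A; rewrite /Lam /l1 /= normrN pospN posnN.
by ring.
Qed.

Lemma Lam_flop a b c d (z : R * R) : Lam c b a d z = Lam a b c d (- z.1, z.2).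
Proof.
apply/funext => A; rewrite /Lam /l1 /= normrN pospN posnN finset.setUC.
by ring.
Qed.

(** The open star of [diag a c] is a single open diamond. As [CN] recovers the second diagonal from
    the first, another listing with this diagonal differs by signs of the coordinates only. *)
Lemma lovasz_diag_pt T a b c d : quad a b c d -> 0 < \val T (diag a c) ->
  exists2 z, l1 z < 1 & T = lift_pt (Lam a b c d z).
Proof.
move=> q Tac.
have [[u [v [s [_ _ _ E]]]]|[a' [b' [c' [d' [z [q' z1 E]]]]]]] :=
    LR_cases reg (set_valP T).
  by move: Tac; rewrite [\val T]E elift_diag0 ?ltxx // (diagonal_quad reg q).
have ac : diag a c = diag a' c'.
  apply/eqP; apply: contraTT Tac => nac.
  by rewrite [\val T]E Lam_diag0 ?ltxx // (diagonal_quad reg q).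
have bd : diag b d = diag b' d' by rewrite -(quad_CN reg q) ac (quad_CN reg q').
have [ac0 bd0] : a != c /\ b != d by case/and5P: q => _ _ _ _ /andP[].
suff [w w1 Ew] : exists2 w, l1 w < 1 & Lam a' b' c' d' z = Lam a b c d w.
  exists w => //; apply: val_inj; rewrite val_Lam ?ltW // -Ew; exact: E.
move: z1; rewrite /l1 => z1.
have [[-> ->]|[-> ->]] := set2_inj ac0 ac;
have [[-> ->]|[-> ->]] := set2_inj bd0 bd.
- by exists z.
- by exists (z.1, - z.2); [rewrite /l1 /= normrN | exact: Lam_flip].
- by exists (- z.1, z.2); [rewrite /l1 /= normrN | exact: Lam_flop].
- exists (- z.1, - z.2); first by rewrite /l1 /= !normrN.
  by rewrite [LHS]Lam_flip; exact: Lam_flop.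
Qed.

(** In this form the open cell is visibly open: positivity of a coordinate is an open condition, and
    the orbit map is open. *)
Lemma quotient_cell_interior a b c d : quad a b c d ->
  quotient_cell a b c d @` [set z | l1 z < 1] =
  @orbit_of L @` [set T | 0 < \val T (diag a c)].
Proof.
move=> q; apply/seteqP; split => [_ [z /= z1 <-]|_ [T /= Tac <-]].
  exists (lift_pt (Lam a b c d z)) => //=.
  by rewrite val_Lam ?ltW // Lam_diag // subr_gt0.
by have [z z1 ->] := lovasz_diag_pt q Tac; exists z.
Qed.

Lemma coordinate_open B : open [set T : L | 0 < \val T B].
Proof.
apply: (@open_comp _ _ (fun T : L => \val T B) [set x | 0 < x]) => [T _|].
  apply: (@continuous_comp L {ptws {set G} -> R} R set_val (fun t => t B)).
    exact: initial_continuous.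
  exact: (@proj_continuous {set G} (fun _ => R) B).
exact: open_gt.
Qed.

Lemma not_range_quotient_embedding T : ~ range f (orbit_of T) ->
  exists a b c d, quad a b c d /\ 0 < \val T (diag a c).
Proof.
move=> nT; have [[u [v [s [uv s0 s1 E]]]]|[a [b [c [d [z [q z1 E]]]]]]] :=
    LR_cases reg (set_valP T).
  case: nT; apply/range_quotient_embedding => B dB.
  by rewrite [\val T]E elift_diag0.
by exists a, b, c, d; split => //; rewrite [\val T]E Lam_diag // subr_gt0.
Qed.

Lemma quotient_cell_disjoint a b c d z : quad a b c d -> l1 z < 1 ->
  ~ range f (quotient_cell a b c d z).
Proof.
move=> q z1 /range_quotient_embedding /(_ _ (diagonal_quad reg q)).
rewrite val_Lam ?ltW // Lam_diag // => /eqP; rewrite subr_eq0 => /eqP E.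
by rewrite -E ltxx in z1.
Qed.

(** The open stars of [diag a c] and [diag b d] have the same image, and those of all other
    diagonals cover the rest of the complement of the graph. Both parts are open, and the first is
    connected. *)
Lemma quotient_component a b c d xi : quad a b c d ->
  (quotient_cell a b c d @` [set z | l1 z < 1]) xi ->
  connected_component (~` range f) xi =
  quotient_cell a b c d @` [set z | l1 z < 1].
Proof.
move=> q xi_in; apply: connected_clopen_component => //.
- by move=> _ [z /= z1 <-]; exact: quotient_cell_disjoint.
- apply: connected_continuous_connected; first exact: l1_lt1_connected.
  apply: continuous_subspaceW (quotient_cell_continuous q) => z.
  by move=> /= /ltW.
- by rewrite quotient_cell_interior //; apply: orbit_of_open; exact: coordinate_open.
rewrite (_ : _ `\` _ = @orbit_of L @` (\bigcup_(B in [set B | [/\ is_diagonal B,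
    B != diag a c & B != diag b d]]) [set T | 0 < \val T B])).
  by apply: orbit_of_open; apply: bigcup_open => B _; exact: coordinate_open.
apply/seteqP; split => [x|_ [T [B [dB Bac Bbd] TB] <-]].
  have [T <-] := orbit_of_surj x => -[nT nO].
  have [a' [b' [c' [d' [q' T']]]]] := not_range_quotient_embedding nT.
  exists T => //; exists (diag a' c') => //; split.
  - exact: diagonal_quad q'.
  - apply: contra_notN nO => /eqP E; rewrite quotient_cell_interior //.
    by exists T; rewrite //= -E.
  - apply: contra_notN nO => /eqP E; rewrite quotient_cell_interior //.
    by exists (z2act T); [have := T'; rewrite E -(act_diag reg T q) | exact: orbit_of_act].
split.
  by move=> /range_quotient_embedding/(_ _ dB) E; move: TB; rewrite /mkset E ltxx.
move=> [y y1 /orbit_ofP E]; pose T' := lift_pt (Lam a b c d y).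
have T'ac : 0 < \val T' (diag a c).
  by rewrite /T' val_Lam ?ltW // Lam_diag // subr_gt0.
have Tac : 0 < \val T (diag a c) \/ 0 < \val T (diag b d).
  case: E => E; [left|right]; first by rewrite E.
  by rewrite -(act_diag reg _ q) E z2actK.
case: Tac => Tac.
  have [z z1 E'] := lovasz_diag_pt q Tac; move: TB.
  by rewrite /mkset E' val_Lam ?ltW // Lam_diag0 ?ltxx.
have [z z1 E'] := lovasz_diag_pt (quad_rot q) Tac; move: TB.
by rewrite /mkset E' (val_Lam (quad_rot q) (ltW z1)) Lam_diag0 ?ltxx.
Qed.

Lemma quotient_cellP a b c d : quad a b c d ->
  cell f w0 a b c d (quotient_cell a b c d).
Proof.
move=> q; split => //.
- exact: quotient_cell_continuous.
- by move=> z w z1 w1; exact: quotient_cell_inj.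
- by move=> z z1; exact: quotient_cell_boundary.
exists (quotient_cell a b c d 0).
  apply: quotient_cell_disjoint => //.
  by have /eqP-> : l1 (0 : R * R) == 0; [rewrite (gauge_eq0 _ (gauge_l1 R))|].
apply/esym; apply: quotient_component => //; exists 0 => //=.
by have /eqP-> : l1 (0 : R * R) == 0; [rewrite (gauge_eq0 _ (gauge_l1 R))|].
Qed.

Lemma quotient_quadrangulation : closed_surface R L ->
  quadrangulation f /\ (forall p, four_cycle p -> facial f p).
Proof.
move=> hL; split; last first.
  move=> p /four_cycleP[a [b [c [d [q ->]]]]].
  have [_ _ _ _ fc] := quotient_cellP q.
  by exists (quotient_cell a b c d @` [set z | l1 z < 1]) => //;
    exact: cell_bounded_by (quotient_cellP q).
split.
- by apply: orbit_space_surface => //; exact: lovasz_act_free.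
- by split; [exact: quotient_embedding_continuous|exact: quotient_embedding_inj].
move=> F [x nx ->]; have [T E] := orbit_of_surj x; rewrite -{}E in nx *.
have [a [b [c [d [q Tac]]]]] := not_range_quotient_embedding nx.
exists [:: a; b; c; d]; first by apply/four_cycleP; exists a, b, c, d.
rewrite (quotient_component q); first exact: cell_bounded_by (quotient_cellP q).
by rewrite quotient_cell_interior //; exists T.
Qed.

End Quotient.

(** * Regularity of a graph whose Lovász complex is a surface *)

Section Converse.
Variables (R : realType) (G : sgraph).
Hypothesis hL : closed_surface R (lovasz_space R G).
Hypothesis nodom : forall u v : G, u <> v -> ~ dominates v u.
Hypothesis noK23 : ~ sg_contains G K23.

Lemma K23_free_CN (a c : G) : a != c -> (#|CN (diag a c)| <= 2)%N.
Proof.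
move=> ac; rewrite leqNgt; apply/negP => /card_gt2P[x [y [z [[xC yC zC] [xy yz zx]]]]].
apply: noK23.
move: xC yC zC; rewrite !mem_CN2 => /andP[ax cx] /andP[ay cy] /andP[az cz].
exists (k23_map a c x y z); split; last exact: k23_map_hom.
apply: k23_map_inj.
rewrite /= !inE !negb_or ac xy yz (sedge_neq ax) (sedge_neq ay).
rewrite (sedge_neq az) (sedge_neq cx) (sedge_neq cy) (sedge_neq cz).
by rewrite [x == z]eq_sym zx.
Qed.

Lemma nbh_sub_eq (u v : G) : nbh u \subset nbh v -> u = v.
Proof. by move=> s; apply: contrapT => uv; exact: (nodom uv s). Qed.

(** The empty neighbourhood of an isolated vertex is dominated by every other one, so [G] would be a
    single vertex; its Lovász complex has no points, but a surface does. *)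
Lemma lovasz_neighbor_ex (u : G) : exists v, sedge u v.
Proof.
apply: contrapT => nv.
have nu0 : nbh u = finset.set0.
  apply/setP => v; rewrite mem_nbh inE; apply/negP => uv.
  by apply: nv; exists v.
have all_u v : v = u by apply/esym/nbh_sub_eq; rewrite nu0 finset.sub0set.
have [[T _] _ _ _] := hL; have [_ _ /lovasz_complexP TL] := set_valP T.
have [A TA] : exists A, \val T A != 0.
  have [_ t1 _] := set_valP T.
  apply: contrapT => nT; move: t1; rewrite big1.
    by move/eqP; rewrite eq_sym oner_eq0.
  by move=> A _; apply: contrapT => /eqP tA; apply: nT; exists A.
have [|A0 CA0 _ _] := TL A; first by rewrite inE.
have /set0Pn[x xA] := A0; have /set0Pn[y /CNP/(_ x xA)] := CA0.
by rewrite (all_u x) (all_u y) sedge_irr.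
Qed.

(* A vertex of degree one would span, with its neighbour, an edge component of
   [G], hence an isolated point of the surface. *)
Lemma lovasz_degree (u : G) : (1 < #|nbh u|)%N.
Proof.
rewrite ltnNge; apply/negP => c1.
have [v uv] := lovasz_neighbor_ex u.
have nu : nbh u = sing v.
  apply/eqP; rewrite eq_sym eqEcard cards1 c1 andbT.
  by rewrite finset.sub1set mem_nbh.
have nv : nbh v = sing u.
  apply/eqP; rewrite eq_sym finset.eqEsubset finset.sub1set mem_nbh sedge_sym uv /=.
  apply/fintype.subsetP => w; rewrite mem_nbh inE => vw.
  apply/eqP/esym/nbh_sub_eq; rewrite nu finset.sub1set mem_nbh sedge_sym //.
have CNv : CN (sing v) = sing u by rewrite CN1.
have CNu : CN (sing u) = sing v by rewrite CN1.
(* No other closed set is comparable with [sing v], so it is an isolated vertex of the complex. *)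
have only B : B != finset.set0 -> CN B != finset.set0 -> CN (CN B) = B ->
    (sing v \subset B) || (B \subset sing v) -> B = sing v.
  move=> B0 CB0 BB /orP[|] s; last first.
    by apply/eqP; rewrite eqEcard s cards1 card_gt0.
  have := CN_sub s; rewrite CNv => s'.
  have CBE : CN B = sing u by apply/eqP; rewrite eqEcard s' cards1 card_gt0.
  by rewrite -BB CBE.
pose t : {ptws {set G} -> R} := fun A => (A == sing v)%:R.
have tE : [set A | t A != 0]%SET = [set sing v]%SET.
  by apply/setP => A; rewrite !inE /t pnatr_eq0; case: (A == sing v).
have Lt : realization R (lovasz_complex G) t.
  split.
  - by move=> A; exact: ler0n.
  - rewrite -[RHS](sum_delta (T := {set G}) (1 : R) (sing v)).
    by apply: eq_bigr => A _; rewrite mul1r.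
  rewrite tE; apply/lovasz_complexP => A /set1P->.
  rewrite CNv CNu; split => //; try by apply/set0Pn; eexists; rewrite inE.
  by move=> B /set1P->; rewrite fintype.subxx.
pose T : lovasz_space R G := SigSub (mem_set Lt).
have TE T' : 0 < \val T' (sing v) -> T' = T.
  move=> Tv; apply: val_inj; have [t0 t1 /lovasz_complexP tL] := set_valP T'.
  have T0 B : B != sing v -> \val T' B = 0.
    move=> nB; apply/eqP; apply: contraT => TB.
    have [|B0 CB0 BB cmp] := tL B; first by rewrite inE.
    have := cmp (sing v); rewrite inE gt_eqF // => /(_ isT); rewrite orbC => c.
    by rewrite (only B B0 CB0 BB c) eqxx in nB.
  have Tv1 : \val T' (sing v) = 1.
    rewrite -[RHS]t1; apply/esym; rewrite (bigD1 (sing v)) // big1 => [|B nB].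
      exact: addr0.
    exact: T0.
  apply/funext => B; rewrite /= /t; have [->|nB] := eqVneq B (sing v).
    by rewrite Tv1.
  exact: T0.
have oT : open [set T].
  rewrite (_ : [set T] = [set T' : lovasz_space R G | 0 < \val T' (sing v)]).
    exact: coordinate_open.
  apply/seteqP; split => [_ ->|T' /TE] //=.
  by rewrite /t eqxx ltr01.
have [U [chi [kap [UT [oU cc cK Uc kP]]]]] := surface_chart hL T.
have oP : open (chi @^-1` [set T]).
  by apply: open_comp oT => z _; exact: cc.
have : nbhs (kap T) (chi @^-1` [set T]).
  by apply: open_nbhs_nbhs; split => //=; have [] := kP T UT.
move=> /nbhs_ballP[e /= e0 He].
have e20 : 0 < e / 2 by rewrite divr_gt0.
have /He /= E : ball (kap T) e (kap T + (e / 2, 0)).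
  rewrite -ball_normE /= opprD addrA subrr sub0r normrN norm_prod_lt /=.
  by rewrite normr0 e0 ger0_norm ?ltW // ltr_pdivrMr // ltr_pMr // ltr1n.
have := cK (kap T + (e / 2, 0)); rewrite E => /eqP.
rewrite -subr_eq0 opprD addrA subrr sub0r oppr_eq0 => /eqP[/eqP].
by rewrite gt_eqF.
Qed.

Lemma lovasz_surface_regular : lovasz_regular G.
Proof.
split; [exact: K23_free_CN|exact: nbh_sub_eq|exact: lovasz_degree].
Qed.

Theorem lovasz_quadrangulation :
  exists f : polyhedron R (graph_complex G) -> orbit_space (lovasz_space R G),
    quadrangulation f /\ (forall p : seq G, four_cycle p -> facial f p).
Proof.
have [[t0 _] _ _ _] := hL.
have [w0 _] : [set: polyhedron R (graph_complex G)] !=set0.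
  have [_ _ /lovasz_complexP tL] := set_valP t0.
  have /set0Pn[A] := supp_neq0 (set_valP t0); rewrite inE => tA.
  have [|/set0Pn[u _] _ _ _] := tL A; first by rewrite inE.
  have [v uv] := lovasz_neighbor_ex u.
  have r : realization R (graph_complex G) (edge_pt u v 1).
    by apply: edge_pt_real.
  by exists (SigSub (mem_set r)).
exists (quotient_embedding t0).
exact: (quotient_quadrangulation lovasz_surface_regular t0 w0 hL).
Qed.

End Converse.

(** * Cells of a quadrangulation *)

Section Half.
Variable R : realType.

(* The point [(1/2, 1/2)] lies on the boundary of the diamond, so a set
   parametrised by part of the diamond cannot be a neighbourhood of its image. *)
Lemma boundary_point_not_nbhs (S : topologicalType) (K : set (R * R))
    (Phi : R * R -> S) : closed_surface R S -> compact K ->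
  K `<=` [set z | l1 z <= 1] -> K (1 / 2, 1 / 2) ->
  {within K, continuous Phi} ->
  (forall z w, K z -> K w -> Phi z = Phi w -> z = w) ->
  ~ nbhs (Phi (1 / 2, 1 / 2)) (Phi @` K).
Proof.
move=> hS cK K1 Km cP iP nP; set m := Phi _ in nP.
have [_ hdS _ _] := hS.
pose ga y := xget 0 [set z | K z /\ Phi z = y].
have gaP y : (Phi @` K) y -> K (ga y) /\ Phi (ga y) = y.
  move=> [z Kz zy]; rewrite /ga; case: xgetP => [w _ //|/(_ z)].
  by move=> /(_ (conj Kz zy)).
have gaK z : K z -> ga (Phi z) = z.
  by move=> Kz; have [|h1 h2] := gaP (Phi z); [exists z | apply: iP].
have cga := compact_inverse_continuous hdS cK cP gaK.
have [U [chi [kap [Um [oU cc ccK Uc kP]]]]] := surface_chart hS m.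
pose O := chi @^-1` (Phi @` K)°.
have oO : open O.
  by apply: open_comp => [z _|]; [exact: cc | exact: open_interior].
have Oin z : O z -> (Phi @` K) (chi z) by move/interior_subset.
have oI : open ((ga \o chi) @` O).
  apply: invariance_of_domain => // [z Oz|z w Oz Ow /= E].
    apply: continuous_comp; first exact: cc.
    have /subspace_continuousP/(_ _ (Oin z Oz)) := cga.
    by rewrite within_interior.
  have [_ h1] := gaP _ (Oin z Oz); have [_ h2] := gaP _ (Oin w Ow).
  by rewrite -(ccK z) -(ccK w) -h1 -h2 E.
have : nbhs ((1 / 2, 1 / 2) : R * R) ((ga \o chi) @` O).
  apply: open_nbhs_nbhs; split => //; exists (kap m).
    by rewrite /O /=; have [-> _] := kP m Um.
  by rewrite /=; have [-> _] := kP m Um; rewrite /m gaK.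
move=> /nbhs_ballP[e /= e0 He].
have e20 : 0 < e / 2 by rewrite divr_gt0.
have /He[z Oz /= E] : ball ((1 / 2, 1 / 2) : R * R) e (1 / 2 + e / 2, 1 / 2).
  rewrite -ball_normE /= norm_prod_lt /= subrr normr0 e0 andbT.
  have -> : 1 / 2 - (1 / 2 + e / 2) = - (e / 2) by ring.
  by rewrite normrN gtr0_norm //; lra.
have [Kz _] := gaP _ (Oin z Oz).
have := K1 _ Kz; rewrite E /l1 /= !ger0_norm; lra.
Qed.

End Half.

Section Cells.
Variables (R : realType) (G : sgraph) (S : topologicalType).
Variable f : polyhedron R (graph_complex G) -> S.
Variable w0 : polyhedron R (graph_complex G).
Hypothesis hS : closed_surface R S.
Hypotheses (cf : continuous f) (injf : injective f).
Implicit Types (a b c d u v : G) (Phi : R * R -> S) (z w : R * R) (s : R).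

Local Notation fpt t := (f (poly_pt w0 t)).

Let hdS : hausdorff_space S. Proof. by case: hS. Qed.

Lemma fpt_inj t t' : realization R (graph_complex G) t ->
  realization R (graph_complex G) t' -> fpt t = fpt t' -> t = t'.
Proof.
move=> rt rt' /injf E; rewrite -(val_poly_pt w0 rt) E val_poly_pt //.
Qed.

(** The embedding of the cycle followed by the inverse of the given disc map is a homeomorphism [h]
    from the boundary of the diamond to the round circle; precomposing the disc map with the radial
    extension of [h] makes the boundary values those prescribed by the graph. *)
Lemma face_cell F a b c d : is_face f F -> quad a b c d ->
  bounded_by f F [:: a; b; c; d] ->
  exists2 Phi, cell f w0 a b c d Phi & Phi @` [set z | l1 z < 1] = F.
Proof.
move=> fF q [phi []]; set D := [set z : R * R | _] => cphi iphi phiF phiB.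
have DE z : D z = (l2 z <= 1) :> Prop by rewrite l2_le1.
have cD : compact D.
  rewrite (_ : D = [set z | l2 z <= 1]).
    exact: gauge_le1_compact (gauge_l2 R).
  by apply/seteqP; split => z; rewrite DE.
have iD z w : D z -> D w -> phi z = phi w -> z = w.
  by move=> Dz Dw; apply: iphi; exact/mem_set.
pose ga y := xget 0 [set z | D z /\ phi z = y].
have gaP y : (phi @` D) y -> D (ga y) /\ phi (ga y) = y.
  move=> [z Dz zy]; rewrite /ga; case: xgetP => [w _ //|/(_ z)].
  by move=> /(_ (conj Dz zy)).
have gaK z : D z -> ga (phi z) = z.
  by move=> Dz; have [|h1 h2] := gaP (phi z); [exists z | apply: iD].
have cga := compact_inverse_continuous hdS cD cphi gaK.
pose h z := ga (fpt (quad_pt a b c d z)).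
have rq z : l1 z = 1 -> realization R (graph_complex G) (quad_pt a b c d z).
  exact: quad_pt_real.
have onB z : l1 z = 1 -> exists2 y, l2 y = 1 & phi y = fpt (quad_pt a b c d z).
  move=> z1.
  have : (f @` cycle_points [:: a; b; c; d]) (fpt (quad_pt a b c d z)).
    eexists; last by [].
    by apply/(cycle_pointsP _ q); exists z; rewrite ?val_poly_pt //; exact: rq.
  by rewrite -phiB => -[y /= y1 E]; exists y => //; apply/l2_eq1.
have ch : {within [set z | l1 z = 1], continuous h}.
  apply: (within_comp (B := phi @` D) _ _ cga).
    apply: (within_comp (B := setT)) => //; last exact: continuous_subspaceT.
    by apply: poly_pt_continuous => //; apply: continuous_subspaceT;
      exact: quad_pt_continuous.
  by move=> z /onB[y y1 <-]; exists y => //; rewrite DE y1.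
have hE z : l1 z = 1 -> l2 (h z) = 1 /\ phi (h z) = fpt (quad_pt a b c d z).
  by move=> /onB[y y1 E]; rewrite /h -E gaK // DE y1.
have hN z : l1 z = 1 -> l2 (h z) = 1 by move=> /hE[].
have ih z w : l1 z = 1 -> l1 w = 1 -> h z = h w -> z = w.
  move=> z1 w1 E; apply: (quad_pt_inj q); apply: fpt_inj; try exact: rq.
  by have [_ <-] := hE z z1; have [_ <-] := hE w w1; rewrite E.
have sh y : l2 y = 1 -> exists2 z, l1 z = 1 & h z = y.
  move=> y1.
  have : (f @` cycle_points [:: a; b; c; d]) (phi y).
    by rewrite -phiB; exists y => //; apply/l2_eq1.
  move=> [W /(cycle_pointsP _ q)[z z1 WE] fW]; exists z => //.
  rewrite /h; have -> : poly_pt w0 (quad_pt a b c d z) = W.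
    by apply: val_inj; rewrite val_poly_pt //; exact: rq.
  by rewrite fW gaK // DE y1.
pose k := radial (@l1 R) h.
have kN : forall z, l2 (k z) = l1 z.
  exact: (radial_gauge (gauge_l1 R) (gauge_l2 R) hN).
have ck : continuous k.
  exact: (radial_continuous (gauge_l1 R) (gauge_l2 R) ch hN).
have ik : injective k by exact: (radial_inj (gauge_l1 R) (gauge_l2 R) hN ih).
have sk : forall y, exists z, k z = y.
  exact: (radial_surj (gauge_l1 R) (gauge_l2 R) sh).
have imE : (phi \o k) @` [set z | l1 z < 1] = F.
  rewrite -phiF; apply/seteqP; split => [_ [z /= z1 <-]|_ [y /= y1 <-]].
    by exists (k z) => //; rewrite /mkset -l2_lt1 kN.
  have [z E] := sk y; exists z; last by rewrite /= E.
  by rewrite /= -kN E l2_lt1.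
exists (phi \o k) => //; split => //.
- apply: within_comp cphi; last by move=> z /= z1; rewrite DE kN.
  exact: continuous_subspaceT.
- by move=> z w z1 w1 /iD; rewrite !DE !kN => /(_ z1 w1)/ik.
- move=> z z1; have [_ <-] := hE z z1; congr phi.
  by rewrite /k /radial z1 invr1 !scale1r.
- by rewrite imE.
Qed.

Section OneCell.
Variables (a b c d : G) (Phi : R * R -> S).
Hypothesis cel : cell f w0 a b c d Phi.

Lemma cell_closed : closed (Phi @` [set z | l1 z <= 1]).
Proof.
have [_ cP _ _ _] := cel; apply: compact_closed => //.
by apply: continuous_compact => //; exact: gauge_le1_compact (gauge_l1 R).
Qed.

Lemma cell_open : open (Phi @` [set z | l1 z < 1]).
Proof.
have [_ cP iP _ _] := cel; have [cl1 _ _] := gauge_l1 R.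
have o1 : open [set z : R * R | l1 z < 1].
  by apply: (@open_comp _ _ (@l1 R) [set x | x < 1]) => // z _; exact: cl1.
apply: (surface_invariance_of_domain hS) => // [z z1|z w /= /ltW z1 /ltW w1].
  have : {in [set z | l1 z < 1], continuous Phi}.
    rewrite -continuous_open_subspace //.
    by apply: continuous_subspaceW cP => y /= /ltW.
  by apply; exact/mem_set.
exact: iP.
Qed.

Lemma cell_range z : l1 z <= 1 -> range f (Phi z) -> l1 z = 1.
Proof.
move=> z1 rz; apply/eqP; rewrite eq_le z1 leNgt; apply/negP => z1'.
have [_ _ _ _ [x nx E]] := cel.
have : (Phi @` [set z | l1 z < 1]) (Phi z) by exists z.
by rewrite E => /connected_component_sub.
Qed.

(** Shrinking towards the centre moves [z] into the open diamond, and the centre itself is pushed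
    aside so that [z'] differs from [z]. This serves both the density of the open face in the closed
    one and the absence of isolated points. *)
Lemma cell_dense z (W : set S) : l1 z <= 1 -> nbhs (Phi z) W ->
  exists z', [/\ l1 z' < 1, z' != z & W (Phi z')].
Proof.
move=> z1 nW; have [_ /subspace_continuousP/(_ z z1 W nW) nz _ _ _] := cel.
have /nbhs_ballP[e /= e0 He] : nbhs z [set y | l1 y <= 1 -> W (Phi y)] by [].
pose t := Num.min (1 / 2) (e / 2).
have t0 : 0 < t by rewrite lt_min !divr_gt0.
have t1 : t < 1 by rewrite gt_min; apply/orP; left; lra.
have te : t < e by rewrite gt_min; apply/orP; right; lra.
have [_ le1 hom] := gauge_l1 R.
have [z0|z0] := eqVneq z 0.
  have lt : l1 ((t, 0) : R * R) = t by rewrite /l1 /= normr0 addr0 gtr0_norm.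
  exists (t, 0); split; [by rewrite lt|by rewrite z0; apply/eqP => -[] /eqP;
    rewrite gt_eqF|].
  apply: He; last by rewrite lt ltW.
  rewrite -ball_normE /= z0 sub0r normrN norm_prod_lt /= normr0 e0 andbT.
  by rewrite gtr0_norm.
exists ((1 - t) *: z); split.
- rewrite hom ger0_norm; last by lra.
  apply: (@le_lt_trans _ _ (1 - t)); last by lra.
  by rewrite ler_piMr //; lra.
- rewrite -subr_eq0 scalerBl scale1r addrAC subrr sub0r oppr_eq0 scaler_eq0.
  by rewrite (gt_eqF t0) (negPf z0).
apply: He; last first.
  rewrite hom ger0_norm; last by lra.
  by apply: mulr_ile1 => //; [lra | exact: gauge_ge0 (gauge_l1 R) | lra].
rewrite -ball_normE /= scalerBl scale1r opprB addrC subrK normrZ gtr0_norm //.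
apply: le_lt_trans te; apply: ler_piMr; first exact: ltW.
exact: le_trans (le1 z) z1.
Qed.

Lemma cell_point_edge t u v : realization R (graph_complex G) t ->
  t u != 0 -> t v != 0 -> u != v -> (Phi @` [set z | l1 z <= 1]) (fpt t) ->
  quad_edge a b c d u v || quad_edge a b c d v u.
Proof.
move=> rt tu tv uv [z z1 E]; have [q _ _ bP _] := cel.
have {}z1 : l1 z = 1 by apply: cell_range => //; rewrite E; exists (poly_pt w0 t).
have tE : t = quad_pt a b c d z.
  by apply: fpt_inj => //; [exact: quad_pt_real | rewrite -bP].
have [u' [v' [s [uv' s0 s1 E']]]] := quad_pt_edges a b c d z1.
have supp x : t x != 0 -> x = u' \/ x = v'.
  rewrite tE E' /edge_pt; have [|_] := eqVneq x u'; first by left.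
  have [|_] := eqVneq x v'; first by right.
  by rewrite !mulr0 addr0 eqxx.
by case: (supp u tu) => hu; case: (supp v tv) => hv; subst;
  rewrite ?eqxx // in uv *; rewrite ?uv' ?orbT.
Qed.

Lemma cell_edge_point u v s : quad_edge a b c d u v || quad_edge a b c d v u ->
  0 <= s -> s <= 1 -> exists2 z, l1 z = 1 & Phi z = fpt (edge_pt u v s).
Proof.
have [_ _ _ bP _] := cel => /orP[] e s0 s1.
  have [z z1 ->] := edge_pt_quad e s0 s1.
  by exists z => //; rewrite bP.
rewrite edge_ptC; have [||z z1 ->] := @edge_pt_quad R _ _ _ _ _ _ _ (1 - s) e.
- by rewrite subr_ge0.
- by rewrite gerBl.
by exists z => //; rewrite bP.
Qed.

End OneCell.

(** Realigning a cell to start at a given directed edge changes the map, but neither of these two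
    images. *)
Definition same_cell Phi Phi' :=
  Phi @` [set z | l1 z < 1] = Phi' @` [set z | l1 z < 1] /\
  Phi @` [set z | l1 z <= 1] = Phi' @` [set z | l1 z <= 1].

Lemma same_cell_trans Phi Phi' Phi2 :
  same_cell Phi Phi' -> same_cell Phi' Phi2 -> same_cell Phi Phi2.
Proof. by rewrite /same_cell => -[-> ->]. Qed.

Lemma image_involutive_gauge (k k' : R * R -> R * R) Phi (P : R -> Prop) :
  (forall z, l1 (k z) = l1 z) -> (forall z, l1 (k' z) = l1 z) -> cancel k' k ->
  Phi @` [set z | P (l1 z)] = (Phi \o k) @` [set z | P (l1 z)].
Proof.
move=> kN kN' kK; apply/seteqP; split => [_ [z /= z1 <-]|_ [z /= z1 <-]].
  by exists (k' z); rewrite /= ?kN' ?kK.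
by exists (k z); rewrite //= kN.
Qed.

Lemma cell_reparam a b c d a' b' c' d' Phi (k k' : R * R -> R * R) :
  cell f w0 a b c d Phi -> quad a' b' c' d' -> continuous k ->
  (forall z, l1 (k z) = l1 z) -> (forall z, l1 (k' z) = l1 z) ->
  cancel k' k -> cancel k k' ->
  (forall z, quad_pt a' b' c' d' z = quad_pt a b c d (k z)) ->
  cell f w0 a' b' c' d' (Phi \o k) /\ same_cell Phi (Phi \o k).
Proof.
move=> [q cP iP bP fP] q' ck kN kN' kK kK' qE.
have E := image_involutive_gauge Phi (fun x => x < 1) kN kN' kK.
have E' := image_involutive_gauge Phi (fun x => x <= 1) kN kN' kK.
split; last by split.
split => //.
- apply: within_comp cP; last by move=> z /=; rewrite kN.
  exact: continuous_subspaceT.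
- by move=> z w z1 w1 /iP; rewrite !kN => /(_ z1 w1)/(can_inj kK').
- by move=> z z1; rewrite /= bP ?kN // qE.
- by rewrite -E.
Qed.

Lemma cell_rot a b c d Phi : cell f w0 a b c d Phi ->
  exists2 Phi', cell f w0 b c d a Phi' & same_cell Phi Phi'.
Proof.
move=> cel; have [q _ _ _ _] := cel.
have [|||||||] := @cell_reparam _ _ _ _ b c d a _ (fun z => (- z.2, z.1))
    (fun z => (z.2, - z.1)) cel.
- exact: quad_rot.
- apply: contpair; last exact: fst_continuous.
  by apply: contN; exact: snd_continuous.
- by move=> z; rewrite /l1 /= normrN addrC.
- by move=> z; rewrite /l1 /= normrN addrC.
- by move=> [x y] /=; rewrite opprK.
- by move=> [x y] /=; rewrite opprK.
- by move=> z; apply/funext => x; rewrite /quad_pt /= pospN posnN; ring.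
by move=> ? ?; eexists; eassumption.
Qed.

Lemma cell_flip a b c d Phi : cell f w0 a b c d Phi ->
  exists2 Phi', cell f w0 a d c b Phi' & same_cell Phi Phi'.
Proof.
move=> cel; have [q _ _ _ _] := cel.
have [|||||||] := @cell_reparam _ _ _ _ a d c b _ (fun z => (z.1, - z.2))
    (fun z => (z.1, - z.2)) cel.
- exact: quad_flip.
- apply: contpair; first exact: fst_continuous.
  by apply: contN; exact: snd_continuous.
- by move=> z; rewrite /l1 /= normrN.
- by move=> z; rewrite /l1 /= normrN.
- by move=> [x y] /=; rewrite opprK.
- by move=> [x y] /=; rewrite opprK.
- by move=> z; apply/funext => x; rewrite /quad_pt /= pospN posnN; ring.
by move=> ? ?; eexists; eassumption.
Qed.

Lemma cell_align a b c d Phi u v : cell f w0 a b c d Phi ->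
  quad_edge a b c d u v || quad_edge a b c d v u ->
  exists c' d' Phi', cell f w0 u v c' d' Phi' /\ same_cell Phi Phi'.
Proof.
have dir a1 b1 c1 d1 Phi1 : cell f w0 a1 b1 c1 d1 Phi1 ->
    quad_edge a1 b1 c1 d1 u v ->
    exists c' d' Phi', cell f w0 u v c' d' Phi' /\ same_cell Phi1 Phi'.
  move=> cel; have [P2 cel2 s2] := cell_rot cel.
  have [P3 cel3 s3] := cell_rot cel2; have [P4 cel4 s4] := cell_rot cel3.
  case/or4P => /andP[/eqP-> /eqP->].
  - by exists c1, d1, Phi1.
  - by exists d1, a1, P2.
  - by exists a1, b1, P3; split => //; exact: same_cell_trans s3.
  - exists b1, c1, P4; split => //.
    by apply: same_cell_trans s4; exact: same_cell_trans s3.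
move=> cel /orP[|e]; first exact: dir.
have [P2 cel2 s2] := cell_flip cel.
have [|c' [d' [P3 [cel3 s3]]]] := dir _ _ _ _ _ cel2.
  by case/or4P: e => /andP[/eqP-> /eqP->]; rewrite /quad_edge !eqxx ?orbT.
by exists c', d', P3; split => //; exact: same_cell_trans s3.
Qed.

Lemma cell_face_eq a b c d a' b' c' d' Phi Phi' z z' :
  cell f w0 a b c d Phi -> cell f w0 a' b' c' d' Phi' ->
  l1 z < 1 -> l1 z' < 1 -> Phi z = Phi' z' ->
  Phi @` [set z | l1 z < 1] = Phi' @` [set z | l1 z < 1].
Proof.
move=> [_ _ _ _ [x nx E]] [_ _ _ _ [x' nx' E']] z1 z1' zz.
rewrite E E'.
have h1 : connected_component (~` range f) x (Phi z) by rewrite -E; exists z.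
have h2 : connected_component (~` range f) x' (Phi z).
  by rewrite -E' zz; exists z'.
by rewrite (same_connected_component h1) (same_connected_component h2).
Qed.

Lemma cell_closure_eq a b c d a' b' c' d' Phi Phi' :
  cell f w0 a b c d Phi -> cell f w0 a' b' c' d' Phi' ->
  Phi @` [set z | l1 z < 1] = Phi' @` [set z | l1 z < 1] ->
  Phi @` [set z | l1 z <= 1] `<=` Phi' @` [set z | l1 z <= 1].
Proof.
move=> cel cel' E _ [z /= z1 <-]; apply: (cell_closed cel').
move=> W nW; have [z' [z1' _ Wz']] := cell_dense cel z1 nW.
exists (Phi z'); split => //.
have : (Phi @` [set z | l1 z < 1]) (Phi z') by exists z'.
by rewrite E => -[y /= /ltW y1 <-]; exists y.
Qed.

Lemma quad_pt_pos a b c d z : 0 <= z.1 -> 0 <= z.2 -> l1 z = 1 ->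
  quad_pt a b c d z = edge_pt a b z.1 :> {ptws G -> R}.
Proof.
move=> x0 y0; rewrite /l1 !ger0_norm // => E.
apply/funext => v; rewrite /quad_pt /edge_pt (posp_pos x0) (posn_pos x0).
by rewrite (posp_pos y0) (posn_pos y0) -E; ring.
Qed.

(* Reflecting the second diamond in the common side [x + y = 1] glues the two
   cells to a map of the open unit square. *)
Lemma two_cells_nbhs a b c d c' d' Phi Phi' s :
  cell f w0 a b c d Phi -> cell f w0 a b c' d' Phi' ->
  Phi @` [set z | l1 z < 1] <> Phi' @` [set z | l1 z < 1] ->
  0 < s -> s < 1 ->
  nbhs (fpt (edge_pt a b s)) (Phi @` [set z | l1 z <= 1] `|`
                              Phi' @` [set z | l1 z <= 1]).
Proof.
move=> cel cel' nF s0 s1.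
have [q cP iP bP _] := cel; have [q' cP' iP' bP' _] := cel'.
pose psi z := if z.1 + z.2 <= 1 then Phi z else Phi' (1 - z.2, 1 - z.1).
pose O := [set z : R * R | [/\ 0 < z.1, z.1 < 1, 0 < z.2 & z.2 < 1]].
pose A := [set z : R * R | [/\ 0 <= z.1, 0 <= z.2 & z.1 + z.2 <= 1]].
pose B := [set z : R * R | [/\ z.1 <= 1, z.2 <= 1 & 1 <= z.1 + z.2]].
have c1 := @fst_continuous R; have c2 := @snd_continuous R.
have c12 : continuous (fun z : R * R => z.1 + z.2) by exact: contD.
have half (k : R * R -> R) (P : set R) : continuous k -> open P ->
    open (k @^-1` P) by move=> ck oP; apply: open_comp => // z _; exact: ck.
have halfc (k : R * R -> R) (P : set R) : continuous k -> closed P ->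
    closed (k @^-1` P) by move=> ck oP; apply: closed_comp => // z _; exact: ck.
have oO : open O.
  rewrite (_ : O = (fst @^-1` [set x | 0 < x] `&` fst @^-1` [set x | x < 1]) `&`
     (snd @^-1` [set x | 0 < x] `&` snd @^-1` [set x | x < 1])).
    by apply: openI; apply: openI; apply: half => //;
      (exact: open_gt || exact: open_lt).
  by apply/seteqP; split => z; [case | move=> [[? ?] [? ?]]].
have clA : closed A.
  rewrite (_ : A = fst @^-1` [set x | 0 <= x] `&` (snd @^-1` [set x | 0 <= x] `&`
     (fun z => z.1 + z.2) @^-1` [set x | x <= 1])).
    by apply: closedI; [|apply: closedI]; apply: halfc => //;
      (exact: closed_ge || exact: closed_le).
  by apply/seteqP; split => z; [case | move=> [? [? ?]]].
have clB : closed B.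
  rewrite (_ : B = fst @^-1` [set x | x <= 1] `&` (snd @^-1` [set x | x <= 1] `&`
     (fun z => z.1 + z.2) @^-1` [set x | 1 <= x])).
    by apply: closedI; [|apply: closedI]; apply: halfc => //;
      (exact: closed_ge || exact: closed_le).
  by apply/seteqP; split => z; [case | move=> [? [? ?]]].
have lA z : A z -> l1 z <= 1 by move=> [x0 y0 xy]; rewrite /l1 !ger0_norm.
have lB z : B z -> l1 (1 - z.2, 1 - z.1) <= 1.
  by move=> [x0 y0 xy]; rewrite /l1 /= !ger0_norm ?subr_ge0 //; lra.
have psiB z : B z -> psi z = Phi' (1 - z.2, 1 - z.1).
  move=> [x1 y1 xy]; rewrite /psi; case: ifP => // xy'.
  have E : z.1 + z.2 = 1 by apply/le_anti; rewrite xy'.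
  have -> : (1 - z.2, 1 - z.1) = z.
    by rewrite [RHS]surjective_pairing; congr pair; lra.
  have lz : l1 z = 1 by rewrite /l1 !ger0_norm //; lra.
  rewrite bP // bP' // !quad_pt_pos //; lra.
have cpsi : {within O, continuous psi}.
  apply: (@continuous_subspaceW _ _ _ (A `|` B)).
    move=> z [x0 x1 y0 y1]; have [xy|/ltW xy] := leP (z.1 + z.2) 1.
      by left; split => //; exact: ltW.
    by right; split => //; exact: ltW.
  apply: withinU_continuous => //.
    apply: (@subspace_eq_continuous _ _ _ Phi); last first.
      by apply: continuous_subspaceW cP; exact: lA.
    by move=> z /set_mem[_ _ xy]; rewrite /from_subspace /psi xy.
  apply: (@subspace_eq_continuous _ _ _ (fun z => Phi' (1 - z.2, 1 - z.1))).
    by move=> z /set_mem Bz; rewrite /from_subspace psiB.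
  apply: (@within_comp _ _ _ B [set z | l1 z <= 1]
    (fun z : R * R => (1 - z.2, 1 - z.1)) Phi') => //; apply: continuous_subspaceT.
  by apply: contpair; apply: contB => //; exact: contcst.
have psiA z : O z -> z.1 + z.2 <= 1 -> psi z = Phi z /\ l1 z <= 1.
  move=> [x0 _ y0 _] xy; rewrite /psi xy; split => //; apply: lA.
  by split => //; exact: ltW.
have psiB' z : O z -> (z.1 + z.2 <= 1) = false ->
    psi z = Phi' (1 - z.2, 1 - z.1) /\ l1 (1 - z.2, 1 - z.1) < 1.
  move=> [x0 x1 y0 y1] /negbT; rewrite -ltNge => xy; split.
    by rewrite psiB //; split; lra.
  by rewrite /l1 /= !ger0_norm ?subr_ge0 ?ltW //; lra.
(* A common value would lie in the second open face; it is no boundary value, as the open face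
   misses the graph, and no inner value, as the faces differ. *)
have cross z w : O z -> O w -> z.1 + z.2 <= 1 -> (w.1 + w.2 <= 1) = false ->
    psi z <> psi w.
  move=> Oz Ow xy xy'; have [-> z1] := psiA z Oz xy.
  have [-> w1] := psiB' w Ow xy' => E.
  have z1' : l1 z < 1.
    rewrite lt_neqAle z1 andbT; apply/eqP => z1'.
    have : range f (Phi' (1 - w.2, 1 - w.1)) by rewrite -E bP //; eexists.
    by move/(cell_range cel' (ltW w1)) => E'; rewrite E' ltxx in w1.
  by apply: nF; exact: cell_face_eq cel cel' z1' w1 E.
have oI : open (psi @` O).
  apply: (surface_invariance_of_domain hS) => // [z Oz|z w Oz Ow E].
    have : {in O, continuous psi} by rewrite -continuous_open_subspace.
    by apply; exact/mem_set.
  case zE : (z.1 + z.2 <= 1); case wE : (w.1 + w.2 <= 1).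
  - move: E; have [-> z1] := psiA z Oz zE; have [-> w1] := psiA w Ow wE.
    exact: iP.
  - by case: (cross _ _ Oz Ow zE wE).
  - by case: (cross _ _ Ow Oz wE zE).
  - move: E; have [-> z1] := psiB' z Oz zE; have [-> w1] := psiB' w Ow wE.
    move=> /(iP' _ _ (ltW z1) (ltW w1))[h1 h2].
    by rewrite (surjective_pairing z) (surjective_pairing w); congr pair; lra.
have Os : O (s, 1 - s) by split => /=; lra.
have -> : fpt (edge_pt a b s) = psi (s, 1 - s).
  have ls : l1 (s, 1 - s) = 1 by rewrite /l1 /= !ger0_norm ?subr_ge0 ?ltW //; lra.
  have [|-> _] := psiA _ Os; first by rewrite /=; lra.
  by rewrite bP // quad_pt_pos //=; lra.
have : nbhs (psi (s, 1 - s)) (psi @` O).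
  by apply: open_nbhs_nbhs; split => //; exists (s, 1 - s).
apply: filterS => _ [z Oz <-]; case zE : (z.1 + z.2 <= 1).
  by have [-> z1] := psiA z Oz zE; left; exists z.
have [-> z1] := psiB' z Oz zE; right.
by exists (1 - z.2, 1 - z.1) => //; exact: ltW.
Qed.

(** * Unions of faces in which every edge is used twice *)

Section CellFamilies.
Variables (I : finType) (p : I -> G * G * G * G) (Phi : I -> R * R -> S).

Definition cell_of (r : G * G * G * G) (P : R * R -> S) : Prop :=
  let: (a, b, c, d) := r in cell f w0 a b c d P.

Hypothesis cels : forall i, cell_of (p i) (Phi i).
Hypothesis paired : forall i u v, qedge (p i) u v -> exists j,
  qedge (p j) u v /\
  Phi i @` [set z | l1 z < 1] <> Phi j @` [set z | l1 z < 1].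

Let X := \bigcup_(i in [set: I]) Phi i @` [set z | l1 z <= 1].

Lemma cell_family_closed : closed X.
Proof.
apply: closed_bigcup => [|i _]; first exact: finite_finset.
by move: (cels i); rewrite /cell_of; case: (p i) => [[[a b] c] d] /cell_closed.
Qed.

Let vertices : set S := (fun v => fpt (edge_pt v v 1)) @` [set: G].

(** Inner points of faces are settled by [cell_open], inner points of edges by [paired] and
    [two_cells_nbhs]; the images of the vertices form the finite exceptional set. *)
Lemma cell_family_open : open X.
Proof.
have fV : finite_set vertices by apply: finite_image; exact: finite_finset.
apply: (surface_open_except_finite hS cell_family_closed fV).
- move=> _ [i _ [z /= z1 <-]] nV.
  move: (cels i) (@paired i); rewrite /cell_of /qedge.
  case: (p i) => [[[a b] c] d] cel pr.
  have [zl|] := ltP (l1 z) 1.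
    have : nbhs (Phi i z) (Phi i @` [set z | l1 z < 1]).
      by apply: open_nbhs_nbhs; split; [exact: cell_open cel | exists z].
    by apply: filterS => _ [y /= /ltW y1 <-]; exists i => //; exists y.
  move=> z1'; have {z1'}zl : l1 z = 1 by apply/le_anti; rewrite z1.
  have [q _ _ bP _] := cel.
  have [u [v [s [uv s0 s1 E]]]] := quad_pt_edges a b c d zl.
  have zE : Phi i z = fpt (edge_pt u v s) by rewrite bP // E.
  have edge0 : edge_pt u v (0 : R) = edge_pt v v 1 :> {ptws G -> R}.
    by apply/funext => x; rewrite /edge_pt subrr !mul0r subr0 add0r addr0.
  have edge1 : edge_pt u v (1 : R) = edge_pt u u 1 :> {ptws G -> R}.
    by apply/funext => x; rewrite /edge_pt subrr !mul0r.
  have s0' : 0 < s.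
    rewrite lt0r s0 andbT; apply/eqP => s00; apply: nV; exists v => //.
    by rewrite zE s00 edge0.
  have s1' : s < 1.
    rewrite lt_neqAle s1 andbT; apply/eqP => s11; apply: nV; exists u => //.
    by rewrite zE s11 edge1.
  have e : quad_edge a b c d u v || quad_edge a b c d v u by rewrite uv.
  have [j [ej nF]] := pr u v e.
  have [c1 [d1 [P1 [cel1 [E1 E1']]]]] := cell_align cel e.
  move: (cels j) ej; rewrite /cell_of /qedge.
  case: (p j) => [[[aj bj] cj] dj] celj ej.
  have [c2 [d2 [P2 [cel2 [E2 E2']]]]] := cell_align celj ej.
  rewrite zE; have := two_cells_nbhs cel1 cel2 _ s0' s1'.
  rewrite -E1 -E2 => /(_ nF); rewrite -E1' -E2'.
  by apply: filterS => y [] ?; [exists i | exists j].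
- move=> _ [i _ [z /= z1 <-]] W nW.
  move: (cels i); rewrite /cell_of; case: (p i) => [[[a b] c] d] cel.
  have [z' [z1' zz' Wz']] := cell_dense cel z1 nW.
  have [_ _ iP _ _] := cel.
  exists (Phi i z'); split => //.
    by apply: contraNneq zz' => /iP -> //; exact: ltW.
  by exists i => //; exists z' => //; exact: ltW.
Qed.

Hypothesis hcon : sg_connected G.
Hypothesis nb : forall u, exists v, sedge u v.

Lemma clopen_edge (Y : set S) u v s s' : open Y -> closed Y -> sedge u v ->
  0 <= s -> s <= 1 -> 0 <= s' -> s' <= 1 ->
  Y (fpt (edge_pt u v s)) -> Y (fpt (edge_pt u v s')).
Proof.
move=> oY cY uv s0 s1 s0' s1' Ys.
pose E := (fun x : R => fpt (edge_pt u v x)) @` `[0, 1]%classic.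
have mem (x : R) : 0 <= x -> x <= 1 -> E (fpt (edge_pt u v x)).
  by move=> x0 x1; exists x => //; rewrite /= in_itv /= x0.
have cE : connected E.
  apply: connected_continuous_connected; first exact: segment_connected.
  apply: (within_comp (B := setT)) => //; last exact: continuous_subspaceT.
  apply: poly_pt_continuous => [|x].
    by apply: continuous_subspaceT; exact: edge_pt_continuous.
  by rewrite /= in_itv /= => /andP[? ?]; exact: edge_pt_real.
have EY : E `&` Y = E.
  apply: cE; [|by exists Y|by exists Y].
  by exists (fpt (edge_pt u v s)); split => //; exact: mem.
by have : E (fpt (edge_pt u v s')); [exact: mem | rewrite -EY => -[]].
Qed.

Lemma clopen_range (Y : set S) W : open Y -> closed Y -> Y (f W) ->
  range f `<=` Y.
Proof.
move=> oY cY YW; pose Yv u := forall v s, sedge u v -> 0 <= s -> s <= 1 ->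
  Y (fpt (edge_pt u v s)).
have step u v s : sedge u v -> 0 <= s -> s <= 1 -> Y (fpt (edge_pt u v s)) ->
    Yv u.
  move=> uv s0 s1 Ys v' s' uv' s0' s1'.
  apply: (@clopen_edge Y u v' 1) => //.
  have -> : edge_pt u v' (1 : R) = edge_pt u v 1 :> {ptws G -> R}.
    by apply/funext => x; rewrite /edge_pt subrr !mul0r.
  by apply: (@clopen_edge Y u v s).
have stepE u v : sedge u v -> Yv u -> Yv v.
  move=> uv Yu; apply: (@step v u 1) => //; rewrite 1?sedge_sym //.
  have -> : edge_pt v u (1 : R) = edge_pt u v 0 by rewrite [RHS]edge_ptC subr0.
  exact: Yu.
have fE W' : exists u v s, [/\ sedge u v, 0 <= s, s <= 1 &
    W' = poly_pt w0 (edge_pt u v s)].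
  have [u [v [s [uv s0 s1 E]]]] := GR_cases nb (set_valP W').
  exists u, v, s; split => //; apply: val_inj.
  by rewrite val_poly_pt //; exact: edge_pt_real.
have [u0 [v0 [s0 [uv0 s00 s01 E0]]]] := fE W.
have Yu0 : Yv u0 by apply: (step u0 v0 s0) => //; rewrite -E0.
have Yall u : Yv u.
  have /connectP[r] := hcon u0 u; elim: r u0 Yu0 {uv0 E0} => [|x r IH] y Yy /=.
    by move=> _ ->.
  by move=> /andP[yx] /IH; apply; exact: stepE Yy.
move=> _ [W' _ <-]; have [u [v [s [uv s0' s1' ->]]]] := fE W'.
exact: Yall.
Qed.

Lemma cell_family_range (i : I) : range f `<=` X.
Proof.
move: (cels i); rewrite /cell_of; case E : (p i) => [[[a b] c] d] cel.
have [q _ _ bP _] := cel.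
have z1 : l1 ((1, 0) : R * R) = 1 by rewrite /l1 /= normr1 normr0 addr0.
apply: (clopen_range (W := poly_pt w0 (quad_pt a b c d (1, 0)))).
- exact: cell_family_open.
- exact: cell_family_closed.
by exists i => //; exists (1, 0); rewrite /= ?bP ?z1.
Qed.

(** The midpoint of the edge lies in some closed cell of the family. Both of its coordinates being
    nonzero, that cell has the edge on its boundary, so the family uses all edges of [G]. *)
Lemma cell_family_edge (i : I) u v : sedge u v -> exists j, qedge (p j) u v.
Proof.
move=> uv; have h0 : 0 <= 1 / 2 :> R by lra.
have h1 : 1 / 2 <= 1 :> R by lra.
have rt := edge_pt_real uv h0 h1.
have [|j _ H] := @cell_family_range i (fpt (edge_pt u v (1 / 2))); first by eexists.
exists j; move: (cels j); rewrite /cell_of /qedge.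
case: (p j) => [[[a b] c] d] cel.
apply: (cell_point_edge cel rt _ _ (sedge_neq uv) H).
  by rewrite /edge_pt eqxx (negPf (sedge_neq uv)) mulr1 mulr0 addr0; lra.
rewrite /edge_pt eqxx [v == u]eq_sym (negPf (sedge_neq uv)) mulr1 mulr0 add0r; lra.
Qed.

End CellFamilies.

End Cells.

(** * From a quadrangulation to the Lovász complex *)

Lemma nonbipartite_neighbor (G : sgraph) : sg_connected G -> ~ sg_bipartite G ->
  forall u : G, exists v, sedge u v.
Proof.
move=> hcon hbip u.
have [x [y xy]] : exists x y : G, sedge x y.
  apply: contrapT => H; apply: hbip; exists (fun _ => true) => x y xy.
  by case: H; exists x, y.
have /connectP[[|h r] /=] := hcon u x; first by move=> _ <-; exists y.
by move=> /andP[uh _] _; exists h.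
Qed.

Section Direct.
Variables (R : realType) (G : sgraph) (S : topologicalType).
Variable f : polyhedron R (graph_complex G) -> S.
Variable w0 : polyhedron R (graph_complex G).
Hypothesis hcon : sg_connected G.
Hypothesis nb : forall u : G, exists v, sedge u v.
Hypothesis hiso : ~ sg_isomorphic G K23.
Hypothesis hbip : ~ sg_bipartite G.
Hypothesis hq : quadrangulation f.
Hypothesis hfac : forall p : seq G, four_cycle p -> facial f p.
Implicit Types (a b c d u v x y : G) (p : G * G * G * G) (z w : R * R).

Local Notation fpt t := (f (poly_pt w0 t)).
Local Notation Fc Phi := (Phi @` [set z | l1 z < 1]).
Local Notation Dc Phi := (Phi @` [set z | l1 z <= 1]).
Local Notation pcell := (cell_of f w0).

Let hS : closed_surface R S. Proof. by case: hq. Qed.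
Let cf : continuous f. Proof. by case: hq => _ []. Qed.
Let injf : injective f. Proof. by case: hq => _ []. Qed.

Lemma quad_cell p : quadP p -> exists Phi, pcell p Phi.
Proof.
case: p => [[[a b] c] d] q.
have [|F fF bF] := hfac (p := [:: a; b; c; d]).
  by apply/four_cycleP; exists a, b, c, d.
by have [Phi cel _] := face_cell w0 hS cf injf fF q bF; exists Phi.
Qed.

Lemma point_face (y : S) : ~ range f y ->
  exists p Phi, [/\ quadP p, pcell p Phi & Fc Phi y].
Proof.
move=> ny; have [_ _ /(_ (connected_component (~` range f) y))] := hq.
move=> [|p4 /four_cycleP[a [b [c [d [q ->]]]]] bF]; first by exists y.
have fF : is_face f (connected_component (~` range f) y) by exists y.
have [Phi cel E] := face_cell w0 hS cf injf fF q bF.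
exists (a, b, c, d), Phi; split => //; rewrite E.
exact: connected_component_refl.
Qed.

Lemma pcell_quad p Phi : pcell p Phi -> quadP p.
Proof. by case: p => [[[a b] c] d] []. Qed.

Let h0 : 0 <= 1 / 2 :> R. Proof. lra. Qed.
Let h1 : 1 / 2 <= 1 :> R. Proof. lra. Qed.

Lemma midpoint_neq0 u v : sedge u v ->
  edge_pt u v (1 / 2 : R) u != 0 /\ edge_pt u v (1 / 2 : R) v != 0.
Proof.
move=> uv; rewrite /edge_pt !eqxx [v == u]eq_sym (negPf (sedge_neq uv)).
have e1 : (1 / 2 : R) != 0 by rewrite gt_eqF //; lra.
have e2 : (1 - 1 / 2 : R) != 0 by rewrite gt_eqF //; lra.
by rewrite !mulr1 !mulr0 addr0 add0r.
Qed.

Lemma pcell_midpoint p Phi u v : pcell p Phi -> sedge u v ->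
  Dc Phi (fpt (edge_pt u v (1 / 2))) -> qedge p u v.
Proof.
case: p => [[[a b] c] d] cel uv; have [n1 n2] := midpoint_neq0 uv.
exact: (cell_point_edge injf cel (edge_pt_real uv h0 h1) n1 n2 (sedge_neq uv)).
Qed.

Lemma pcell_edge p Phi u v (s : R) : pcell p Phi -> qedge p u v ->
  0 <= s -> s <= 1 -> exists2 z, l1 z = 1 & Phi z = fpt (edge_pt u v s).
Proof. by case: p => [[[a b] c] d] cel; exact: (cell_edge_point cel). Qed.

Lemma quadP_qedge_sedge p u v : quadP p -> qedge p u v -> sedge u v.
Proof.
case: p => [[[a b] c] d] q /orP[]; first exact: quad_edge_sedge.
by rewrite sedge_sym; exact: quad_edge_sedge.
Qed.

Lemma face_eq_qedge p p' Phi Phi' u v : pcell p Phi -> pcell p' Phi' ->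
  Fc Phi = Fc Phi' -> qedge p u v -> qedge p' u v.
Proof.
move=> cel cel' E e.
have uv := quadP_qedge_sedge (pcell_quad cel) e.
apply: (pcell_midpoint cel' uv).
have [z z1 zE] := pcell_edge cel e h0 h1.
have : Dc Phi (fpt (edge_pt u v (1 / 2))) by exists z; rewrite //= z1.
move: cel cel'; case: p {e} => [[[a b] c] d]; case: p' => [[[a' b'] c'] d'].
by move=> cel cel'; exact: (cell_closure_eq hS cel cel' E).
Qed.

(** Two different faces on one 4-cycle pair all its edges, so every edge of [G] belongs to the cycle
    and membership in a diagonal is a 2-colouring, against [hbip]. For [p = p'] this makes the face
    of a cycle independent of choices. *)
Lemma same_quad_face p p' Phi Phi' : pcell p Phi -> pcell p' Phi' ->
  same_quad p p' -> Fc Phi = Fc Phi'.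
Proof.
move=> cel cel' sq; apply: contrapT => nF.
pose P (i : bool) := if i then p else p'.
pose PH (i : bool) := if i then Phi else Phi'.
have ce i : pcell (P i) (PH i) by case: i.
have pr i u v : qedge (P i) u v -> exists j, qedge (P j) u v /\
    Fc (PH i) <> Fc (PH j).
  case: i => /= e; first by exists false; rewrite /= -(same_quad_qedge _ _ sq).
  exists true; rewrite /= (same_quad_qedge _ _ sq); split => //.
  by move=> E; exact/nF/esym.
have edges u v : sedge u v -> qedge p u v.
  move=> uv; have [[] //=] := cell_family_edge hS cf injf ce pr hcon nb true uv.
  by rewrite -(same_quad_qedge _ _ sq).
move: (pcell_quad cel) edges; case: p {sq cel P PH ce pr nF} => [[[a b] c] d] q edges.
apply: hbip; exists (fun u => u \in diag a c) => u v /edges.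
rewrite qedgeE => /orP[]/andP[h1' h2'].
  by rewrite h1'; apply/negP => /eqP/esym/(quad_disjoint q); rewrite h2'.
by rewrite h2'; apply/negP => /eqP/(quad_disjoint q); rewrite h1'.
Qed.

Lemma quad_common a c x y : a != c -> x != y -> sedge a x -> sedge c x ->
  sedge a y -> sedge c y -> quad a x c y.
Proof.
by move=> ac xy ax cx ay cy; apply/and5P; split;
  rewrite // 1?sedge_sym // ac xy.
Qed.

(** The three 4-cycles of the theta graph bound different faces, because each has an edge that the
    next one lacks. They exhaust the edges of [G], against [hiso]. *)
Lemma at_most_two_common a c x y (z : G) : a != c -> x != y -> y != z -> z != x ->
  sedge a x -> sedge c x -> sedge a y -> sedge c y ->
  sedge a z -> sedge c z -> False.
Proof.
move=> ac xy yz zx ax cx ay cy az cz.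
have q1 : quadP (a, x, c, y) by exact: quad_common.
have q2 : quadP (a, y, c, z) by exact: quad_common.
have q3 : quadP (a, z, c, x) by exact: quad_common.
have [P1 c1] := quad_cell q1; have [P2 c2] := quad_cell q2.
have [P3 c3] := quad_cell q3.
have nax := sedge_neq ax; have nay := sedge_neq ay; have naz := sedge_neq az.
have ncx := sedge_neq cx; have ncy := sedge_neq cy; have ncz := sedge_neq cz.
have no m n k : k != m -> k != n -> a != m -> a != n ->
    qedge (a, m, c, n) a k = false.
  move=> km kn am an; rewrite qedgeE !inE (negPf km) (negPf kn).
  by rewrite (negPf am) (negPf an) andbF.
have yes m n k u v : k \in [:: m; n] ->
    (u \in diag a c) && (v == k) || (u == k) && (v \in diag a c) ->
    qedge (a, m, c, n) u v.
  rewrite qedgeE !inE => /orP[]/eqP-> /orP[]/andP[-> ->]; rewrite ?orbT //.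
have edge_of m n u v : qedge (a, m, c, n) u v -> exists2 k, k \in [:: m; n] &
    (u \in diag a c) && (v == k) || (u == k) && (v \in diag a c).
  rewrite qedgeE !inE => /orP[]/andP[].
    by move=> hu /orP[]/eqP->; [exists m | exists n]; rewrite ?hu ?inE ?eqxx ?orbT.
  by move=> /orP[]/eqP-> hv; [exists m | exists n]; rewrite ?hv ?inE ?eqxx ?orbT.
have xz : x != z by rewrite eq_sym.
have yx : y != x by rewrite eq_sym.
have e1x : qedge (a, x, c, y) a x by apply: (yes x y x); rewrite !inE !eqxx.
have e1y : qedge (a, x, c, y) a y.
  by apply: (yes x y y); rewrite !inE !eqxx ?orbT.
have e2y : qedge (a, y, c, z) a y by apply: (yes y z y); rewrite !inE !eqxx.
have n12 : Fc P1 <> Fc P2.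
  by move=> E; have := face_eq_qedge c1 c2 E e1x; rewrite (no y z x).
have n13 : Fc P1 <> Fc P3.
  by move=> E; have := face_eq_qedge c1 c3 E e1y; rewrite (no z x y).
have n23 : Fc P2 <> Fc P3.
  by move=> E; have := face_eq_qedge c2 c3 E e2y; rewrite (no z x y).
(* A three-element index type; each edge of the theta graph lies on exactly two of the three
   cycles. *)
pose P (i : option bool) := match i with
  | None => (a, x, c, y) | Some true => (a, y, c, z) | Some false => (a, z, c, x) end.
pose PH (i : option bool) := match i with
  | None => P1 | Some true => P2 | Some false => P3 end.
have ce i : pcell (P i) (PH i) by case: i => [[]|].
have n21 : Fc P2 <> Fc P1 by move=> E; exact/n12/esym.
have n31 : Fc P3 <> Fc P1 by move=> E; exact/n13/esym.
have n32 : Fc P3 <> Fc P2 by move=> E; exact/n23/esym.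
have pr i u v : qedge (P i) u v -> exists j, qedge (P j) u v /\
    Fc (PH i) <> Fc (PH j).
  case: i => [[]|]; rewrite /P => /edge_of[k kk H]; move: kk;
    rewrite !inE => /orP[]/eqP E; rewrite E in H.
  - by exists None; split => //; apply: yes H; rewrite !inE eqxx ?orbT.
  - by exists (Some false); split => //; apply: yes H; rewrite !inE eqxx ?orbT.
  - by exists (Some true); split => //; apply: yes H; rewrite !inE eqxx ?orbT.
  - by exists None; split => //; apply: yes H; rewrite !inE eqxx ?orbT.
  - by exists (Some false); split => //; apply: yes H; rewrite !inE eqxx ?orbT.
  - by exists (Some true); split => //; apply: yes H; rewrite !inE eqxx ?orbT.
have edges u v : sedge u v -> exists2 k, k \in [:: x; y; z] &
    (u \in diag a c) && (v == k) || (u == k) && (v \in diag a c).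
  move=> uv; have [j] := cell_family_edge hS cf injf ce pr hcon nb None uv.
  case: j => [[]|]; rewrite /P => /edge_of[k kk H]; exists k => //;
    move: kk; rewrite !inE => kk.
  - by case/orP: kk => ->; rewrite ?orbT.
  - by case/orP: kk => ->; rewrite ?orbT.
  - by case/orP: kk => ->; rewrite ?orbT.
apply: hiso; apply: (@k23_map_isomorphic G a c x y z).
- rewrite /= !inE !negb_or ac nax nay naz ncx ncy ncz xy yz.
  by rewrite [x == z]eq_sym zx.
- move=> u; have [v /edges[k]] := nb u; rewrite !inE => kk /orP[]/andP[].
    by case/orP => -> _; rewrite ?orbT.
  by move=> /eqP-> _; rewrite kk !orbT.
- exact: k23_map_hom.
- move=> u v /edges[k]; rewrite !inE => kk.
  have ka : (k == a) || (k == c) = false.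
    apply/negP => /orP[]/eqP E; move: kk; rewrite E.
      by rewrite (negPf nax) (negPf nay) (negPf naz).
    by rewrite (negPf ncx) (negPf ncy) (negPf ncz).
  by case/orP=> /andP[]; [move=> -> /eqP-> | move=> /eqP-> ->]; rewrite ka.
Qed.

(** If all 4-cycles at [uv] coincide, one closed disc covers a neighbourhood of the midpoint, or the
    edge alone does when there is no such cycle. Either parametrisation has the midpoint on the
    boundary of the diamond, against [boundary_point_not_nbhs]. *)
Lemma edge_two_quads u v : sedge u v -> exists c d c' d',
  [/\ quad u v c d, quad u v c' d' & ~~ same_quad (u, v, c, d) (u, v, c', d')].
Proof.
move=> uv; apply: contrapT => H.
have {}H c d c' d' : quad u v c d -> quad u v c' d' ->
    same_quad (u, v, c, d) (u, v, c', d').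
  by move=> q q'; apply: contrapT => /negP nq; apply: H; exists c, d, c', d'.
have /choice[PH PHP] : forall p, exists Phi, quadP p -> pcell p Phi.
  move=> p; have [q|nq] := boolP (quadP p); last by exists (fun _ => f w0).
  by have [Phi ?] := quad_cell q; exists Phi.
(* [Z1] gathers the closed faces not incident with [uv], [Z2] the other edges; both are closed and
   miss the midpoint. *)
pose Z1 := \bigcup_(p in [set p | quadP p && ~~ qedge p u v]) Dc (PH p).
pose ed (e : G * G) := (fun s : R => fpt (edge_pt e.1 e.2 s)) @` `[0, 1]%classic.
pose bad (e : G * G) := [&& sedge e.1 e.2, e != (u, v) & e != (v, u)].
pose Z2 := \bigcup_(e in [set e | bad e]) ed e.
have clZ1 : closed Z1.
  apply: closed_bigcup => [|p /andP[qp _]]; first exact: finite_finset.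
  by move: (PHP p qp); case: p {qp} => [[[a b] c] d] /(cell_closed hS).
have ced (x y : G) : sedge x y -> {within `[0, 1]%classic,
    continuous (fun s : R => fpt (edge_pt x y s))}.
  move=> xy; apply: (within_comp (B := setT)) => //; last exact: continuous_subspaceT.
  apply: poly_pt_continuous => [|s].
    by apply: continuous_subspaceT; exact: edge_pt_continuous.
  by rewrite /= in_itv /= => /andP[? ?]; exact: edge_pt_real.
have hdS : hausdorff_space S by case: hS.
have clZ2 : closed Z2.
  apply: closed_bigcup => [|e /and3P[xy _ _]]; first exact: finite_finset.
  apply: compact_closed => //; apply: continuous_compact; first exact: ced.
  exact: segment_compact.
set m := fpt (edge_pt u v (1 / 2)).
have nm : nbhs m (~` (Z1 `|` Z2)).
  apply: open_nbhs_nbhs; split; first by apply: closed_openC; exact: closedU.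
  move=> [[p /andP[qp np] mp]|[[x y] /and3P[/= xy n1 n2] [s /=]]].
    by move/negP: np; apply; exact: pcell_midpoint (PHP p qp) uv mp.
  rewrite in_itv /= => /andP[s0 s1] E.
  have {}E := fpt_inj injf (edge_pt_real xy s0 s1) (edge_pt_real uv h0 h1) E.
  have [m1 m2] := midpoint_neq0 uv.
  have supp k : edge_pt x y s k != 0 -> k = x \/ k = y.
    rewrite /edge_pt; have [|_] := eqVneq k x; first by left.
    have [|_] := eqVneq k y; first by right.
    by rewrite !mulr0 addr0 eqxx.
  rewrite -E in m1 m2; have nuv := sedge_neq uv.
  case: (supp _ m1) => E1; case: (supp _ m2) => E2; subst;
    by rewrite ?eqxx // in nuv n1 n2.
(* Near the midpoint, the surface consists of the edge and of the faces
   incident with it. *)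
have near_m (y : S) : (~` (Z1 `|` Z2)) y ->
    (exists s, [/\ 0 <= s, s <= 1 & y = fpt (edge_pt u v s)]) \/
    (exists c d Phi, cell f w0 u v c d Phi /\ Fc Phi y).
  move=> nZ; have [[W _ WE]|ny] := pselect (range f y).
    left; have [x [x' [s [xx' s0 s1 E]]]] := GR_cases nb (set_valP W).
    have WE' : y = fpt (edge_pt x x' s).
      rewrite -WE; congr f; apply: val_inj; rewrite val_poly_pt //.
      exact: edge_pt_real.
    have [xu|nxu] := eqVneq (x, x') (u, v); first by case: xu WE' => -> -> ?; exists s.
    have [xv|nxv] := eqVneq (x, x') (v, u).
      case: xv WE' => -> -> E'; exists (1 - s); split; [lra|lra|].
      by rewrite edge_ptC; have -> : 1 - (1 - s) = s by ring.
    case: nZ; right; exists (x, x'); first by rewrite /= /bad xx' nxu nxv.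
    by exists s; rewrite //= in_itv /= s0.
  right; have [p [Phi [qp cel yF]]] := point_face ny.
  have [e|ne] := boolP (qedge p u v); last first.
    case: nZ; left; exists p; first by rewrite /= qp ne.
    have : Fc (PH p) y.
      by rewrite -(same_quad_face cel (PHP p qp) (same_quad_refl p)).
    by move=> [z /= /ltW z1 <-]; exists z.
  move: cel e; case: p {qp} => [[[a b] c] d] cel e.
  have [c' [d' [P' [cel' [E _]]]]] := cell_align cel e.
  by exists c', d', P'; rewrite -E.
have [[c [d q]]|nq] := pselect (exists c d, quad u v c d).
  have cel : cell f w0 u v c d (PH (u, v, c, d)) by exact: (PHP (u, v, c, d) q).
  have [_ cP iP bP _] := cel.
  have lm : l1 ((1 / 2, 1 / 2) : R * R) = 1.
    by rewrite /l1 /= !ger0_norm; lra.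
  apply: (@boundary_point_not_nbhs R S [set z | l1 z <= 1] (PH (u, v, c, d))) => //.
  - exact: gauge_le1_compact (gauge_l1 R).
  - by rewrite /= lm.
  rewrite bP // quad_pt_pos //=; apply: filterS nm => y /near_m[].
    move=> [s [s0 s1 ->]].
    have [|z z1 <-] := cell_edge_point (u := u) (v := v) cel _ s0 s1.
      by rewrite /quad_edge !eqxx.
    by exists z; rewrite //= z1.
  move=> [c' [d' [Phi [cel' yF]]]]; have [q' _ _ _ _] := cel'.
  have : Fc (PH (u, v, c, d)) y.
    by rewrite (@same_quad_face (u, v, c, d) (u, v, c', d') _ Phi cel cel' (H _ _ _ _ q q')).
  by move=> [z /= /ltW z1 <-]; exists z.
(* In the absence of a 4-cycle at [uv], the edge is parametrised by a side of the diamond, so that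
   the same lemma excludes this case. *)
pose K := [set z : R * R | l1 z <= 1] `&`
  ((fst @^-1` [set x | 0 <= x] `&` snd @^-1` [set x | 0 <= x]) `&`
  (fun z => z.1 + z.2) @^-1` [set 1]).
have fc := @fst_continuous R; have sc := @snd_continuous R.
have cK : compact K.
  apply: compact_closedI; first exact: gauge_le1_compact (gauge_l1 R).
  apply: closedI; first apply: closedI.
  - by apply: closed_comp => [z _|]; [exact: fc | exact: closed_ge].
  - by apply: closed_comp => [z _|]; [exact: sc | exact: closed_ge].
  apply: closed_comp => [z _|]; last exact: closed_eq.
  exact: (contD fc sc).
have K01 z : K z -> 0 <= z.1 /\ z.1 <= 1.
  by move=> [_ [[/= x0 y0] xy]]; split => //; rewrite -xy lerDl.
apply: (@boundary_point_not_nbhs R S K (fun z => fpt (edge_pt u v z.1))) => //.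
- by move=> z [].
- split; first by rewrite /= /l1 /= !ger0_norm; lra.
  by split; [split => /=; lra | rewrite /=; lra].
- have := @within_comp (R * R)%type R S K `[0, 1]%classic (fun z : R * R => z.1)
    (fun s : R => fpt (edge_pt u v s)).
  apply; last exact: ced.
    exact: continuous_subspaceT.
  by move=> z /K01[x0 x1]; rewrite /= in_itv /= x0.
- move=> z w Kz Kw E; have [z0 z1] := K01 z Kz; have [w0' w1] := K01 w Kw.
  have {}E := fpt_inj injf (edge_pt_real uv z0 z1) (edge_pt_real uv w0' w1) E.
  have := congr1 (fun h => h u) E.
  rewrite /edge_pt /= eqxx (negPf (sedge_neq uv)) !mulr1 !mulr0 !addr0 => E1.
  case: Kz => _ [_ /= zE]; case: Kw => _ [_ /= wE].
  rewrite (surjective_pairing z) (surjective_pairing w); congr pair => //.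
  by rewrite E1 in zE; lra.
apply: filterS nm => y /near_m[].
  move=> [s [s0 s1 ->]]; exists (s, 1 - s) => //; split.
    by rewrite /= /l1 /= !ger0_norm ?subr_ge0 //; lra.
  by split; [split => //=; lra | rewrite /=; lra].
by move=> [c [d [Phi [[q _ _ _ _] _]]]]; case: nq; exists c, d.
Qed.

Lemma quadrangulation_regular : lovasz_regular G.
Proof.
have two a c : a != c -> (#|CN (diag a c)| <= 2)%N.
  move=> ac; rewrite leqNgt; apply/negP => /card_gt2P[x [y [z [[xC yC zC] [xy yz zx]]]]].
  move: xC yC zC; rewrite !mem_CN2 => /andP[ax cx] /andP[ay cy] /andP[az cz].
  exact: (at_most_two_common ac xy yz zx ax cx ay cy az cz).
have deg u : (2 < #|nbh u|)%N.
  have [v uv] := nb u; have [c [d [c' [d' [q q' nsq]]]]] := edge_two_quads uv.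
  have [_ vc cd du /andP[uc vd]] := and5P q.
  have [_ vc' cd' du' /andP[uc' vd']] := and5P q'.
  (* If [d = d'], then [c] and [c'] differ, and [v] and [d] have the three common neighbours [u],
     [c], [c']. Otherwise [v], [d], [d'] are three neighbours of [u]. *)
  have [dd|nd] := eqVneq d d'.
    subst d'; have ncc : c != c'.
      by apply: contraNneq nsq => ->; exact: same_quad_refl.
    exfalso; apply: (@at_most_two_common v d u c c') => //;
      by rewrite 1?sedge_sym // 1?eq_sym.
  apply/card_gt2P; exists v, d, d'; rewrite !mem_nbh uv.
  by rewrite ![sedge u _]sedge_sym du du' vd nd eq_sym vd'.
split => // [u v uv|u]; last exact: ltn_trans (deg u).
(* A dominated vertex [u] would share all its neighbours, at least three, with [v]. *)
apply: contrapT => /eqP nuv; have := deg u; rewrite ltnNge => /negP; apply.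
apply: leq_trans (two u v nuv); apply: subset_leq_card.
apply/fintype.subsetP => x xu; rewrite mem_CN2 -!mem_nbh xu.
by move/fintype.subsetP: uv; apply.
Qed.

Definition quad_rep p := choose [pred p' | quadP p' && same_quad p p'] p.

Lemma quad_repP p : quadP p -> quadP (quad_rep p) /\ same_quad p (quad_rep p).
Proof.
move=> q; apply/andP; apply: (@chooseP _ [pred p' | quadP p' && same_quad p p']).
by rewrite /= q same_quad_refl.
Qed.

Lemma quad_rep_eq p p' : quadP p -> quadP p' -> same_quad p p' ->
  quad_rep p = quad_rep p'.
Proof.
move=> q q' sq; rewrite /quad_rep.
rewrite (@eq_choose _ _ [pred r | quadP r && same_quad p' r]).
  by apply: choose_id; rewrite /= ?q ?q' ?same_quad_refl // same_quad_sym sq.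
move=> r; rewrite /=; congr andb; apply/idP/idP; last exact: same_quad_trans.
by apply: same_quad_trans; rewrite same_quad_sym.
Qed.

Lemma quadrangulation_homeomorphic : homeomorphic (orbit_space (lovasz_space R G)) S.
Proof.
have reg := quadrangulation_regular.
have [u0 [v0 [_ [uv0 _ _ _]]]] := GR_cases nb (set_valP w0).
have rt := elift_real reg uv0 (@ler01 R) (lexx 1).
pose t0 : lovasz_space R G := SigSub (mem_set rt).
have /choice[PH PHP] : forall p, exists Phi, quadP p -> pcell p Phi.
  move=> p; have [q|nq] := boolP (quadP p); last by exists (fun _ => f w0).
  by have [Phi ?] := quad_cell q; exists Phi.
(* Two listings of a 4-cycle have the same face but possibly incompatible parametrisations inside,
   so only one listing of each is kept. *)
pose P p := quadP p && (quad_rep p == p).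
have PE p p' : P p -> P p' -> same_quad p p' -> p = p'.
  move=> /andP[q /eqP r] /andP[q' /eqP r'] sq.
  by rewrite -r -r'; exact: quad_rep_eq.
have Prep p : quadP p -> P (quad_rep p).
  move=> q; have [q' sq] := quad_repP q; rewrite /P q' /=; apply/eqP.
  by apply: quad_rep_eq; rewrite // same_quad_sym.
pose Q p := let: (a, b, c, d) := p in
  @quotient_cell R G t0 a b c d.
pose fq := @quotient_embedding R G t0.
have Qcell p : quadP p -> cell_of fq w0 p (Q p).
  by case: p => [[[a b] c] d] q; exact: (quotient_cellP reg t0 w0 q).
have ifq : injective fq by exact: (quotient_embedding_inj reg).
have within_cell (T : topologicalType) (g : _ -> T) p Phi :
    cell_of g w0 p Phi -> {within [set z | l1 z <= 1], continuous Phi}.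
  by case: p => [[[a b] c] d] [].
have inj_cell (T : topologicalType) (g : _ -> T) p Phi z w :
    cell_of g w0 p Phi -> l1 z <= 1 -> l1 w <= 1 -> Phi z = Phi w -> z = w.
  by case: p => [[[a b] c] d] [_ _ iP _ _]; exact: iP.
pose qpt p := let: (a, b, c, d) := p in @quad_pt R G a b c d.
have bd_cell (T : topologicalType) (g : _ -> T) p Phi z :
    cell_of g w0 p Phi -> l1 z = 1 -> Phi z = g (poly_pt w0 (qpt p z)).
  by case: p => [[[a b] c] d] [_ _ _ bP _]; exact: bP.
have range_cell (T : topologicalType) (g : _ -> T) p Phi z :
    cell_of g w0 p Phi -> l1 z <= 1 -> range g (Phi z) -> l1 z = 1.
  by case: p => [[[a b] c] d] cel; exact: (cell_range cel).
have real_qpt p z : quadP p -> l1 z = 1 ->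
    realization R (graph_complex G) (qpt p z).
  by case: p => [[[a b] c] d]; exact: quad_pt_real.
(* On the boundary both cells agree with the embedded graph; a common interior
   point determines the cycle. *)
have kernel (T T' : topologicalType) (g : _ -> T) (g' : _ -> T')
    (A : _ -> R * R -> T) (B : _ -> R * R -> T') :
    injective g ->
    (forall p, quadP p -> cell_of g w0 p (A p)) ->
    (forall p, quadP p -> cell_of g' w0 p (B p)) ->
    (forall p p' z w, quadP p -> quadP p' -> l1 z < 1 -> l1 w < 1 ->
      A p z = A p' w -> same_quad p p') ->
    forall p p' z w, P p -> P p' -> l1 z <= 1 -> l1 w <= 1 ->
      A p z = A p' w -> B p z = B p' w.
  move=> ig cA cB sq p p' z w Pp Pp' z1 w1 E.
  have [qp _] := andP Pp; have [qp' _] := andP Pp'.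
  have [zl|zl] := ltP (l1 z) 1.
    have wl : l1 w < 1.
      rewrite lt_neqAle w1 andbT; apply/eqP => w1'.
      have : range g (A p z) by rewrite E (bd_cell _ _ _ _ _ (cA p' qp') w1'); eexists.
      by move/(range_cell _ _ _ _ _ (cA p qp) z1) => z1'; rewrite z1' ltxx in zl.
    have pp := PE p p' Pp Pp' (sq p p' z w qp qp' zl wl E); subst p'.
    by rewrite (inj_cell _ _ _ _ _ _ (cA p qp) z1 w1 E).
  have {}zl : l1 z = 1 by apply/le_anti; rewrite z1.
  have wl : l1 w = 1.
    apply: (range_cell _ _ _ _ _ (cA p' qp') w1).
    by rewrite -E (bd_cell _ _ _ _ _ (cA p qp) zl); eexists.
  rewrite (bd_cell _ _ _ _ _ (cB p qp) zl) (bd_cell _ _ _ _ _ (cB p' qp') wl).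
  congr (g' (poly_pt w0 _)).
  apply: (fpt_inj (w0 := w0) ig (real_qpt p z qp zl) (real_qpt p' w qp' wl)).
  by rewrite -(bd_cell _ _ _ _ _ (cA p qp) zl) -(bd_cell _ _ _ _ _ (cA p' qp') wl).
(* A common inner point identifies the faces, and a face determines the edges of its cycle. *)
have sqS p p' z w : quadP p -> quadP p' -> l1 z < 1 -> l1 w < 1 ->
    PH p z = PH p' w -> same_quad p p'.
  move=> qp qp' z1 w1 E; apply: qedge_sub_same_quad => // u v.
  apply: (face_eq_qedge (PHP p qp) (PHP p' qp')).
  move: (PHP p qp) (PHP p' qp') z1 w1 E.
  case: p {qp} => [[[a b] c] d]; case: p' {qp'} => [[[a' b'] c'] d'] cel cel' z1 w1.
  exact: (cell_face_eq cel cel' z1 w1).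
(* An inner point has positive weight on exactly one diagonal, and the involution moves this weight
   to the other diagonal of the same cycle; the orbit thus determines the cycle. *)
have sqQ p p' z w : quadP p -> quadP p' -> l1 z < 1 -> l1 w < 1 ->
    Q p z = Q p' w -> same_quad p p'.
  case: p => [[[a b] c] d]; case: p' => [[[a' b'] c'] d'] q q' z1 w1 /orbit_ofP E.
  have Tac : 0 < \val (lift_pt t0 (Lam a b c d z)) (diag a c).
    by rewrite val_Lam ?ltW // Lam_diag // subr_gt0.
  have CE := quad_CN reg q; have CE' := quad_CN reg q'.
  have CR := quad_CN reg (quad_rot q).
  case: E => E.
    have ac : diag a c = diag a' c'.
      apply/eqP; apply: contraTT Tac => nac.
      rewrite -E val_Lam ?ltW // Lam_diag0 ?ltxx //; exact: diagonal_quad q.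
    by apply/orP; left; rewrite -CE -CE' ac !eqxx.
  have bd : diag b d = diag a' c'.
    apply/eqP; apply: contraTT Tac => nac.
    rewrite -[lift_pt t0 (Lam a b c d z)]z2actK -E (act_diag reg _ q).
    rewrite val_Lam ?ltW // Lam_diag0 ?ltxx //; exact: diagonal_quad (quad_rot q).
  by apply/orP; right; rewrite bd -CE' -bd CR finset.setUC !eqxx.
have edge_rep u v : sedge u v -> exists2 p, P p & qedge p u v.
  move=> uv; have [c [d [_ [_ [q _ _]]]]] := edge_two_quads uv.
  have qp : quadP (u, v, c, d) by [].
  exists (quad_rep (u, v, c, d)); first exact: Prep.
  have [_ sq] := quad_repP qp; rewrite -(same_quad_qedge u v sq) qedgeE.
  by rewrite !inE !eqxx.
have [_ hdS _ _] := hS.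
apply: (@finite_cover_homeomorphic _ P _ [set z | l1 z <= 1]
  (gauge_le1_compact (gauge_l1 R)) _ _ Q PH) => //.
- by apply: orbit_space_hausdorff; exact: polyhedron_hausdorff.
- by move=> p /andP[q _]; exact: within_cell (Qcell p q).
- by move=> p /andP[q _]; exact: within_cell (PHP p q).
- move=> xi; have [T <-] := orbit_of_surj xi.
  have [[u [v [s [uv s0 s1 E]]]]|[a [b [c [d [z [q z1 E]]]]]]] :=
      LR_cases reg (set_valP T).
    have [p Pp e] := edge_rep u v uv; have [qp _] := andP Pp.
    have cel := Qcell p qp.
    have [z z1 zE] : exists2 z, l1 z = 1 & Q p z = fq (poly_pt w0 (edge_pt u v s)).
      move: e cel; case: (p) => [[[a b] c] d] e cel.
      exact: (cell_edge_point cel e s0 s1).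
    exists p, z; split => //; first by rewrite /= z1.
    rewrite zE; apply: (quotient_embeddingE reg) => [B dB|].
      by rewrite [\val T]E elift_diag0.
    rewrite val_poly_pt; last exact: edge_pt_real.
    by rewrite [\val T]E shadow_elift.
  have qp : quadP (a, b, c, d) by [].
  have [q' sq] := quad_repP qp; have Pr := Prep _ qp.
  suff : Fc (Q (quad_rep (a, b, c, d))) (orbit_of T).
    by move=> [w /= /ltW w1 wE]; exists (quad_rep (a, b, c, d)), w.
  have Tac : 0 < \val T (diag a c) by rewrite [\val T]E Lam_diag // subr_gt0.
  move: q' sq; case: (quad_rep _) => [[[a' b'] c'] d'] q' sq.
  rewrite /Q quotient_cell_interior //.
  case/orP: sq => /andP[/eqP E1 /eqP E2].
    by exists T => //; rewrite /mkset -E1.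
  exists (z2act T); last exact: orbit_of_act.
  by rewrite /mkset (act_diag reg _ q') -E1.
- move=> y; have [[W _ <-]|ny] := pselect (range f y).
    have [u [v [s [uv s0 s1 E]]]] := GR_cases nb (set_valP W).
    have [p Pp e] := edge_rep u v uv; have [qp _] := andP Pp.
    have [z z1 zE] := pcell_edge (PHP p qp) e s0 s1.
    exists p, z; split => //; first by rewrite /= z1.
    rewrite zE; congr f; apply: val_inj; rewrite val_poly_pt //.
    exact: edge_pt_real.
  have [p [Phi [qp cel yF]]] := point_face ny.
  have [q' sq] := quad_repP qp; have Pr := Prep _ qp.
  move: yF; rewrite (same_quad_face cel (PHP _ q') sq) => -[z /= /ltW z1 zE].
  by exists (quad_rep p), z.
- move=> p p' z w Pp Pp' z1 w1; split.
    exact: (kernel _ _ fq f Q PH ifq Qcell PHP sqQ).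
  exact: (kernel _ _ f fq PH Q injf PHP Qcell sqS).
Qed.

End Direct.

Theorem quadrangulation_double_cover (R : realType) (G : sgraph) (S : topologicalType)
    (f : polyhedron R (graph_complex G) -> S) :
  ~ sg_isomorphic G K23 -> sg_connected G -> ~ sg_bipartite G ->
  quadrangulation f -> (forall p : seq G, four_cycle p -> facial f p) ->
  double_cover (lovasz_space R G) S.
Proof.
move=> hiso hcon hbip hq hfac.
have nb := nonbipartite_neighbor hcon hbip.
have [u _] : exists u : G, True.
  apply: contrapT => nG; apply: hbip; exists (fun _ => true) => x.
  by case: nG; exists x.
have [v uv] := nb u.
have rt := edge_pt_real uv (@ler01 R) (lexx 1).
exact: (quadrangulation_homeomorphic (SigSub (mem_set rt)) hcon nb hiso hbip hq hfac).
Qed.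


Theorem theorem1p1 (R : realType) (G : sgraph) :
  (forall (S : topologicalType) (f : polyhedron R (graph_complex G) -> S),
      ~ sg_isomorphic G K23 ->
      sg_connected G ->
      ~ sg_bipartite G ->
      quadrangulation f ->
      (forall p : seq G, four_cycle p -> facial f p) ->
      double_cover (lovasz_space R G) S)
  /\
  (closed_surface R (lovasz_space R G) ->
   (forall u v : G, u <> v -> ~ dominates v u) ->
   ~ sg_contains G K23 ->
   exists f : polyhedron R (graph_complex G) -> orbit_space (lovasz_space R G),
     quadrangulation f /\
     (forall p : seq G, four_cycle p -> facial f p)).
Proof.
split=> [S f|]; first exact: quadrangulation_double_cover.
exact: lovasz_quadrangulation.
Qed.
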